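(* (i) Let $(U,A)$ be a left Hopf algebroid and let $A$ be a stable anti Yetter-Drinfel'd contramodule over $U$. Then $C(U,A)$ becomes a cyclic operad with multiplication. (ii) Let $(U,A)$ be a left Hopf algebroid such that $U$ is finitely generated projective as a right $A$-module via $u\cdot a=t(a)u$, and let $M$ be a braided commutative Yetter-Drinfel'd algebra over $U$. If $A$ is a stable anti Yetter-Drinfel'd contramodule over $U$, then $C(U,M)$ becomes a cyclic operad with multiplication.
   Context: $k$ is a commutative ring, algebras are unital associative $k$-algebras, $\otimes=\otimes_k$. Left bialgebroid $(U,A)$: a $k$-algebra $U$ with $k$-algebra maps $s:A\to U$, $t:A^{\mathrm{op}}\to U$ with commuting images, and an $A$-coring structure $\Delta:U\to U\otimes_AU$, $u\mapsto u_{(1)}\otimes_Au_{(2)}$, $\varepsilon:U\to A$, on $U$ with bimodule structure $a\cdot u\cdot b=s(a)t(b)u$, where $U\otimes_AU=U\otimes U/\langle t(a)u\otimes v-u\otimes s(a)v\rangle$. One requires that $\Delta$ takes values in $\{\sum u_i\otimes_A u_i'\mid\sum u_it(a)\otimes u'_i=\sum u_i\otimes u'_is(a)\ \forall a\}$ and is a unital algebra map into it, $\varepsilon(1)=1$, $\varepsilon(uv)=\varepsilon(us(\varepsilon(v)))=\varepsilon(ut(\varepsilon(v)))$. Left Hopf algebroid: $U\otimes_{A^{\mathrm{op}}}U\to U\otimes_AU$, $u\otimes v\mapsto u_{(1)}\otimes u_{(2)}v$, is bijective, where $U\otimes_{A^{\mathrm{op}}}U=U\otimes U/\langle ut(a)\otimes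 v-u\otimes t(a)v\rangle$; $u_+\otimes u_-$ is the preimage of $u\otimes_A1$. Left $U$-modules are $A$-bimodules by $anb=s(a)t(b)n$; $A$ is a left $U$-module by $u\cdot a=\varepsilon(us(a))$ (canonical action). Right $U$-contramodule: a right $A$-module $M$ with $\gamma:\mathrm{Hom}_{A^{\mathrm{op}}}(U,M)=\{f\mid f(t(a)u)=f(u)a\}\to M$ such that $\gamma(f(s(a)-))=\gamma(f)a$; $\gamma(u\mapsto\gamma(v\mapsto g(u\otimes v)))=\gamma(u\mapsto g(u_{(1)}\otimes u_{(2)}))$ for all $g:U\otimes_AU\to M$ with $g(u\otimes t(a)v)=g(u\otimes v)a$; $\gamma(m\varepsilon(-))=m$. It has the left $A$-action $am:=\gamma(m\varepsilon(-\,s(a)))$. An anti Yetter-Drinfel'd (aYD) contramodule is a left $U$-module right $U$-contramodule $M$ whose $A$-bimodule structures coincide, with $u(\gamma(f))=\gamma\big(w\mapsto u_{+(2)}f(u_-wu_{+(1)})\big)$; it is stable if $\gamma(u\mapsto um)=m$ for all $m$. When $A$ is an aYD contramodule, its left $U$-action is the canonical one and its right $A$-action is multiplication; write $\gamma_A$ for its contraaction. A left $U$-comodule is a left $A$-module $N$ with coassociative counital left $A$-linear coaction $n\mapsto n_{(-1)}\otimes_An_{(0)}\in U\otimes_AN$ ($t(a)u\otimes n=u\otimes an$), with $na:=\varepsilon(n_{(-1)}s(a))n_{(0)}$. A Yetter-Drinfel'd module over $U$ is a left $U$-module left $U$-comodule $N$ whose $A$-bimodule structures coincide, with $(u_{(1)}n)_{(-1)}u_{(2)}\otimes_A(u_{(1)}n)_{(0)}=u_{(1)}n_{(-1)}\otimes_Au_{(2)}n_{(0)}$.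 A Yetter-Drinfel'd algebra is such an $N$ that is a monoid both in left $U$-modules and in left $U$-comodules (product $\cdot_N$); it is braided commutative if $n\cdot_Nn'=(n_{(-1)}n')\cdot_Nn_{(0)}$. Contraaction on $M$ in (ii): with $U^*=\{\phi:U\to A\mid\phi(t(a)u)=\phi(u)a\}$, a dual basis $\{e_j\}\subset U,\{e^j\}\subset U^*$ ($u=\sum_jt(e^j(u))e_j$) and $(u\rightharpoondown\phi)(v)=\varepsilon(u_+t(\phi(u_-v)))$, the aYD contramodule structure on $M$ induced from that of $A$ has contraaction $\gamma(f)=\sum_j\gamma_A\big(f(e_j)_{(-1)}\rightharpoondown e^j\big)\,f(e_j)_{(0)}$. $C(U,M)$: $C^n(U,M)=\mathrm{Hom}_{A^{\mathrm{op}}}(U^{\otimes_{A^{\mathrm{op}}}n},M)$, i.e. $k$-multilinear $f(u^1,\ldots,u^n)\in M$ with $f(\ldots,u^it(a),u^{i+1},\ldots)=f(\ldots,u^i,t(a)u^{i+1},\ldots)$ and $f(t(a)u^1,\ldots)=f(u^1,\ldots)a$; $C^0=M$. Cyclic operator: $(\tau f)(u^1,\ldots,u^n)=\gamma\big(w\mapsto u^1_+f(u^2_+,\ldots,u^n_+,u^n_-\cdots u^1_-w)\big)$, and $\tau m=\gamma(u\mapsto um)$ in degree $0$. Operad structure on $C(U,A)$ in (i): $(\varphi\circ_i\psi)(u^1,\ldots,u^{p+q-1})=\varphi\big(u^1,\ldots,u^{p-i},s(\psi(u^{p-i+1}_{(1)},\ldots,u^{p+q-i}_{(1)}))u^{p-i+1}_{(2)}\cdots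 u^{p+q-i}_{(2)},u^{p+q-i+1},\ldots,u^{p+q-1}\big)$, $\mathbb1=\varepsilon$, $\mu(u,v)=\varepsilon(uv)$, $e=1_A$. Operad structure on $C(U,M)$ in (ii), for $f\in C^p$, $g\in C^q$, $i=1,\ldots,p$: $(f\circ_ig)(u^1,\ldots,u^{p+q-1})=f\big(u^1_{(1)},\ldots,u^{i-1}_{(1)},g(u^i_{(1)},\ldots,u^{i+q-1}_{(1)})_{(-1)}u^i_{(2)}\cdots u^{i+q-1}_{(2)},u^{i+q},\ldots,u^{p+q-1}\big)\cdot_M\big(u^1_{(2)}\cdots u^{i-1}_{(2)}\,g(u^i_{(1)},\ldots,u^{i+q-1}_{(1)})_{(0)}\big)$, $\mathbb1(u)=\varepsilon(u)1_M$, $\mu(u,v)=\varepsilon(uv)1_M$, $e=1_M$. (Non-$\Sigma$) operad: $k$-modules $O(n)$, $n\ge0$, $\mathbb 1\in O(1)$, bilinear $\circ_i:O(p)\otimes O(q)\to O(p+q-1)$, zero if $p<i$ or $p=0$, with $\varphi\circ_i\mathbb1=\varphi$ for $i\le p$, $\mathbb1\circ_1\varphi=\varphi$, and for $\varphi\in O(p),\psi\in O(q),\chi\in O(r)$: $(\varphi\circ_i\psi)\circ_j\chi$ equals $(\varphi\circ_j\chi)\circ_{i+r-1}\psi$ if $j<i$, $\varphi\circ_i(\psi\circ_{j-i+1}\chi)$ if $i\le j<q+i$, $(\varphi\circ_{j-q+1}\chi)\circ_i\psi$ if $j\ge q+i$. With multiplication: $\mu\in O(2)$, $e\in O(0)$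 with $\mu\circ_1\mu=\mu\circ_2\mu$, $\mu\circ_1e=\mu\circ_2e=\mathbb1$. Cyclic: $k$-linear $\tau:O(n)\to O(n)$ with $\tau(\varphi\circ_1\psi)=\tau\psi\circ_q\tau\varphi$ ($p,q\ge1$), $\tau(\varphi\circ_i\psi)=\tau\varphi\circ_{i-1}\psi$ ($q\ge0$, $2\le i\le p$), $\tau\mathbb1=\mathbb1$, $\tau^{n+1}=\mathrm{id}_{O(n)}$; cyclic with multiplication: moreover $\tau\mu=\mu$.
   Formalization: In (ii) the contraaction induced on M is also assumed stable (this does not follow from stability of A, and τ=id on C^0 forces it), and cyclicity is stated for the compositions ∘_i with inputs numbered from the right, since the given left numbering is incompatible with τ. *)

(* Defs.v *)
From HB Require Import structures.
From mathcomp Require Import all_boot all_algebra.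
From mathcomp Require Import boolp functions.

Set Implicit Arguments.
Unset Strict Implicit.
Unset Printing Implicit Defensive.

Import GRing.Theory.
Local Open Scope ring_scope.

(* Tensor products.  An element of a tensor product is given by a formal sum of
   elementary tensors, i.e. a list, and equality in the tensor product is the
   congruence on formal sums generated by the defining relations.  Hence
   "\sum_(x <- D u) g x.1 x.2" is the Sweedler expression g(u_(1), u_(2)).  The
   empty list is the zero tensor; opposites need no generator, since
   x (x) y + (-x) (x) y is congruent to 0 (x) y, hence to the empty sum. *)

Inductive fsum_cong (T : Type) (R : seq T -> seq T -> Prop) :
    seq T -> seq T -> Prop :=
| fsum_gen s t : R s t -> fsum_cong R s t
| fsum_refl s : fsum_cong R s s
| fsum_sym s t : fsum_cong R s t -> fsum_cong R t s
| fsum_trans s t r : fsum_cong R s t -> fsum_cong R t r -> fsum_cong R s r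
| fsum_catC s t : fsum_cong R (s ++ t) (t ++ s)
| fsum_cat s s' t t' :
    fsum_cong R s s' -> fsum_cong R t t' -> fsum_cong R (s ++ t) (s' ++ t').

Section Tensor.
Variables (k : comNzRingType) (A : Type) (X Y Z : lmodType k).

Inductive tens2_gen (l : A -> X -> X) (r : A -> Y -> Y) :
    seq (X * Y) -> seq (X * Y) -> Prop :=
| tens2Dl x x' y : tens2_gen l r [:: (x + x', y)] [:: (x, y); (x', y)]
| tens2Dr x y y' : tens2_gen l r [:: (x, y + y')] [:: (x, y); (x, y')]
| tens20l y : tens2_gen l r [:: (0, y)] [::]
| tens20r x : tens2_gen l r [:: (x, 0)] [::]
| tens2Z c x y : tens2_gen l r [:: (c *: x, y)] [:: (x, c *: y)]
| tens2A a x y : tens2_gen l r [:: (l a x, y)] [:: (x, r a y)].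

(* Equality in X (x) Y / < l(a)x (x) y - x (x) r(a)y >. *)
Definition tens2 l r := fsum_cong (tens2_gen l r).

Inductive tens3_gen (l1 : A -> X -> X) (r1 : A -> Y -> Y)
    (l2 : A -> Y -> Y) (r2 : A -> Z -> Z) :
    seq (X * Y * Z) -> seq (X * Y * Z) -> Prop :=
| tens3D1 x x' y z :
    tens3_gen l1 r1 l2 r2 [:: (x + x', y, z)] [:: (x, y, z); (x', y, z)]
| tens3D2 x y y' z :
    tens3_gen l1 r1 l2 r2 [:: (x, y + y', z)] [:: (x, y, z); (x, y', z)]
| tens3D3 x y z z' :
    tens3_gen l1 r1 l2 r2 [:: (x, y, z + z')] [:: (x, y, z); (x, y, z')]
| tens301 y z : tens3_gen l1 r1 l2 r2 [:: (0, y, z)] [::]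
| tens302 x z : tens3_gen l1 r1 l2 r2 [:: (x, 0, z)] [::]
| tens303 x y : tens3_gen l1 r1 l2 r2 [:: (x, y, 0)] [::]
| tens3Z12 c x y z :
    tens3_gen l1 r1 l2 r2 [:: (c *: x, y, z)] [:: (x, c *: y, z)]
| tens3Z23 c x y z :
    tens3_gen l1 r1 l2 r2 [:: (x, c *: y, z)] [:: (x, y, c *: z)]
| tens3A12 a x y z :
    tens3_gen l1 r1 l2 r2 [:: (l1 a x, y, z)] [:: (x, r1 a y, z)]
| tens3A23 a x y z :
    tens3_gen l1 r1 l2 r2 [:: (x, l2 a y, z)] [:: (x, y, r2 a z)].

(* Equality in X (x) Y (x) Z modulo l1(a)x (x) y (x) z = x (x) r1(a)y (x) z
   and x (x) l2(a)y (x) z = x (x) y (x) r2(a)z. *)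
Definition tens3 l1 r1 l2 r2 := fsum_cong (tens3_gen l1 r1 l2 r2).

End Tensor.

(* The coproduct takes its values in formal sums; the axioms only involve their
   classes in U (x)_A U and U (x)_A U (x)_A U. *)
Record bialgebroid (k : comNzRingType) (A U : algType k) := Bialgebroid {
  src : {lrmorphism A -> U};
  tgt : {linear A -> U};
  tgt1 : tgt 1 = 1;
  tgtM : forall a b, tgt (a * b) = tgt b * tgt a;
  src_tgtC : forall a b, src a * tgt b = tgt b * src a;
  cop : U -> seq (U * U);
  cou : {linear U -> A};
  tensA : seq (U * U) -> seq (U * U) -> Prop :=
    tens2 (fun a u => tgt a * u) (fun a v => src a * v);
  cop_linear : forall c u v,
    tensA (cop (c *: u + v)) ([seq (c *: x.1, x.2) | x <- cop u] ++ cop v);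
  cop_src : forall a u,
    tensA (cop (src a * u)) [seq (src a * x.1, x.2) | x <- cop u];
  cop_tgt : forall a u,
    tensA (cop (tgt a * u)) [seq (x.1, tgt a * x.2) | x <- cop u];
  cou_src : forall a u, cou (src a * u) = a * cou u;
  cou_tgt : forall a u, cou (tgt a * u) = cou u * a;
  cop_coassoc : forall u,
    tens3 (fun a x => tgt a * x) (fun a y => src a * y)
          (fun a y => tgt a * y) (fun a z => src a * z)
      [seq (y.1, y.2, x.2) | x <- cop u, y <- cop x.1]
      [seq (x.1, y.1, y.2) | x <- cop u, y <- cop x.2];
  counitl : forall u, \sum_(x <- cop u) src (cou x.1) * x.2 = u;
  counitr : forall u, \sum_(x <- cop u) tgt (cou x.2) * x.1 = u;
  cop_takeuchi : forall a u,
    tensA [seq (x.1 * tgt a, x.2) | x <- cop u]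
          [seq (x.1, x.2 * src a) | x <- cop u];
  cop1 : tensA (cop 1) [:: (1, 1)];
  copM : forall u v,
    tensA (cop (u * v)) [seq (x.1 * y.1, x.2 * y.2) | x <- cop u, y <- cop v];
  cou1 : cou 1 = 1;
  couM_src : forall u v, cou (u * v) = cou (u * src (cou v));
  couM_tgt : forall u v, cou (u * v) = cou (u * tgt (cou v))
}.

Section LeftHopf.
Variables (k : comNzRingType) (A U : algType k) (B : bialgebroid A U).

Definition tensAop : seq (U * U) -> seq (U * U) -> Prop :=
  tens2 (fun a u => u * tgt B a) (fun a v => tgt B a * v).

Definition galois (s : seq (U * U)) : seq (U * U) :=
  [seq (x.1, x.2 * p.2) | p <- s, x <- cop B p.1].

(* Bijectivity of U (x)_{A^op} U -> U (x)_A U, together with a choice of formal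
   sums tr u representing u_+ (x) u_- ; such a choice exists by surjectivity. *)
Record left_hopf := LeftHopf {
  galois_inj : forall s t, tensA B (galois s) (galois t) -> tensAop s t;
  galois_surj : forall t, exists s, tensA B (galois s) t;
  tr : U -> seq (U * U);
  trP : forall u, tensA B (galois (tr u)) [:: (u, 1)]
}.

End LeftHopf.

Section Modules.
Variables (k : comNzRingType) (R : algType k) (M : lmodType k).

Definition is_lmodule (act : R -> {linear M -> M}) : Prop :=
  [/\ forall c u v m, act (c *: u + v) m = c *: act u m + act v m,
      forall m, act 1 m = m &
      forall u v m, act (u * v) m = act u (act v m)].

(* act a m stands for m a *)
Definition is_rmodule (act : R -> {linear M -> M}) : Prop :=
  [/\ forall c u v m, act (c *: u + v) m = c *: act u m + act v m,
      forall m, act 1 m = m &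
      forall u v m, act (u * v) m = act v (act u m)].

End Modules.

Section Regular.
Variables (k : comNzRingType) (A U : algType k) (B : bialgebroid A U).

Definition canact_fun (u : U) (a : A) : A := cou B (u * src B a).

Fact canact_linear u : linear (canact_fun u).
Proof.
by move=> c a b; rewrite /canact_fun linearP mulrDr linearD -scalerAr linearZ.
Qed.
HB.instance Definition _ u :=
  GRing.isLinear.Build k A A *:%R (canact_fun u) (canact_linear u).

Definition canact (u : U) : {linear A -> A} := canact_fun u.

Definition mulract_fun (b a : A) : A := a * b.

Fact mulract_linear b : linear (mulract_fun b).
Proof. by move=> c x y; rewrite /mulract_fun mulrDl scalerAl. Qed.
HB.instance Definition _ b :=
  GRing.isLinear.Build k A A *:%R (mulract_fun b) (mulract_linear b).

(* the right action of A on itself *)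
Definition mulract (b : A) : {linear A -> A} := mulract_fun b.

End Regular.

Section Contramodules.
Variables (k : comNzRingType) (A U : algType k) (B : bialgebroid A U).
Variables (H : left_hopf B) (M : lmodType k).
Implicit Types (act : U -> {linear M -> M}) (ract : A -> {linear M -> M}).
(* A contraaction is a function on all maps U -> M, of which only the
   restriction to Hom_{A^op}(U, M) is ever constrained or used. *)
Implicit Types (g : (U -> M) -> M).

Definition homA ract (f : U -> M) : Prop :=
  linear f /\ forall a u, f (tgt B a * u) = ract a (f u).

Record is_contramodule ract g : Prop := IsContramodule {
  contra_rmodule : is_rmodule ract;
  contra_linear : forall c f h, homA ract f -> homA ract h ->
    g (fun u => c *: f u + h u) = c *: g f + g h;
  contra_src : forall a f, homA ract f ->
    g (fun u => f (src B a * u)) = ract a (g f);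
  contra_assoc : forall h : U -> U -> M,
    (forall u, linear (h u)) -> (forall v, linear (h^~ v)) ->
    (forall a u v, h (tgt B a * u) v = h u (src B a * v)) ->
    (forall a u v, h u (tgt B a * v) = ract a (h u v)) ->
    g (fun u => g (h u)) = g (fun u => \sum_(x <- cop B u) h x.1 x.2);
  contra_counit : forall m, g (fun u => ract (cou B u) m) = m
}.

Definition contra_lact ract g (a : A) (m : M) : M :=
  g (fun u => ract (cou B (u * src B a)) m).

(* In the last axiom u_{+(1)} (x) u_{+(2)} (x) u_-, an element of
   U (x)_A U (x)_{A^op} U, is written as a sum of x (x) y_+ (x) y_-
   (xs := cop B u is possible by the Hopf algebroid identities).  For such a sum
   every w |-> y_+ f(y_- w x) lies in Hom_{A^op}(U, M); for an arbitrary formal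
   sum representing that tensor the argument of g need not, and the formula
   would make no sense. *)
Record is_aYD act ract g : Prop := IsAYD {
  aYD_module : is_lmodule act;
  aYD_contra : is_contramodule ract g;
  aYD_src : forall a m, act (src B a) m = contra_lact ract g a m;
  aYD_tgt : forall a m, act (tgt B a) m = ract a m;
  aYD_compat : forall u f (xs : seq (U * U)), homA ract f ->
    tens3 (fun a x => tgt B a * x) (fun a y => src B a * y)
          (fun a y => y * tgt B a) (fun a z => tgt B a * z)
      [seq (x.1, x.2, p.2) | p <- tr H u, x <- cop B p.1]
      [seq (x.1, p.1, p.2) | x <- xs, p <- tr H x.2] ->
    act u (g f) = g (fun w =>
      \sum_(x <- xs) \sum_(p <- tr H x.2) act p.1 (f (p.2 * w * x.1)))
}.

Definition stable act g : Prop := forall m, g (fun u => act u m) = m.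

End Contramodules.

Section YetterDrinfeld.
Variables (k : comNzRingType) (A U : algType k) (B : bialgebroid A U).
Variable N : lmodType k.
Implicit Types (act : U -> {linear N -> N}) (lact : A -> {linear N -> N}).
(* Coactions take their values in formal sums, as the coproduct does. *)
Implicit Types (co : N -> seq (U * N)).

Definition tensN lact : seq (U * N) -> seq (U * N) -> Prop :=
  tens2 (fun a u => tgt B a * u) (fun a n => lact a n).

Record is_comodule lact co : Prop := IsComodule {
  com_lmodule : is_lmodule lact;
  com_linear : forall c m n,
    tensN lact (co (c *: m + n)) ([seq (c *: x.1, x.2) | x <- co m] ++ co n);
  com_lact : forall a n,
    tensN lact (co (lact a n)) [seq (src B a * x.1, x.2) | x <- co n];
  com_coassoc : forall n,
    tens3 (fun a x => tgt B a * x) (fun a y => src B a * y)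
          (fun a y => tgt B a * y) (fun a z => lact a z)
      [seq (y.1, y.2, x.2) | x <- co n, y <- cop B x.1]
      [seq (x.1, y.1, y.2) | x <- co n, y <- co x.2];
  com_counit : forall n, \sum_(x <- co n) lact (cou B x.1) x.2 = n
}.

Definition com_ract lact co (a : A) (n : N) : N :=
  \sum_(x <- co n) lact (cou B (x.1 * src B a)) x.2.

Record is_YD act lact co : Prop := IsYD {
  YD_module : is_lmodule act;
  YD_comodule : is_comodule lact co;
  YD_src : forall a n, act (src B a) n = lact a n;
  YD_tgt : forall a n, act (tgt B a) n = com_ract lact co a n;
  YD_compat : forall u n,
    tensN lact [seq (y.1 * x.2, y.2) | x <- cop B u, y <- co (act x.1 n)]
               [seq (x.1 * y.1, act x.2 y.2) | x <- cop B u, y <- co n]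
}.

(* The monoidal unit A has the canonical U-action and the coaction
   a |-> s(a) (x) 1; a morphism from it to N is determined by the image 1_N
   of 1, and the conditions on 1_N below express that a |-> a 1_N is U-linear
   and U-colinear. *)
Record is_YDalgebra act lact co (mul : N -> N -> N) (oneN : N) : Prop :=
  IsYDalgebra {
  YDalg_YD : is_YD act lact co;
  YDalg_linl : forall n, linear (mul^~ n);
  YDalg_linr : forall m, linear (mul m);
  YDalg_bal : forall a m n,
    mul (com_ract lact co a m) n = mul m (lact a n);
  YDalg_A : associative mul;
  YDalg_1l : left_id oneN mul;
  YDalg_1r : right_id oneN mul;
  YDalg_act : forall u m n,
    act u (mul m n) = \sum_(x <- cop B u) mul (act x.1 m) (act x.2 n);
  YDalg_act1 : forall u, act u oneN = lact (cou B u) oneN;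
  YDalg_co : forall m n,
    tensN lact (co (mul m n))
      [seq (x.1 * y.1, mul x.2 y.2) | x <- co m, y <- co n];
  YDalg_co1 : tensN lact (co oneN) [:: (1, oneN)]
}.

Definition braided_comm act co (mul : N -> N -> N) : Prop :=
  forall m n, mul m n = \sum_(x <- co m) mul (act x.1 n) x.2.

End YetterDrinfeld.

Section DualBasis.
Variables (k : comNzRingType) (A U : algType k) (B : bialgebroid A U).
Variable H : left_hopf B.

(* U, as a right A-module by u a = t(a) u, is a direct summand of the free
   right A-module A^n for some n. *)
Definition fg_projective : Prop :=
  exists n (i : U -> 'rV[A]_n) (p : 'rV[A]_n -> U),
    [/\ {morph i : u v / u + v}, {morph p : x y / x + y},
        forall a u, i (tgt B a * u) = map_mx (mulract a) (i u),
        forall a x, p (map_mx (mulract a) x) = tgt B a * p x &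
        cancel i p].

Definition dual_basis (r : nat) (e : 'I_r -> U) (e' : 'I_r -> U -> A) : Prop :=
  (forall j, homA B (@mulract k A) (e' j)) /\
  forall u, u = \sum_(j < r) tgt B (e' j u) * e j.

Definition harpoon (u : U) (phi : U -> A) (v : U) : A :=
  \sum_(x <- tr H u) cou B (x.1 * tgt B (phi (x.2 * v))).

Definition induced_contra (gA : (U -> A) -> A) (N : lmodType k)
    (lact : A -> {linear N -> N}) (co : N -> seq (U * N))
    (r : nat) (e : 'I_r -> U) (e' : 'I_r -> U -> A) (f : U -> N) : N :=
  \sum_(j < r) \sum_(x <- co (f (e j))) lact (gA (harpoon x.1 (e' j))) x.2.

End DualBasis.

(* Value of a function of n variables on a list, 0 if the length is not n. *)
Definition evs (U : Type) (M : nmodType) n (f : n.-tuple U -> M) (s : seq U)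
    : M :=
  if insub s is Some t then f t else 0.

Section Cochains.
Variables (k : comNzRingType) (A U : algType k) (B : bialgebroid A U).
Variables (M : lmodType k) (ract : A -> {linear M -> M}) (n : nat).
Implicit Types f : n.-tuple U -> M.

Lemma evsD f g s : evs (f + g) s = evs f s + evs g s.
Proof. by rewrite /evs; case: insub => [t|] //; rewrite addr0. Qed.

Lemma evsZ c f s : evs (c *: f) s = c *: evs f s.
Proof. by rewrite /evs; case: insub => [t|] //; rewrite scaler0. Qed.

Lemma evs0 s : evs (0 : n.-tuple U -> M) s = 0.
Proof. by rewrite /evs; case: insub. Qed.

(* Argument lists of the wrong length make both sides 0. *)
Record is_cochain f : Prop := IsCochain {
  cochain_linear : forall s1 s2 c u v,
    evs f (s1 ++ (c *: u + v) :: s2) =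
      c *: evs f (s1 ++ u :: s2) + evs f (s1 ++ v :: s2);
  cochain_bal : forall s1 s2 a u v,
    evs f (s1 ++ u * tgt B a :: v :: s2) =
      evs f (s1 ++ u :: tgt B a * v :: s2);
  cochain_tgt : forall s a u,
    evs f (tgt B a * u :: s) = ract a (evs f (u :: s))
}.

Definition cochain_pred : {pred n.-tuple U -> M} := fun f => `[< is_cochain f >].

Fact cochain_submod : subsemimod_closed cochain_pred.
Proof.
split; first split.
- apply/asboolP; split=> *; rewrite !evs0 ?scaler0 ?addr0 //.
  by rewrite linear0.
- move=> f g /asboolP[f1 f2 f3] /asboolP[g1 g2 g3]; apply/asboolP; split=> *.
  + by rewrite !evsD f1 g1 scalerDr addrACA.
  + by rewrite !evsD f2 g2.
  + by rewrite !evsD f3 g3 linearD.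
- move=> c f /asboolP[f1 f2 f3]; apply/asboolP; split=> *.
  + by rewrite !evsZ f1 scalerDr !scalerA mulrC.
  + by rewrite !evsZ f2.
  + by rewrite !evsZ f3 linearZ.
Qed.

HB.instance Definition _ :=
  GRing.isSubmodClosed.Build k (n.-tuple U -> M) cochain_pred cochain_submod.

Record cochain := Cochain {
  cofun :> n.-tuple U -> M;
  cofunP : cofun \in cochain_pred
}.
HB.instance Definition _ := [isSub for cofun].
HB.instance Definition _ := [Choice of cochain by <:].
HB.instance Definition _ := [SubChoice_isSubLmodule of cochain by <:].

End Cochains.

Section Operads.
Local Open Scope nat_scope.
Variables (k : comNzRingType) (O : nat -> lmodType k).

(* Equality of operations whose arities agree only up to a nat equation. *)
Definition eqop m n (x : O m) (y : O n) : Prop :=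
  existT (fun n => O n : Type) m x = existT (fun n => O n : Type) n y.

(* circ i x y is the partial composition of x and y at i; its values at i = 0
   are irrelevant. *)
Implicit Types (one : O 1) (mu : O 2) (e : O 0).
Implicit Types (circ : forall p q : nat, nat -> O p -> O q -> O (p + q).-1).

Record is_operad one circ : Prop := IsOperad {
  circ_linr : forall p q i (x : O p), 0 < i -> linear (circ p q i x);
  circ_linl : forall p q i (y : O q), 0 < i -> linear ((circ p q i)^~ y);
  circ_out : forall p q i (x : O p) (y : O q), p < i -> circ p q i x y = 0%R;
  circ_unitr : forall p i (x : O p), 0 < i <= p ->
    eqop (circ p 1 i x one) x;
  circ_unitl : forall p (x : O p), eqop (circ 1 p 1 one x) x;
  (* For p = 0 both sides of the next three axioms are 0, but their arities,
     truncated at 0, need not agree. *)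
  circ_A1 : forall p q r i j (x : O p) (y : O q) (z : O r),
    0 < p -> 0 < j < i ->
    eqop (circ _ _ j (circ _ _ i x y) z)
         (circ _ _ (i + r).-1 (circ _ _ j x z) y);
  circ_A2 : forall p q r i j (x : O p) (y : O q) (z : O r),
    0 < p -> 0 < i <= j -> j < q + i ->
    eqop (circ _ _ j (circ _ _ i x y) z)
         (circ _ _ i x (circ _ _ (j - i).+1 y z));
  circ_A3 : forall p q r i j (x : O p) (y : O q) (z : O r),
    0 < p -> 0 < i -> q + i <= j ->
    eqop (circ _ _ j (circ _ _ i x y) z)
         (circ _ _ i (circ _ _ (j - q).+1 x z) y)
}.

Record is_operad_mult one circ mu e : Prop := IsOperadMult {
  opmult_operad : is_operad one circ;
  opmult_A : circ 2 2 1 mu mu = circ 2 2 2 mu mu;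
  opmult_e1 : circ 2 0 1 mu e = one;
  opmult_e2 : circ 2 0 2 mu e = one
}.

Record is_cyclic_operad_mult one circ mu e (tau : forall n, O n -> O n) : Prop :=
  IsCyclicOperadMult {
  cyc_opmult : is_operad_mult one circ mu e;
  cyc_linear : forall n, linear (tau n);
  cyc_circ1 : forall p q (x : O p) (y : O q), 0 < p -> 0 < q ->
    eqop (tau _ (circ p q 1 x y)) (circ q p q (tau _ y) (tau _ x));
  cyc_circ : forall p q i (x : O p) (y : O q), 1 < i <= p ->
    tau _ (circ p q i x y) = circ p q i.-1 (tau _ x) y;
  cyc_one : tau 1 one = one;
  cyc_id : forall n (x : O n), iter n.+1 (tau n) x = x;
  cyc_mu : tau 2 mu = mu
}.

(* The same partial compositions, with the inputs numbered from the right.  The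
   axiom cyc_circ lets tau lower the index i, while the cyclic operator tau_fun
   below moves the arguments of f one slot to the left, i.e. raises the slot of
   each; it is therefore compatible with compositions numbered from the right,
   such as circA, whereas circN numbers its inputs from the left. *)
Definition rev_circ circ p q (i : nat) (x : O p) (y : O q) : O (p + q).-1 :=
  if (i <= p) then circ p q (p.+1 - i) x y else 0%R.

End Operads.

(* The formal sum representing D(u^1) (x) ... (x) D(u^n), as lists of the n
   pairs (u^i_(1), u^i_(2)). *)
Definition sweedler (U : Type) (D : U -> seq (U * U)) (us : seq U) :
    seq (seq (U * U)) :=
  foldr (fun u acc => [seq x :: xs | x <- D u, xs <- acc]) [:: [::]] us.

Section Operations.
Variables (k : comNzRingType) (A U : algType k) (B : bialgebroid A U).
Variable H : left_hopf B.

Definition tau_fun (M : lmodType k) (act : U -> {linear M -> M})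
    (g : (U -> M) -> M) n (f : n.-tuple U -> M) (us : seq U) : M :=
  if us is u :: us' then
    g (fun w => \sum_(x <- tr H u) \sum_(xs <- sweedler (tr H) us')
      act x.1 (evs f (rcons (unzip1 xs) ((\prod_(y <- rev xs) y.2) * x.2 * w))))
  else g (fun u => act u (evs f [::])).

(* Insertion of h into the slot p - i + 1 of f. *)
Definition circA p q (i : nat) (f : p.-tuple U -> A) (h : q.-tuple U -> A)
    (us : seq U) : A :=
  let a := take (p - i) us in
  let b := take q (drop (p - i) us) in
  let c := drop (p - i + q) us in
  \sum_(xs <- sweedler (cop B) b)
    evs f (a ++ src B (evs h (unzip1 xs)) * (\prod_(x <- xs) x.2) :: c).

(* Insertion of h into the slot i of f. *)
Definition circN (N : lmodType k) (act : U -> {linear N -> N})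
    (co : N -> seq (U * N)) (mul : N -> N -> N)
    p q (i : nat) (f : p.-tuple U -> N) (h : q.-tuple U -> N) (us : seq U) : N :=
  let a := take i.-1 us in
  let b := take q (drop i.-1 us) in
  let c := drop (i.-1 + q) us in
  \sum_(xs <- sweedler (cop B) a) \sum_(ys <- sweedler (cop B) b)
  \sum_(n <- co (evs h (unzip1 ys)))
    mul (evs f (unzip1 xs ++ n.1 * (\prod_(y <- ys) y.2) :: c))
        (act (\prod_(x <- xs) x.2) n.2).

End Operations.

(* Main.v *)
Require Import Defs.
From HB Require Import structures.
From mathcomp Require Import all_boot all_algebra.
From mathcomp Require Import boolp functions generic_quotient zify.

Set Implicit Arguments.
Unset Strict Implicit.
Unset Printing Implicit Defensive.

Import GRing.Theory.
Local Open Scope ring_scope.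

(** Both parts are instances of one theorem on a braided commutative
    Yetter-Drinfel'd algebra $N$ with a stable contraaction $\gamma$
    ([cochain_cyclic_operad]): if $\gamma$ satisfies the anti Yetter-Drinfel'd
    condition and is right $N$-linear in the sense that
    $\gamma(w \mapsto f(n_{(-1)} w) \cdot_N n_{(0)}) = \gamma(f) \cdot_N n$
    (these and a few more identities are the record [cyc_contra]), then the
    cochains form a cyclic operad with multiplication.  For part (i) one takes
    $N = A$ with the coaction $a \mapsto s(a) \otimes 1$; the sums over the
    arguments to the left of the insertion then collapse by the counit
    ([circN_base]), which leaves the stated composition, with inputs numbered
    from the right.  For part (ii) one has to show that the contraaction
    induced on $N$ satisfies [cyc_contra] ([induced_cyc_contra]).

    Operad axioms.  The heart is [Sw_insert]: the coefficient produced by an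
    inserted cochain moves past the arguments on its left by the
    Yetter-Drinfel'd condition.  It makes composition compatible with the
    coaction ([dl_circ3]), whence the nested associativity axiom
    ([circ3_nested]); the parallel axiom needs braided commutativity
    ([circ3_parallel]).

    Cyclicity.  Write $\tilde f(u^0, \ldots, u^n) = u^0 f(u^1, \ldots, u^n)$.
    Then $\tau f(u^1, \ldots, u^n) = \gamma(w \mapsto \tilde f(u^1_+, \ldots,
    u^n_+, u^n_- \cdots u^1_- w))$, and inverting the Galois maps one variable
    at a time ([Tr_Sw]) turns this into an identification principle: to prove
    that the argument of $\gamma$ is a given function, one may replace the
    translation maps by coproducts.  With it the compatibility of $\tau$ with
    composition reduces to right $N$-linearity of $\gamma$ ([ltau_circ]) and,
    for the last input, to contraassociativity and braided commutativity
    ([ltau_circ_last]).  That $\tau^{n+1}$ is the identity becomes visible in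
    the homogeneous coordinates $v^0, \ldots, v^n$ with $u^0 = v^0_+$,
    $u^1 = v^0_- v^1_+$, and so on: there $\tau$ is
    $G \mapsto \gamma(w \mapsto G(v^1, \ldots, v^n, w v^0))$ by the anti
    Yetter-Drinfel'd condition ([hom_ltau]), its power is an iterated
    contraaction of all variables, which contraassociativity makes a
    contraaction along the diagonal action ([gam_dact]), and since $\tilde f$
    is $U$-linear in $u^0$, stability gives back $\tilde f$ ([iter_ltau]).

    The induced contraaction.  When $U$ has a dual basis, the maps
    $w \mapsto \chi(n_{(-1)} w) n_{(0)}$ with $\chi \in U^*$ span
    $\mathrm{Hom}_{A^{op}}(U, N)$ ([homN_ind]), and the induced contraaction
    sends such a map to $\gamma_A(\chi) n$ ([gN_dual_tens]).  Every property is
    checked on them, where it follows from the same property of $\gamma_A$.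

    An identity between tensors is used in the form of an equality of sums of
    the values of an arbitrary biadditive balanced function.  The passage back
    to tensors, needed to apply injectivity of the Galois map, is
    [fsum_cong_complete]. *)

(** * Formal sums and their test functions *)

Lemma fsum_cong_sum (T : Type) (R : seq T -> seq T -> Prop) (W : nmodType)
    (F : T -> W) s t :
  (forall s t, R s t -> \sum_(x <- s) F x = \sum_(x <- t) F x) ->
  fsum_cong R s t -> \sum_(x <- s) F x = \sum_(x <- t) F x.
Proof.
move=> RF; elim=> {s t} [s t /RF|s|s t _|s t r _ IH1 _ IH2|s t|s s' t t' _ IH1 _ IH2] //.
- by rewrite IH1.
- by rewrite !big_cat /= addrC.
- by rewrite !big_cat IH1 IH2.
Qed.

(** The classes of formal sums form an abelian group as soon as each generator
    has an opposite; it is the universal target of test functions. *)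
Section ClassGroup.
Local Open Scope quotient_scope.
Variables (T : choiceType) (R : seq T -> seq T -> Prop) (ng : T -> T).
Hypothesis ngN : forall x, fsum_cong R [:: x; ng x] [::].
Hypothesis ngR : forall s t, R s t -> fsum_cong R (map ng s) (map ng t).

Definition fsum_eqb (s t : seq T) : bool := `[< fsum_cong R s t >].

Fact fsum_eqb_equiv : equiv_class_of fsum_eqb.
Proof.
split=> [s|s t|t s r].
- by apply/asboolP/fsum_refl.
- by apply/asboolP/asboolP; apply: fsum_sym.
- by move=> /asboolP st /asboolP tr; apply/asboolP/(fsum_trans st).
Qed.
Canonical fsum_equiv := EquivRelPack fsum_eqb_equiv.

(** Formal sums up to the congruence. *)
Definition fclass := {eq_quot fsum_equiv}.
HB.instance Definition _ := Choice.on fclass.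
HB.instance Definition _ := EqQuotient.on fclass.

Lemma fclassP s t : reflect (fsum_cong R s t) (\pi_fclass s == \pi_fclass t).
Proof. by rewrite piE /=; apply: asboolP. Qed.

Lemma fsum_cong_ng s t :
  fsum_cong R s t -> fsum_cong R (map ng s) (map ng t).
Proof.
elim=> {s t} [s t /ngR //|s|s t _ IH|s t r _ IH1 _ IH2|s t|s s' t t' _ IH1 _ IH2].
- exact: fsum_refl.
- exact: fsum_sym.
- exact: fsum_trans IH2.
- by rewrite !map_cat; apply: fsum_catC.
- by rewrite !map_cat; apply: fsum_cat.
Qed.

Lemma fsum_cong_ngK s : fsum_cong R (map ng s ++ s) [::].
Proof.
elim: s => [|x s IH] /=; first exact: fsum_refl.
have mid t : fsum_cong R (t ++ x :: s) (x :: t ++ s).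
  rewrite -[x :: s]cat1s catA -[x :: t ++ s]/(([:: x] ++ t) ++ s).
  by apply: fsum_cat; [apply: fsum_catC | apply: fsum_refl].
apply: fsum_trans (mid (ng x :: map ng s)) _.
exact: (fsum_cat (s' := [::]) (ngN x) IH).
Qed.

Definition fc_add (x y : fclass) : fclass := \pi_fclass (repr x ++ repr y).
Definition fc_opp (x : fclass) : fclass := \pi_fclass (map ng (repr x)).

Lemma repr_cong s : fsum_cong R (repr (\pi_fclass s)) s.
Proof. by apply/fclassP; rewrite reprK. Qed.

Lemma fc_addE s t : fc_add (\pi_fclass s) (\pi_fclass t) = \pi_fclass (s ++ t).
Proof. by apply/eqP/fclassP/fsum_cat; apply: repr_cong. Qed.

Lemma fc_oppE s : fc_opp (\pi_fclass s) = \pi_fclass (map ng s).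
Proof. by apply/eqP/fclassP/fsum_cong_ng/repr_cong. Qed.

Lemma fclassW (P : fclass -> Prop) : (forall s, P (\pi_fclass s)) -> forall x, P x.
Proof. by move=> h x; rewrite -[x]reprK. Qed.

Fact fc_addA : associative fc_add.
Proof.
by elim/fclassW=> x; elim/fclassW=> y; elim/fclassW=> z; rewrite !fc_addE catA.
Qed.

Fact fc_addC : commutative fc_add.
Proof.
elim/fclassW=> x; elim/fclassW=> y; rewrite !fc_addE.
by apply/eqP/fclassP/fsum_catC.
Qed.

Fact fc_add0 : left_id (\pi_fclass [::]) fc_add.
Proof. by elim/fclassW=> x; rewrite !fc_addE. Qed.

Fact fc_addN : left_inverse (\pi_fclass [::]) fc_opp fc_add.
Proof.
elim/fclassW=> x; rewrite fc_oppE fc_addE.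
exact/eqP/fclassP/fsum_cong_ngK.
Qed.

HB.instance Definition _ :=
  GRing.isZmodule.Build fclass fc_addA fc_addC fc_add0 fc_addN.

Lemma fclass_sum (s : seq T) : \sum_(x <- s) (\pi_fclass [:: x] : fclass) = \pi_fclass s.
Proof.
elim: s => [|x s IH]; first by rewrite big_nil.
by rewrite big_cons IH; exact: (fc_addE [:: x] s).
Qed.

(** Converse of [fsum_cong_sum]: formal sums that no test function separates
    are congruent. *)
Lemma fsum_cong_complete s t :
  (forall (W : zmodType) (F : T -> W),
     (forall s t, R s t -> \sum_(x <- s) F x = \sum_(x <- t) F x) ->
     \sum_(x <- s) F x = \sum_(x <- t) F x) ->
  fsum_cong R s t.
Proof.
move=> h; apply/fclassP; rewrite -!fclass_sum; apply/eqP/(h fclass) => u v uv.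
by rewrite !fclass_sum; apply/eqP/fclassP/fsum_gen.
Qed.

End ClassGroup.

Lemma additive_sum (V W : zmodType) (f : V -> W) I (s : seq I) (F : I -> V) :
  {morph f : x y / x + y} -> f (\sum_(i <- s) F i) = \sum_(i <- s) f (F i).
Proof.
by move=> fD; apply: (big_morph f fD); apply: (addrI (f 0)); rewrite -fD !addr0.
Qed.

(** A test function for the tensor product: biadditive and balanced.  Scalars
    of the ground ring need no separate condition when they act through [A]. *)
Record bal2 (A : Type) (X Y W : zmodType) (l : A -> X -> X) (r : A -> Y -> Y)
    (F : X -> Y -> W) : Prop := Bal2 {
  bal2Dl : forall x x' y, F (x + x') y = F x y + F x' y;
  bal2Dr : forall x y y', F x (y + y') = F x y + F x y';
  bal2A : forall a x y, F (l a x) y = F x (r a y)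
}.

Lemma bal20l (A : Type) (X Y W : zmodType) (l : A -> X -> X) r
  (F : X -> Y -> W) y : bal2 l r F -> F 0 y = 0.
Proof. by case=> D _ _; apply: (addrI (F 0 y)); rewrite -D !addr0. Qed.

Lemma bal20r (A : Type) (X Y W : zmodType) (l : A -> X -> X) r
  (F : X -> Y -> W) x : bal2 l r F -> F x 0 = 0.
Proof. by case=> _ D _; apply: (addrI (F x 0)); rewrite -D !addr0. Qed.

Lemma bal2_sum (A : Type) (X Y W : zmodType) (l : A -> X -> X) r I (s : seq I)
    (F : I -> X -> Y -> W) :
  (forall i, bal2 l r (F i)) -> bal2 l r (fun x y => \sum_(i <- s) F i x y).
Proof.
move=> FP; split=> *.
- by rewrite -big_split; apply: eq_bigr => i _; apply: (bal2Dl (FP i)).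
- by rewrite -big_split; apply: eq_bigr => i _; apply: (bal2Dr (FP i)).
- by apply: eq_bigr => i _; apply: (bal2A (FP i)).
Qed.

Section TensorTests.
Variables (k : comNzRingType) (A : algType k).

(** The action of [A] extends that of the ground ring. *)
Definition unital (X : lmodType k) (l : A -> X -> X) :=
  forall (c : k) x, l c%:A x = c *: x.

Variables (X Y Z : lmodType k) (l1 : A -> X -> X) (r1 l2 : A -> Y -> Y).
Variable r2 : A -> Z -> Z.

Lemma tens2_sum (W : zmodType) (F : X -> Y -> W) s t :
  unital l1 -> unital r1 -> bal2 l1 r1 F -> tens2 l1 r1 s t ->
  \sum_(x <- s) F x.1 x.2 = \sum_(x <- t) F x.1 x.2.
Proof.
move=> ul ur FP; apply: fsum_cong_sum => {s t} _ _ [] *;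
  rewrite !(big_cons, big_nil) /= ?addr0.
- exact: (bal2Dl FP).
- exact: (bal2Dr FP).
- exact: (bal20l _ FP).
- exact: (bal20r _ FP).
- by rewrite -ul (bal2A FP) ur.
- exact: (bal2A FP).
Qed.

Lemma tens2_complete s t :
  (forall a x, l1 a (- x) = - l1 a x) ->
  (forall (W : zmodType) (F : X -> Y -> W), bal2 l1 r1 F ->
     \sum_(x <- s) F x.1 x.2 = \sum_(x <- t) F x.1 x.2) ->
  tens2 l1 r1 s t.
Proof.
move=> lN h; apply: (@fsum_cong_complete _ _ (fun x => (- x.1, x.2))).
- move=> [x y]; apply: fsum_trans (fsum_sym (fsum_gen (tens2Dl _ _ _ _ _))) _.
  by rewrite subrr; apply/fsum_gen/tens20l.
- move=> {h} _ _ [] * /=; rewrite ?opprD ?oppr0 -?scalerN -?lN; apply: fsum_gen.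
  + exact: tens2Dl.
  + exact: tens2Dr.
  + exact: tens20l.
  + exact: tens20r.
  + exact: tens2Z.
  + exact: tens2A.
move=> W F FP; have eqF (G : X * Y -> W) u : \sum_(x <- u) G x =
    \sum_(x <- u) G (x.1, x.2) by apply: eq_bigr => -[].
have FP1 u v : tens2_gen l1 r1 [:: u] [:: v] -> F u = F v.
  by move/FP; rewrite !big_cons !big_nil !addr0.
have FP2 u v w : tens2_gen l1 r1 [:: u] [:: v; w] -> F u = F v + F w.
  by move/FP; rewrite !big_cons !big_nil !addr0.
rewrite eqF [RHS]eqF; apply: (h _ (fun x y => F (x, y))); split=> *.
- exact/FP2/tens2Dl.
- exact/FP2/tens2Dr.
- exact/FP1/tens2A.
Qed.

Lemma tens3_sum (W : zmodType) (F : X -> Y -> Z -> W) s t :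
  unital l1 -> unital r1 -> unital l2 -> unital r2 ->
  (forall z, bal2 l1 r1 (fun x y => F x y z)) -> (forall x, bal2 l2 r2 (F x)) ->
  tens3 l1 r1 l2 r2 s t ->
  \sum_(x <- s) F x.1.1 x.1.2 x.2 = \sum_(x <- t) F x.1.1 x.1.2 x.2.
Proof.
move=> u1 v1 u2 v2 F1 F2; apply: fsum_cong_sum => {s t} _ _ [] *;
  rewrite !(big_cons, big_nil) /= ?addr0.
- exact: (bal2Dl (F1 _)).
- exact: (bal2Dl (F2 _)).
- exact: (bal2Dr (F2 _)).
- exact: (bal20l _ (F1 _)).
- exact: (bal20l _ (F2 _)).
- exact: (bal20r _ (F2 _)).
- by rewrite -u1 (bal2A (F1 _)) v1.
- by rewrite -u2 (bal2A (F2 _)) v2.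
- exact: (bal2A (F1 _)).
- exact: (bal2A (F2 _)).
Qed.

Lemma tens3_complete s t :
  (forall a x, l1 a (- x) = - l1 a x) ->
  (forall (W : zmodType) (F : X -> Y -> Z -> W),
     (forall z, bal2 l1 r1 (fun x y => F x y z)) ->
     (forall x, bal2 l2 r2 (F x)) ->
     \sum_(x <- s) F x.1.1 x.1.2 x.2 = \sum_(x <- t) F x.1.1 x.1.2 x.2) ->
  tens3 l1 r1 l2 r2 s t.
Proof.
move=> lN h; apply: (@fsum_cong_complete _ _ (fun x => (- x.1.1, x.1.2, x.2))).
- move=> [[x y] z].
  apply: fsum_trans (fsum_sym (fsum_gen (tens3D1 _ _ _ _ _ _ _ _))) _.
  by rewrite subrr; apply/fsum_gen/tens301.
- move=> {h} _ _ [] * /=; rewrite ?opprD ?oppr0 -?scalerN -?lN; apply: fsum_gen.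
  + exact: tens3D1.
  + exact: tens3D2.
  + exact: tens3D3.
  + exact: tens301.
  + exact: tens302.
  + exact: tens303.
  + exact: tens3Z12.
  + exact: tens3Z23.
  + exact: tens3A12.
  + exact: tens3A23.
move=> W F FP; have eqF (G : X * Y * Z -> W) u : \sum_(x <- u) G x =
    \sum_(x <- u) G (x.1.1, x.1.2, x.2) by apply: eq_bigr => -[[]].
have FP1 u v : tens3_gen l1 r1 l2 r2 [:: u] [:: v] -> F u = F v.
  by move/FP; rewrite !big_cons !big_nil !addr0.
have FP2 u v w : tens3_gen l1 r1 l2 r2 [:: u] [:: v; w] -> F u = F v + F w.
  by move/FP; rewrite !big_cons !big_nil !addr0.
rewrite eqF [RHS]eqF; apply: (h _ (fun x y z => F (x, y, z))); split=> *.
- exact/FP2/tens3D1.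
- exact/FP2/tens3D2.
- exact/FP1/tens3A12.
- exact/FP2/tens3D2.
- exact/FP2/tens3D3.
- exact/FP1/tens3A23.
Qed.

End TensorTests.

(** * Calculus in a left bialgebroid *)

Section Bialgebroid.
Variables (k : comNzRingType) (A U : algType k) (B : bialgebroid A U).
Implicit Types (a b : A) (u v w : U).

(** Test functions on $U \otimes_A U$. *)
Definition balA (W : zmodType) : (U -> U -> W) -> Prop :=
  bal2 (fun a u => tgt B a * u) (fun a v => src B a * v).

Lemma unital_tgtl : unital (fun a u => tgt B a * u).
Proof. by move=> c u; rewrite linearZ /= tgt1 -scalerAl mul1r. Qed.

Lemma unital_tgtr : unital (fun a u => u * tgt B a).
Proof. by move=> c u; rewrite linearZ /= tgt1 -scalerAr mulr1. Qed.

Lemma unital_srcl : unital (fun a u => src B a * u).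
Proof. by move=> c u; rewrite linearZ /= rmorph1 -scalerAl mul1r. Qed.

Variable W : zmodType.

Lemma tensA_sum (F : U -> U -> W) s t : balA F -> tensA B s t ->
  \sum_(x <- s) F x.1 x.2 = \sum_(x <- t) F x.1 x.2.
Proof. exact: (tens2_sum unital_tgtl unital_srcl). Qed.

Lemma tensA_complete s t :
  (forall (W : zmodType) (F : U -> U -> W), balA F ->
     \sum_(x <- s) F x.1 x.2 = \sum_(x <- t) F x.1 x.2) ->
  tensA B s t.
Proof. by apply: tens2_complete => a u; rewrite mulrN. Qed.

Section TwoVariables.
Variable F : U -> U -> W.
Hypothesis FP : balA F.

Lemma cop_sumD u v : \sum_(x <- cop B (u + v)) F x.1 x.2 =
  \sum_(x <- cop B u) F x.1 x.2 + \sum_(x <- cop B v) F x.1 x.2.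
Proof.
rewrite -{1}[u]scale1r (tensA_sum FP (cop_linear B 1 u v)) big_cat big_map /=.
by under eq_bigr do rewrite scale1r.
Qed.

Lemma cop_sumM u v : \sum_(x <- cop B (u * v)) F x.1 x.2 =
  \sum_(x <- cop B u) \sum_(y <- cop B v) F (x.1 * y.1) (x.2 * y.2).
Proof. by rewrite (tensA_sum FP (copM B u v)) big_allpairs_dep. Qed.

Lemma cop_sum1 : \sum_(x <- cop B 1) F x.1 x.2 = F 1 1.
Proof. by rewrite (tensA_sum FP (cop1 B)) big_seq1. Qed.

Lemma cop_sum_srcl a u : \sum_(x <- cop B (src B a * u)) F x.1 x.2 =
  \sum_(x <- cop B u) F (src B a * x.1) x.2.
Proof. by rewrite (tensA_sum FP (cop_src B a u)) big_map. Qed.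

Lemma cop_sum_tgtl a u : \sum_(x <- cop B (tgt B a * u)) F x.1 x.2 =
  \sum_(x <- cop B u) F x.1 (tgt B a * x.2).
Proof. by rewrite (tensA_sum FP (cop_tgt B a u)) big_map. Qed.

Lemma cop_takeuchi_sum a u : \sum_(x <- cop B u) F (x.1 * tgt B a) x.2 =
  \sum_(x <- cop B u) F x.1 (x.2 * src B a).
Proof. by have := tensA_sum FP (cop_takeuchi B a u); rewrite !big_map. Qed.

End TwoVariables.

Lemma balA_mulr (F : U -> U -> W) v : balA F -> balA (fun x y => F x (y * v)).
Proof.
move=> FP; split=> *; first by rewrite (bal2Dl FP).
  by rewrite mulrDl (bal2Dr FP).
by rewrite -mulrA (bal2A FP).
Qed.

Lemma balA_mull (F : U -> U -> W) u : balA F -> balA (fun x y => F (x * u) y).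
Proof.
move=> FP; split=> *; first by rewrite mulrDl (bal2Dl FP).
  by rewrite (bal2Dr FP).
by rewrite -mulrA (bal2A FP).
Qed.

Lemma balA_tgtr (F : U -> U -> W) a :
  balA F -> balA (fun x y => F x (tgt B a * y)).
Proof.
move=> FP; split=> *; first by rewrite (bal2Dl FP).
  by rewrite mulrDr (bal2Dr FP).
by rewrite (bal2A FP) !mulrA src_tgtC.
Qed.

Lemma balA_srcl (F : U -> U -> W) a :
  balA F -> balA (fun x y => F (src B a * x) y).
Proof.
move=> FP; split=> *; first by rewrite mulrDr (bal2Dl FP).
  by rewrite (bal2Dr FP).
by rewrite mulrA src_tgtC -mulrA (bal2A FP).
Qed.

Lemma cop_sum_mulr (F : U -> U -> W) u : balA F ->
  balA (fun x y => \sum_(z <- cop B u) F (z.1 * x) (z.2 * y)).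
Proof.
move=> FP; split=> [x x' y|x y y'|a x y].
- by rewrite -big_split; apply: eq_bigr => z _; rewrite mulrDr (bal2Dl FP).
- by rewrite -big_split; apply: eq_bigr => z _; rewrite mulrDr (bal2Dr FP).
- have := cop_takeuchi_sum (balA_mull x (balA_mulr y FP)) a u.
  under eq_bigr do rewrite -mulrA; move=> ->.
  by apply: eq_bigr => z _; rewrite mulrA.
Qed.

Lemma cop_sum_src (F : U -> U -> W) a : balA F ->
  \sum_(x <- cop B (src B a)) F x.1 x.2 = F (src B a) 1.
Proof.
move=> FP; rewrite -[src B a in LHS]mulr1 cop_sum_srcl //.
by rewrite (cop_sum1 (balA_srcl a FP)) mulr1.
Qed.

Lemma cop_sum_tgt (F : U -> U -> W) a : balA F ->
  \sum_(x <- cop B (tgt B a)) F x.1 x.2 = F 1 (tgt B a).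
Proof.
move=> FP; rewrite -[tgt B a in LHS]mulr1 cop_sum_tgtl //.
by rewrite (cop_sum1 (balA_tgtr a FP)) mulr1.
Qed.

Lemma cop_sum_srcr (F : U -> U -> W) a u : balA F ->
  \sum_(x <- cop B (u * src B a)) F x.1 x.2 =
  \sum_(x <- cop B u) F (x.1 * src B a) x.2.
Proof.
move=> FP; rewrite cop_sumM // exchange_big (cop_sum_src _ (cop_sum_mulr u FP)).
by apply: eq_bigr => z _; rewrite mulr1.
Qed.

Lemma cop_sum_tgtr (F : U -> U -> W) a u : balA F ->
  \sum_(x <- cop B (u * tgt B a)) F x.1 x.2 =
  \sum_(x <- cop B u) F x.1 (x.2 * tgt B a).
Proof.
move=> FP; rewrite cop_sumM // exchange_big (cop_sum_tgt _ (cop_sum_mulr u FP)).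
by apply: eq_bigr => z _; rewrite mulr1.
Qed.

Lemma cop_coassoc_sum (F : U -> U -> U -> W) u :
  (forall z, balA (fun x y => F x y z)) -> (forall x, balA (F x)) ->
  \sum_(x <- cop B u) \sum_(y <- cop B x.1) F y.1 y.2 x.2 =
  \sum_(x <- cop B u) \sum_(y <- cop B x.2) F x.1 y.1 y.2.
Proof.
move=> F1 F2.
have := tens3_sum unital_tgtl unital_srcl unital_tgtl unital_srcl F1 F2
  (cop_coassoc B u).
by rewrite !big_allpairs_dep.
Qed.

End Bialgebroid.

Section Counit.
Variables (k : comNzRingType) (A U : algType k) (B : bialgebroid A U).
Implicit Types (a b : A) (u : U).

Lemma cou_srcE a : cou B (src B a) = a.
Proof. by rewrite -[src B a]mulr1 cou_src cou1 mulr1. Qed.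

Lemma cou_tgtE a : cou B (tgt B a) = a.
Proof. by rewrite -[tgt B a]mulr1 cou_tgt cou1 mul1r. Qed.

Lemma cou_mul_src_tgt u b : cou B (u * tgt B b) = cou B (u * src B b).
Proof. by rewrite couM_src cou_tgtE. Qed.

Lemma src_counitl u b :
  \sum_(x <- cop B u) src B (cou B (x.1 * src B b)) * x.2 = u * src B b.
Proof.
rewrite -[RHS](counitl B).
rewrite (cop_sum_srcr (F := fun p q => src B (cou B p) * q)) //.
split=> *; rewrite ?linearD ?rmorphD ?mulrDl ?mulrDr //.
by rewrite cou_tgt rmorphM mulrA.
Qed.

Lemma tgt_counitr u b :
  \sum_(x <- cop B u) tgt B (cou B (x.2 * tgt B b)) * x.1 = u * tgt B b.
Proof.
rewrite -[RHS](counitr B).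
rewrite (cop_sum_tgtr (F := fun p q => tgt B (cou B q) * p)) //.
split=> *; rewrite ?linearD ?mulrDl ?mulrDr //.
by rewrite cou_src tgtM mulrA.
Qed.

End Counit.

(** * The translation map *)

Section Translation.
Variables (k : comNzRingType) (A U : algType k) (B : bialgebroid A U).
Variable H : left_hopf B.
Implicit Types (a b : A) (u v w : U).

(** Test functions on $U \otimes_{A^{op}} U$. *)
Definition balAop (W : zmodType) : (U -> U -> W) -> Prop :=
  bal2 (fun a u => u * tgt B a) (fun a v => tgt B a * v).

Lemma balAop_mull (W : zmodType) (F : U -> U -> W) u :
  balAop F -> balAop (fun x y => F (u * x) y).
Proof.
move=> FP; split=> *; first by rewrite mulrDr (bal2Dl FP).
  by rewrite (bal2Dr FP).
by rewrite mulrA (bal2A FP).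
Qed.

Lemma balAop_mulr (W : zmodType) (F : U -> U -> W) v :
  balAop F -> balAop (fun x y => F x (y * v)).
Proof.
move=> FP; split=> *; first by rewrite (bal2Dl FP).
  by rewrite mulrDl (bal2Dr FP).
by rewrite (bal2A FP) mulrA.
Qed.

(** $u_{+(1)} \otimes u_{+(2)} u_- = u \otimes 1$ *)
Lemma tr_galois_sum (W : zmodType) (F : U -> U -> W) u : balA B F ->
  \sum_(p <- tr H u) \sum_(x <- cop B p.1) F x.1 (x.2 * p.2) = F u 1.
Proof.
by move=> FP; have := tensA_sum FP (trP H u); rewrite big_allpairs_dep big_seq1.
Qed.

(** Injectivity of the Galois map: two formal sums are equal in
    $U \otimes_{A^{op}} U$ as soon as their images are equal in
    $U \otimes_A U$. *)
Lemma galois_test (W : zmodType) (F : U -> U -> W) s t :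
  (forall (V : zmodType) (G : U -> U -> V), balA B G ->
     \sum_(p <- s) \sum_(x <- cop B p.1) G x.1 (x.2 * p.2) =
     \sum_(p <- t) \sum_(x <- cop B p.1) G x.1 (x.2 * p.2)) ->
  balAop F -> \sum_(p <- s) F p.1 p.2 = \sum_(p <- t) F p.1 p.2.
Proof.
move=> h FP; apply: (tens2_sum (unital_tgtr B) (unital_tgtl B) FP).
apply: (galois_inj H); apply: tensA_complete => V G GP.
by have := h V G GP; rewrite !big_allpairs_dep.
Qed.

Section TwoVariables.
Variables (W : zmodType) (F : U -> U -> W).
Hypothesis FP : balAop F.

(** $u_{(1)+} \otimes u_{(1)-} u_{(2)} = u \otimes 1$ *)
Lemma cop_tr_sum u :
  \sum_(x <- cop B u) \sum_(p <- tr H x.1) F p.1 (p.2 * x.2) = F u 1.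
Proof.
pose s := [seq (p.1, p.2 * x.2) | x <- cop B u, p <- tr H x.1].
have := @galois_test W F s [:: (u, 1)].
rewrite /s big_allpairs_dep big_seq1; apply=> // V G GP.
rewrite big_allpairs_dep big_seq1 /=.
transitivity (\sum_(x <- cop B u) G x.1 x.2); last first.
  by apply: eq_bigr => x _; rewrite mulr1.
apply: eq_bigr => x _; have := tr_galois_sum x.1 (balA_mulr x.2 GP).
rewrite mul1r => <-; apply: eq_bigr => p _; apply: eq_bigr => y _.
by rewrite mulrA.
Qed.

Lemma tr_sumD u v : \sum_(p <- tr H (u + v)) F p.1 p.2 =
  \sum_(p <- tr H u) F p.1 p.2 + \sum_(p <- tr H v) F p.1 p.2.
Proof.
rewrite -big_cat; apply: galois_test => // V G GP; rewrite big_cat /=.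
by rewrite !tr_galois_sum // (bal2Dl GP).
Qed.

Lemma tr_sumM u v : \sum_(p <- tr H (u * v)) F p.1 p.2 =
  \sum_(p <- tr H u) \sum_(q <- tr H v) F (p.1 * q.1) (q.2 * p.2).
Proof.
pose s := [seq (p.1 * q.1, q.2 * p.2) | p <- tr H u, q <- tr H v].
have := @galois_test W F (tr H (u * v)) s.
rewrite /s big_allpairs_dep; apply=> // V G GP; rewrite big_allpairs_dep /=.
rewrite tr_galois_sum //.
transitivity (\sum_(p <- tr H u) \sum_(x <- cop B p.1) G (x.1 * v) (x.2 * p.2)).
  by rewrite (tr_galois_sum u (balA_mull v GP)).
apply: eq_bigr => p _.
transitivity (\sum_(x <- cop B p.1) G (x.1 * v) (x.2 * 1 * p.2)).
  by apply: eq_bigr => x _; rewrite mulr1.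
rewrite -(tr_galois_sum v (F := fun x y =>
    \sum_(z <- cop B p.1) G (z.1 * x) (z.2 * y * p.2))); last first.
  exact: (cop_sum_mulr p.1 (balA_mulr p.2 GP)).
apply: eq_bigr => q _ /=; rewrite (cop_sumM (balA_mulr (q.2 * p.2) GP)).
rewrite exchange_big; apply: eq_bigr => z _; apply: eq_bigr => y _.
by rewrite !mulrA.
Qed.

Lemma tr_sum_src a : \sum_(p <- tr H (src B a)) F p.1 p.2 = F (src B a) 1.
Proof.
have := @galois_test W F (tr H (src B a)) [:: (src B a, 1)].
rewrite big_seq1; apply=> // V G GP; rewrite big_seq1 tr_galois_sum //=.
by rewrite (cop_sum_src a (balA_mulr 1 GP)) mulr1.
Qed.

Lemma tr_sum_tgt a : \sum_(p <- tr H (tgt B a)) F p.1 p.2 = F 1 (src B a).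
Proof.
have := @galois_test W F (tr H (tgt B a)) [:: (1, src B a)].
rewrite big_seq1; apply=> // V G GP; rewrite big_seq1 tr_galois_sum //=.
by rewrite (cop_sum1 (balA_mulr (src B a) GP)) mul1r -[tgt B a]mulr1 (bal2A GP)
  mulr1.
Qed.

Lemma tr_takeuchi_sum a u : \sum_(p <- tr H u) F (tgt B a * p.1) p.2 =
  \sum_(p <- tr H u) F p.1 (p.2 * tgt B a).
Proof.
have := @galois_test W F [seq (tgt B a * p.1, p.2) | p <- tr H u]
  [seq (p.1, p.2 * tgt B a) | p <- tr H u].
rewrite !big_map; apply=> // V G GP; rewrite !big_map /=.
transitivity (G u (tgt B a)); last first.
  rewrite -[tgt B a]mul1r -(tr_galois_sum u (balA_mulr (tgt B a) GP)).
  by apply: eq_bigr => p _; apply: eq_bigr => x _; rewrite mul1r mulrA.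
rewrite -[tgt B a]mulr1 -(tr_galois_sum u (balA_tgtr a GP)).
apply: eq_bigr => p _; rewrite mulr1 /= (cop_sum_tgtl (balA_mulr p.2 GP)).
by apply: eq_bigr => x _; rewrite mulrA.
Qed.

End TwoVariables.

Section Multiplication.
Variables (W : zmodType) (F : U -> U -> W).
Hypothesis FP : balAop F.

Lemma balAop_tr u : balAop (fun x y => \sum_(p <- tr H u) F (p.1 * x) (y * p.2)).
Proof. exact: bal2_sum (fun p => balAop_mull p.1 (balAop_mulr p.2 FP)). Qed.

Lemma balAop_tr_out v :
  balAop (fun x y => \sum_(p <- tr H v) F (x * p.1) (p.2 * y)).
Proof.
split=> [x x' y|x y y'|a x y].
- by rewrite -big_split; apply: eq_bigr => p _; rewrite mulrDl (bal2Dl FP).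
- by rewrite -big_split; apply: eq_bigr => p _; rewrite mulrDr (bal2Dr FP).
- have := tr_takeuchi_sum (balAop_mull x (balAop_mulr y FP)) a v.
  under eq_bigr do rewrite mulrA; move=> ->.
  by apply: eq_bigr => p _; rewrite mulrA.
Qed.

Lemma tr_sum_srcl a u : \sum_(p <- tr H (src B a * u)) F p.1 p.2 =
  \sum_(p <- tr H u) F (src B a * p.1) p.2.
Proof.
rewrite tr_sumM // (tr_sum_src (balAop_tr_out u)).
by apply: eq_bigr => p _; rewrite mulr1.
Qed.

Lemma tr_sum_tgtl a u : \sum_(p <- tr H (tgt B a * u)) F p.1 p.2 =
  \sum_(p <- tr H u) F p.1 (p.2 * src B a).
Proof.
rewrite tr_sumM // (tr_sum_tgt (balAop_tr_out u)).
by apply: eq_bigr => p _; rewrite mul1r.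
Qed.

Lemma tr_sum_tgtr a u : \sum_(p <- tr H (u * tgt B a)) F p.1 p.2 =
  \sum_(p <- tr H u) F p.1 (src B a * p.2).
Proof.
rewrite tr_sumM // exchange_big (tr_sum_tgt (balAop_tr u)).
by apply: eq_bigr => p _; rewrite mulr1.
Qed.

End Multiplication.

(** The inverse $x \otimes y \mapsto x_+ \otimes x_- y$ of the Galois map is
    well defined. *)
Lemma balA_tr (W : zmodType) (F : U -> U -> W) : balAop F ->
  balA B (fun x y => \sum_(p <- tr H x) F p.1 (p.2 * y)).
Proof.
move=> FP; split=> [x x' y|x y y'|a x y].
- exact: (tr_sumD (balAop_mulr y FP)).
- by rewrite -big_split; apply: eq_bigr => p _; rewrite mulrDr (bal2Dr FP).
- rewrite (tr_sum_tgtl (balAop_mulr y FP)).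
  by apply: eq_bigr => p _; rewrite mulrA.
Qed.

(** $u_+ u_- = s(\varepsilon(u))$ *)
Lemma tr_mul u : \sum_(p <- tr H u) p.1 * p.2 = src B (cou B u).
Proof.
rewrite -[RHS]mulr1 -(tr_galois_sum u (F := fun x y => src B (cou B x) * y)).
  apply: eq_bigr => p _; rewrite -{1}[p.1](counitl B) mulr_suml.
  by apply: eq_bigr => x _; rewrite mulrA.
split=> *; first by rewrite linearD rmorphD mulrDl.
  by rewrite mulrDr.
by rewrite cou_tgt rmorphM mulrA.
Qed.

(** $u_{+(1)} \otimes u_{+(2)} \otimes u_- = u_{(1)} \otimes u_{(2)+} \otimes
    u_{(2)-}$ in $U \otimes_A U \otimes_{A^{op}} U$ *)
Lemma tr_cop_sum (W : zmodType) (F : U -> U -> U -> W) u :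
  (forall z, balA B (fun x y => F x y z)) -> (forall x, balAop (F x)) ->
  \sum_(p <- tr H u) \sum_(x <- cop B p.1) F x.1 x.2 p.2 =
  \sum_(x <- cop B u) \sum_(p <- tr H x.2) F x.1 p.1 p.2.
Proof.
move=> F1 F2.
have G1 c : balA B (fun x y => \sum_(q <- tr H y) F x q.1 (q.2 * c)).
  split=> [x x' y|x y y'|a x y].
  - by rewrite -big_split; apply: eq_bigr => p _; rewrite (bal2Dl (F1 _)).
  - exact: (tr_sumD (balAop_mulr c (F2 x))).
  - rewrite (tr_sum_srcl (balAop_mulr c (F2 x))).
    by apply: eq_bigr => p _; rewrite (bal2A (F1 _)).
have G2 : balA B (fun x y =>
    \sum_(z <- cop B x) \sum_(q <- tr H z.2) F z.1 q.1 (q.2 * y)).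
  split=> [x x' y|x y y'|a x y].
  - exact: (cop_sumD (G1 y)).
  - rewrite -big_split; apply: eq_bigr => z _.
    exact: (bal2Dr (balA_tr (F2 z.1))).
  - rewrite (cop_sum_tgtl (G1 y)); apply: eq_bigr => z _.
    exact: (bal2A (balA_tr (F2 z.1))).
transitivity (\sum_(x <- cop B u) \sum_(p <- tr H x.2) F x.1 p.1 (p.2 * 1)).
  rewrite -(tr_galois_sum u G2); apply: eq_bigr => p _ /=.
  rewrite (@cop_coassoc_sum _ _ _ _ _
      (fun x y z => \sum_(q <- tr H y) F x q.1 (q.2 * (z * p.2)))).
  - apply: eq_bigr => x _; rewrite -[in LHS](mul1r p.2).
    rewrite -(cop_tr_sum (balAop_mulr p.2 (F2 x.1))).
    by apply: eq_bigr => y _; apply: eq_bigr => q _; rewrite mulrA.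
  - by move=> z; apply: G1.
  - by move=> x; apply: (balA_mulr p.2 (balA_tr (F2 x))).
by apply: eq_bigr => x _; apply: eq_bigr => p _; rewrite mulr1.
Qed.

Lemma tr_cop_cong u :
  tens3 (fun a x => tgt B a * x) (fun a y => src B a * y)
        (fun a y => y * tgt B a) (fun a z => tgt B a * z)
    [seq (x.1, x.2, p.2) | p <- tr H u, x <- cop B p.1]
    [seq (x.1, p.1, p.2) | x <- cop B u, p <- tr H x.2].
Proof.
apply: tens3_complete => [a x|W F F1 F2]; first by rewrite mulrN.
by rewrite !big_allpairs_dep; apply: tr_cop_sum.
Qed.

(** $u_+ \otimes u_{-(1)} \otimes u_{-(2)} = u_{++} \otimes u_- \otimes
    u_{+-}$.  The order of the factors puts $\otimes_{A^{op}}$ between the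
    first and the third one. *)
Lemma tr_cop_snd_sum (W : zmodType) (F : U -> U -> U -> W) u :
  (forall y, balAop (fun x z => F x y z)) -> (forall x, balA B (F x)) ->
  \sum_(p <- tr H u) \sum_(x <- cop B p.2) F p.1 x.1 x.2 =
  \sum_(p <- tr H u) \sum_(q <- tr H p.1) F q.1 p.2 q.2.
Proof.
move=> F1 F2.
have F1r c y : balAop (fun x z => F x y (z * c)) := balAop_mulr c (F1 y).
have K1 y z : balAop (fun r s => \sum_(q <- tr H r) F q.1 (s * y) (q.2 * z)).
  split=> [x x' s|x s s'|a x s].
  - exact: (tr_sumD (F1r _ _)).
  - by rewrite -big_split; apply: eq_bigr => q _; rewrite mulrDl (bal2Dl (F2 _)).
  - rewrite (tr_sum_tgtr (F1r _ _)); apply: eq_bigr => q _.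
    by rewrite -!mulrA (bal2A (F2 _)).
pose K p y z := \sum_(r <- tr H p) \sum_(q <- tr H r.1) F q.1 (r.2 * y) (q.2 * z).
have K2 z : balA B (fun p y => K p y z).
  split=> [p p' y|p y y'|a p y].
  - exact: (tr_sumD (K1 y z)).
  - rewrite -big_split; apply: eq_bigr => r _; rewrite -big_split.
    by apply: eq_bigr => q _; rewrite mulrDr (bal2Dl (F2 _)).
  - rewrite /K (tr_sum_tgtl (K1 y z)); apply: eq_bigr => r _.
    by apply: eq_bigr => q _; rewrite mulrA.
have K3 p : balA B (K p).
  split=> [y y' z|y z z'|a y z].
  - rewrite -big_split; apply: eq_bigr => r _; rewrite -big_split.
    by apply: eq_bigr => q _; rewrite mulrDr (bal2Dl (F2 _)).
  - rewrite -big_split; apply: eq_bigr => r _; rewrite -big_split.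
    by apply: eq_bigr => q _; rewrite mulrDr (bal2Dr (F2 _)).
  - rewrite /K; under eq_bigr do under eq_bigr do rewrite mulrA.
    rewrite -(tr_takeuchi_sum (K1 y z)); apply: eq_bigr => r _.
    rewrite (tr_sum_tgtl (F1r z (r.2 * y))).
    by apply: eq_bigr => q _; rewrite mulrA.
pose G p v := \sum_(y <- cop B v) K p y.1 y.2.
have GP : balA B G.
  split=> [p p' v|p v v'|a p v].
  - rewrite -big_split; apply: eq_bigr => y _; exact: (bal2Dl (K2 _)).
  - exact: (cop_sumD (K3 p)).
  - rewrite /G (cop_sum_srcl (K3 p)); apply: eq_bigr => y _.
    exact: (bal2A (K2 _)).
transitivity (G u 1); last first.
  rewrite /G (cop_sum1 (K3 u)); apply: eq_bigr => r _; apply: eq_bigr => q _.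
  by rewrite !mulr1.
rewrite -(tr_galois_sum u GP); apply: eq_bigr => p _.
transitivity (\sum_(x <- cop B p.1) \sum_(y <- cop B x.2) \sum_(w <- cop B p.2)
    K x.1 (y.1 * w.1) (y.2 * w.2)); last first.
  by apply: eq_bigr => x _; rewrite /G (cop_sumM (K3 x.1)).
rewrite -(@cop_coassoc_sum _ _ _ _ _ (fun x y z => \sum_(w <- cop B p.2)
    K x (y * w.1) (z * w.2))).
- transitivity (\sum_(x <- cop B p.1) \sum_(w <- cop B p.2)
      \sum_(q <- tr H x.1) F q.1 w.1 (q.2 * (x.2 * w.2))).
    rewrite exchange_big; apply: eq_bigr => w _ /=.
    rewrite -[in LHS](mul1r w.2) -(cop_tr_sum (F1r w.2 w.1)).
    by apply: eq_bigr => x _; apply: eq_bigr => q _; rewrite mulrA.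
  apply: eq_bigr => x _; rewrite [RHS]exchange_big; apply: eq_bigr => w _ /=.
  rewrite -[in LHS](mul1r w.1) -(cop_tr_sum (F := fun r s =>
      \sum_(q <- tr H r) F q.1 (s * w.1) (q.2 * (x.2 * w.2)))); last exact: K1.
  by apply: eq_bigr => y _; apply: eq_bigr => r _; apply: eq_bigr => q _;
    rewrite -mulrA.
- by move=> z; apply: bal2_sum => w; apply: (balA_mulr w.1 (K2 _)).
- by move=> x /=; apply: bal2_sum => w; apply: (balA_mull w.1 (balA_mulr w.2 (K3 x))).
Qed.

End Translation.

(** * Sweedler sums over lists *)

Lemma sweedler_nil (V : Type) (D : V -> seq (V * V)) (W : zmodType)
    (F : seq (V * V) -> W) :
  \sum_(xs <- sweedler D [::]) F xs = F [::].
Proof. by rewrite big_seq1. Qed.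

Lemma sweedler_cons (V : Type) (D : V -> seq (V * V)) (W : zmodType) u us
    (F : seq (V * V) -> W) :
  \sum_(xs <- sweedler D (u :: us)) F xs =
  \sum_(x <- D u) \sum_(xs <- sweedler D us) F (x :: xs).
Proof. by rewrite /= big_allpairs_dep. Qed.

Lemma sweedler_cat (V : Type) (D : V -> seq (V * V)) (W : zmodType) us vs
    (F : seq (V * V) -> W) :
  \sum_(xs <- sweedler D (us ++ vs)) F xs =
  \sum_(xs <- sweedler D us) \sum_(ys <- sweedler D vs) F (xs ++ ys).
Proof.
elim: us F => [|u us IH] F; first by rewrite sweedler_nil.
by rewrite cat_cons !sweedler_cons; apply: eq_bigr => x _; rewrite IH.
Qed.

Lemma eq_sweedler (V : Type) (D : V -> seq (V * V)) (W : zmodType) us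
    (F G : seq (V * V) -> W) :
  (forall xs, size xs = size us -> F xs = G xs) ->
  \sum_(xs <- sweedler D us) F xs = \sum_(xs <- sweedler D us) G xs.
Proof.
elim: us F G => [|u us IH] F G FG; first by rewrite !sweedler_nil FG.
rewrite !sweedler_cons; apply: eq_bigr => x _; apply: IH => xs sz.
by apply: FG; rewrite /= sz.
Qed.

Section SweedlerSums.
Variables (k : comNzRingType) (A U : algType k) (B : bialgebroid A U).
Implicit Types (a b : A) (u v w : U) (W : zmodType).

(** $F(u^1_{(1)}, \ldots, u^n_{(1)}; u^1_{(2)} \cdots u^n_{(2)})$ *)
Definition Sw W (us : seq U) (F : seq U -> U -> W) : W :=
  \sum_(xs <- sweedler (cop B) us) F (unzip1 xs) (\prod_(x <- xs) x.2).

Lemma Sw_nil W (F : seq U -> U -> W) : Sw [::] F = F [::] 1.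
Proof. by rewrite /Sw sweedler_nil big_nil. Qed.

Lemma Sw_cons W u us (F : seq U -> U -> W) :
  Sw (u :: us) F =
  \sum_(x <- cop B u) Sw us (fun xs y => F (x.1 :: xs) (x.2 * y)).
Proof.
rewrite /Sw sweedler_cons; apply: eq_bigr => x _; apply: eq_bigr => xs _.
by rewrite big_cons.
Qed.

Lemma Sw_sum W I (s : seq I) us (F : I -> seq U -> U -> W) :
  Sw us (fun xs y => \sum_(i <- s) F i xs y) = \sum_(i <- s) Sw us (F i).
Proof. exact: exchange_big. Qed.

Lemma Sw_cons_in W u us (F : seq U -> U -> W) :
  Sw (u :: us) F =
  Sw us (fun xs y => \sum_(x <- cop B u) F (x.1 :: xs) (x.2 * y)).
Proof. by rewrite Sw_cons Sw_sum. Qed.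

Lemma eq_Sw W us (F G : seq U -> U -> W) :
  (forall xs y, size xs = size us -> F xs y = G xs y) -> Sw us F = Sw us G.
Proof.
by move=> FG; apply: eq_sweedler => xs sz; apply: FG; rewrite size_map.
Qed.

Lemma Sw_cat W us vs (F : seq U -> U -> W) :
  Sw (us ++ vs) F =
  Sw us (fun xs y => Sw vs (fun ys z => F (xs ++ ys) (y * z))).
Proof.
rewrite /Sw sweedler_cat; apply: eq_bigr => xs _; apply: eq_bigr => ys _.
by rewrite /unzip1 map_cat big_cat.
Qed.

Lemma exchange_Sw W us vs (F : seq U -> U -> seq U -> U -> W) :
  Sw us (fun xs y => Sw vs (fun ys z => F xs y ys z)) =
  Sw vs (fun ys z => Sw us (fun xs y => F xs y ys z)).
Proof. exact: exchange_big. Qed.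

Lemma SwD W us (F G : seq U -> U -> W) :
  Sw us (fun xs y => F xs y + G xs y) = Sw us F + Sw us G.
Proof. exact: big_split. Qed.

Lemma raddf_Sw W W' (f : W -> W') us (F : seq U -> U -> W) :
  {morph f : x y / x + y} -> f (Sw us F) = Sw us (fun xs y => f (F xs y)).
Proof. exact: additive_sum. Qed.

(** Functions of a list and a further argument for which the Sweedler sums
    [Sw us (fun xs y => F xs (y * z))] are well defined. *)
Record mix W (F : seq U -> U -> W) : Prop := Mix {
  mixDl : forall s1 s2 u v y,
    F (s1 ++ (u + v) :: s2) y = F (s1 ++ u :: s2) y + F (s1 ++ v :: s2) y;
  mixDr : forall s y y', F s (y + y') = F s y + F s y';
  mixB : forall s1 s2 a u v y,
    F (s1 ++ u * tgt B a :: v :: s2) y = F (s1 ++ u :: tgt B a * v :: s2) y;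
  mixA : forall a u s y, F (tgt B a * u :: s) y = F (u :: s) (src B a * y)
}.

Lemma mix_balA W (F : seq U -> U -> W) xs :
  mix F -> balA B (fun x y => F (x :: xs) y).
Proof.
move=> FP; split=> *; first exact: (mixDl FP [::]).
  exact: (mixDr FP).
exact: (mixA FP).
Qed.

Lemma mix_cop W (F : seq U -> U -> W) u : mix F ->
  mix (fun xs y => \sum_(x <- cop B u) F (x.1 :: xs) (x.2 * y)).
Proof.
move=> FP; split=> [s1 s2 v v' y|s y y'|s1 s2 a v v' y|a v s y].
- by rewrite -big_split; apply: eq_bigr => x _; rewrite -!cat_cons (mixDl FP).
- by rewrite -big_split; apply: eq_bigr => x _; rewrite mulrDr (mixDr FP).
- by apply: eq_bigr => x _; rewrite -!cat_cons (mixB FP).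
- have := cop_takeuchi_sum (balA_mulr y (mix_balA (v :: s) FP)) a u.
  under eq_bigr do rewrite -[_ :: _ :: _]cat0s (mixB FP) /=; move=> ->.
  by apply: eq_bigr => x _; rewrite mulrA.
Qed.

Lemma mix_mulr W (F : seq U -> U -> W) z : mix F -> mix (fun xs y => F xs (y * z)).
Proof.
move=> FP; split=> *; first exact: (mixDl FP).
- by rewrite mulrDl (mixDr FP).
- exact: (mixB FP).
- by rewrite (mixA FP) mulrA.
Qed.

Lemma Sw_takeuchi W (F : seq U -> U -> W) a us v tail z : mix F ->
  Sw us (fun xs y => F (xs ++ tgt B a * v :: tail) (y * z)) =
  Sw us (fun xs y => F (xs ++ v :: tail) (y * (src B a * z))).
Proof.
elim: us F => [|u us IH] F FP.
  by rewrite !Sw_nil !mul1r (mixA FP).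
rewrite !Sw_cons_in; have := IH _ (mix_cop u FP).
under eq_Sw do under eq_bigr do rewrite mulrA.
by under [in RHS]eq_Sw do under eq_bigr do rewrite mulrA.
Qed.

(** The analogous condition for [Sw us (fun xs y => \sum_(z <- cop B y)
    F xs z.1 z.2)]. *)
Record mix3 W (F : seq U -> U -> U -> W) : Prop := Mix3 {
  mix3D : forall s1 s2 u v y z,
    F (s1 ++ (u + v) :: s2) y z = F (s1 ++ u :: s2) y z + F (s1 ++ v :: s2) y z;
  mix3Y : forall s, balA B (F s);
  mix3B : forall s1 s2 a u v y z,
    F (s1 ++ u * tgt B a :: v :: s2) y z = F (s1 ++ u :: tgt B a * v :: s2) y z;
  mix3A : forall a u s y z,
    F (tgt B a * u :: s) y z = F (u :: s) (src B a * y) z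
}.

Lemma mix3_balA W (F : seq U -> U -> U -> W) xs z :
  mix3 F -> balA B (fun x y => F (x :: xs) y z).
Proof.
move=> FP; split=> *; first exact: (mix3D FP [::]).
  exact: (bal2Dl (mix3Y FP _)).
exact: (mix3A FP).
Qed.

Lemma mix3_cop2 W (F : seq U -> U -> U -> W) xs y z : mix3 F ->
  balA B (fun p q => \sum_(x <- cop B q) F (p :: xs) (x.1 * y) (x.2 * z)).
Proof.
move=> FP.
have FP2 p : balA B (fun v w => F (p :: xs) (v * y) (w * z)).
  exact: balA_mull y (balA_mulr z (mix3Y FP _)).
split=> [p p' q|p q q'|a p q].
- by rewrite -big_split; apply: eq_bigr => x _; rewrite -[_ :: _]cat0s (mix3D FP).
- by rewrite (cop_sumD (FP2 p)).
- rewrite (cop_sum_srcl (FP2 p)).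
  by apply: eq_bigr => x _; rewrite (mix3A FP) mulrA.
Qed.

Lemma mix3_cop W (F : seq U -> U -> U -> W) u : mix3 F ->
  mix3 (fun xs y z => \sum_(x <- cop B u) \sum_(x' <- cop B x.2)
    F (x.1 :: xs) (x'.1 * y) (x'.2 * z)).
Proof.
move=> FP; split=> [s1 s2 v v' y z|s|s1 s2 a v v' y z|a v s y z].
- rewrite -big_split; apply: eq_bigr => x _; rewrite -big_split.
  by apply: eq_bigr => x' _; rewrite -!cat_cons (mix3D FP).
- apply: bal2_sum => x; exact: (cop_sum_mulr x.2 (mix3Y FP _)).
- apply: eq_bigr => x _; apply: eq_bigr => x' _.
  by rewrite -!cat_cons (mix3B FP).
- have := cop_takeuchi_sum (mix3_cop2 (v :: s) y z FP) a u.
  under eq_bigr do under eq_bigr do rewrite -[_ :: _ :: _]cat0s (mix3B FP) /=.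
  move=> ->; apply: eq_bigr => x _.
  rewrite (cop_sum_srcr (F := fun y1 z1 => F [:: x.1, v & s] (y1 * y) (z1 * z))).
    by apply: eq_bigr => x' _; rewrite mulrA.
  exact: balA_mull y (balA_mulr z (mix3Y FP _)).
Qed.

Lemma Sw_coassoc W (F : seq U -> U -> U -> W) us : mix3 F ->
  Sw us (fun xs z => Sw xs (fun xs' y => F xs' y z)) =
  Sw us (fun xs y => \sum_(z <- cop B y) F xs z.1 z.2).
Proof.
elim: us F => [|u us IH] F FP.
  by rewrite !Sw_nil (cop_sum1 (mix3Y FP _)).
rewrite !Sw_cons_in.
transitivity (Sw us (fun xs z => Sw xs (fun xs' y =>
    \sum_(x <- cop B u) \sum_(x' <- cop B x.2)
      F (x.1 :: xs') (x'.1 * y) (x'.2 * z)))).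
  apply: eq_Sw => xs z _; under eq_bigr do rewrite Sw_cons_in.
  rewrite -Sw_sum; apply: eq_Sw => xs' y _.
  rewrite (@cop_coassoc_sum _ _ _ _ _
    (fun p q r => F (p :: xs') (q * y) (r * z))) // => [r|p].
  + exact: balA_mulr y (mix3_balA xs' (r * z) FP).
  + exact: balA_mull y (balA_mulr z (mix3Y FP _)).
rewrite (IH _ (mix3_cop u FP)); apply: eq_Sw => xs y _.
rewrite exchange_big; apply: eq_bigr => x _ /=.
by rewrite exchange_big (cop_sumM (mix3Y FP _)).
Qed.

End SweedlerSums.

Section TranslationSums.
Variables (k : comNzRingType) (A U : algType k) (B : bialgebroid A U).
Variable H : left_hopf B.
Implicit Types (a b : A) (u v w : U) (W : zmodType).

(** Functions on $U \otimes_{A^{op}} \cdots \otimes_{A^{op}} U$. *)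
Record balL W (p : seq U -> W) : Prop := BalL {
  balLD : forall s1 s2 u v,
    p (s1 ++ (u + v) :: s2) = p (s1 ++ u :: s2) + p (s1 ++ v :: s2);
  balLB : forall s1 s2 a u v,
    p (s1 ++ u * tgt B a :: v :: s2) = p (s1 ++ u :: tgt B a * v :: s2)
}.

Lemma balL_catl W (p : seq U -> W) s : balL p -> balL (fun l => p (s ++ l)).
Proof.
by move=> pP; split=> *; rewrite !catA; [apply: (balLD pP) | apply: (balLB pP)].
Qed.

Lemma balL_cons W (p : seq U -> W) u : balL p -> balL (fun l => p (u :: l)).
Proof. exact: (balL_catl [:: u]). Qed.

(** $p(u^1_+, \ldots, u^n_+, u^n_- \cdots u^1_- w)$ *)
Definition Tr W (p : seq U -> W) (us : seq U) (w : U) : W :=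
  \sum_(xs <- sweedler (tr H) us)
    p (rcons (unzip1 xs) ((\prod_(y <- rev xs) y.2) * w)).

Lemma Tr_nil W (p : seq U -> W) w : Tr p [::] w = p [:: w].
Proof. by rewrite /Tr sweedler_nil big_nil mul1r. Qed.

Lemma Tr_cons W (p : seq U -> W) u us w : Tr p (u :: us) w =
  \sum_(x <- tr H u) Tr (fun l => p (x.1 :: l)) us (x.2 * w).
Proof.
rewrite /Tr sweedler_cons; apply: eq_bigr => x _; apply: eq_bigr => xs _.
by rewrite rev_cons -[rcons (rev _) _]cats1 big_cat big_seq1 /= mulrA.
Qed.

Lemma Tr_cat W (p : seq U -> W) us vs w : Tr p (us ++ vs) w =
  \sum_(xs <- sweedler (tr H) us)
    Tr (fun l => p (unzip1 xs ++ l)) vs ((\prod_(y <- rev xs) y.2) * w).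
Proof.
rewrite /Tr sweedler_cat; apply: eq_bigr => xs _; apply: eq_bigr => ys _.
by rewrite /unzip1 map_cat rcons_cat rev_cat big_cat /= mulrA.
Qed.

Lemma Tr_sum W I (s : seq I) (p : I -> seq U -> W) us w :
  Tr (fun l => \sum_(i <- s) p i l) us w = \sum_(i <- s) Tr (p i) us w.
Proof. exact: exchange_big. Qed.

Lemma TrD W (p q : seq U -> W) us w :
  Tr (fun l => p l + q l) us w = Tr p us w + Tr q us w.
Proof. exact: big_split. Qed.

Lemma eq_Tr W (p q : seq U -> W) us w :
  (forall l, size l = (size us).+1 -> p l = q l) -> Tr p us w = Tr q us w.
Proof.
move=> pq; apply: eq_sweedler => xs sz.
by apply: pq; rewrite size_rcons size_map sz.
Qed.

Lemma raddf_Tr W W' (f : W -> W') (p : seq U -> W) us w :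
  {morph f : x y / x + y} -> f (Tr p us w) = Tr (fun l => f (p l)) us w.
Proof. exact: additive_sum. Qed.

Section Balanced.
Variable W : zmodType.
Implicit Type p : seq U -> W.

Lemma TrDr p us w w' : balL p -> Tr p us (w + w') = Tr p us w + Tr p us w'.
Proof.
move=> pP; rewrite /Tr -big_split; apply: eq_bigr => xs _.
by rewrite mulrDr -!cats1 (balLD pP).
Qed.

Lemma Tr_bal p a u us w : balL p ->
  Tr (fun l => p (u * tgt B a :: l)) us w =
  Tr (fun l => p (u :: l)) us (tgt B a * w).
Proof.
elim: us a u p w => [|v us IH] a u p w pP.
  by rewrite !Tr_nil (balLB pP [::]).
rewrite !Tr_cons; under [RHS]eq_bigr do rewrite mulrA.
have G : balAop B (fun x y => Tr (fun l => p (u :: x :: l)) us (y * w)).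
  split=> [x x' y|x y y'|b x y].
  - by rewrite -TrD; apply: eq_Tr => l _; rewrite (balLD pP [:: u]).
  - by rewrite mulrDl TrDr //; apply: (balL_catl [:: u; x]).
  - by rewrite /= -mulrA; exact: (IH b x (fun l => p (u :: l)) (y * w) (balL_cons u pP)).
rewrite -(tr_takeuchi_sum H G); apply: eq_bigr => x _.
by apply: eq_Tr => l _; rewrite (balLB pP [::]).
Qed.

Lemma Tr_balAop p us w : balL p ->
  balAop B (fun x y => Tr (fun l => p (x :: l)) us (y * w)).
Proof.
move=> pP; split=> [x x' y|x y y'|b x y].
- by rewrite -TrD; apply: eq_Tr => l _; rewrite (balLD pP [::]).
- by rewrite mulrDl TrDr //; apply: balL_cons.
- by rewrite Tr_bal // mulrA.
Qed.

Lemma Tr_tgt p a u us w : balL p ->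
  Tr p (tgt B a * u :: us) w = Tr p (u :: us) (src B a * w).
Proof.
move=> pP; rewrite !Tr_cons (tr_sum_tgtl H (Tr_balAop us w pP)).
by apply: eq_bigr => x _; rewrite mulrA.
Qed.

Lemma Tr_tgtr p a u us w : balL p ->
  Tr p (u :: us) (tgt B a * w) =
  \sum_(x <- tr H u) Tr (fun l => p (tgt B a * x.1 :: l)) us (x.2 * w).
Proof.
move=> pP; rewrite Tr_cons (tr_takeuchi_sum H (Tr_balAop us w pP)).
by apply: eq_bigr => x _; rewrite mulrA.
Qed.

Lemma Tr_mix p : balL p -> mix B (Tr p).
Proof.
move=> pP; split=> [s1 s2 u v w|s w w'|s1 s2 a u v w|a u s w].
- elim: s1 p pP w => [|x s1 IH] p pP w /=.
    by rewrite !Tr_cons (tr_sumD H (Tr_balAop s2 w pP)).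
  rewrite !Tr_cons -big_split; apply: eq_bigr => y _.
  by rewrite IH //; apply: balL_cons.
- exact: TrDr.
- elim: s1 p pP w => [|x s1 IH] p pP w /=; last first.
    rewrite !Tr_cons; apply: eq_bigr => y _.
    by rewrite IH //; apply: balL_cons.
  rewrite /= !Tr_cons (tr_sum_tgtr H (Tr_balAop (v :: s2) w pP)).
  by apply: eq_bigr => x _; rewrite Tr_tgt ?mulrA //; apply: balL_cons.
- exact: Tr_tgt.
Qed.

(** The translation maps of several arguments undo the coproducts: if
    [P xs x] is $F(x^1_{(1)}, \ldots, x^n_{(1)}; x^1_{(2)} \cdots
    x^n_{(2)} x)$, then $P(u^1_+, \ldots, u^n_+; u^n_- \cdots u^1_- w) =
    F(u^1, \ldots, u^n; w)$. *)
Lemma tr_Sw F (P : seq U -> U -> W) us w : mix B F ->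
  (forall xs x, size xs = size us -> Sw B xs (fun ys y => F ys (y * x)) = P xs x) ->
  \sum_(xs <- sweedler (tr H) us) P (unzip1 xs) ((\prod_(y <- rev xs) y.2) * w)
  = F us w.
Proof.
elim: us F P w => [|u us IH] F P w FP FE.
  by rewrite sweedler_nil big_nil mul1r -FE // Sw_nil mul1r.
rewrite sweedler_cons -[w in RHS]mul1r.
rewrite -(tr_galois_sum H u (balA_mulr w (mix_balA us FP))).
apply: eq_bigr => x _.
have := IH _ (fun xs => P (x.1 :: xs)) (x.2 * w) (mix_cop x.1 FP).
move=> IH'; transitivity (\sum_(y <- cop B x.1) F (y.1 :: us) (y.2 * (x.2 * w))).
  rewrite -IH' => [|xs z sz].
    apply: eq_bigr => xs _.
    by rewrite rev_cons -cats1 big_cat big_seq1 /= mulrA.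
  rewrite -FE /= ?sz // Sw_cons_in; apply: eq_Sw => ys y _.
  by apply: eq_bigr => y' _; rewrite mulrA.
by apply: eq_bigr => y _; rewrite mulrA.
Qed.

Lemma Tr_Sw F p us w : mix B F ->
  (forall xs x, size xs = size us ->
     Sw B xs (fun ys y => F ys (y * x)) = p (rcons xs x)) ->
  Tr p us w = F us w.
Proof. by move=> FP FE; apply: (tr_Sw (P := fun xs x => p (rcons xs x))). Qed.

(** Conversely $p(u^1_{(1)+}, \ldots, u^n_{(1)+}, u^n_{(1)-} \cdots
    u^1_{(1)-} u^1_{(2)} \cdots u^n_{(2)} w) = p(u^1, \ldots, u^n, w)$. *)
Lemma Sw_Tr p us w : balL p ->
  Sw B us (fun xs y => Tr p xs (y * w)) = p (rcons us w).
Proof.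
elim: us p w => [|u us IH] p w pP.
  by rewrite Sw_nil Tr_nil mul1r.
rewrite Sw_cons_in rcons_cons -(IH (fun l => p (u :: l))); last first.
  exact: balL_cons.
apply: eq_Sw => xs y _.
rewrite -[y * w]mul1r -(cop_tr_sum H (Tr_balAop xs (y * w) pP)).
apply: eq_bigr => x _; rewrite Tr_cons; apply: eq_bigr => q _.
by rewrite !mulrA.
Qed.

End Balanced.
End TranslationSums.

(** * Yetter-Drinfel'd algebras *)

Lemma lmodule_actDl (k : comNzRingType) (R : algType k) (M : lmodType k)
    (act : R -> {linear M -> M}) u v m :
  is_lmodule act -> act (u + v) m = act u m + act v m.
Proof. by case=> D _ _; have := D 1 u v m; rewrite !scale1r. Qed.

Lemma lmodule_unital (k : comNzRingType) (R : algType k) (M : lmodType k)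
    (act : R -> {linear M -> M}) : is_lmodule act -> unital act.
Proof.
move=> actP c m; have [D a1 _] := actP.
have a0 : act 0 m = 0.
  by apply: (addrI (act 0 m)); rewrite -lmodule_actDl // !addr0.
by rewrite -[c%:A]addr0 D a0 addr0 a1.
Qed.

Section YDAlgebra.
Variables (k : comNzRingType) (A U : algType k) (B : bialgebroid A U).
Variable H : left_hopf B.
Variables (N : lmodType k) (act : U -> {linear N -> N}).
Variables (lact : A -> {linear N -> N}) (co : N -> seq (U * N)).
Variables (mul : N -> N -> N) (oneN : N).
Hypothesis NP : is_YDalgebra B act lact co mul oneN.
Implicit Types (a b : A) (u v w : U) (m n : N) (W : zmodType).

Let YDP := YDalg_YD NP.
Let coP := YD_comodule YDP.
Let actP := YD_module YDP.

Lemma act_one n : act 1 n = n. Proof. by case: actP => _ ->. Qed.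
Lemma act_mul u v n : act (u * v) n = act u (act v n).
Proof. by case: actP => _ _ ->. Qed.
Lemma actDl u v n : act (u + v) n = act u n + act v n.
Proof. exact: lmodule_actDl. Qed.
Lemma act_suml I (s : seq I) (f : I -> U) n :
  act (\sum_(i <- s) f i) n = \sum_(i <- s) act (f i) n.
Proof. by apply: (additive_sum (f := fun u => act u n)) => u v; apply: actDl. Qed.
Lemma actDr u m n : act u (m + n) = act u m + act u n.
Proof. exact: linearD. Qed.
Lemma lactE a n : lact a n = act (src B a) n.
Proof. by rewrite (YD_src YDP). Qed.
Lemma act_tgt_src a b n :
  act (tgt B a) (act (src B b) n) = act (src B b) (act (tgt B a) n).
Proof. by rewrite -!act_mul src_tgtC. Qed.

Lemma mulDl l m n : mul (l + m) n = mul l n + mul m n.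
Proof. by have := YDalg_linl NP n 1 l m; rewrite !scale1r. Qed.
Lemma mulDr l m n : mul l (m + n) = mul l m + mul l n.
Proof. by have := YDalg_linr NP l 1 m n; rewrite !scale1r. Qed.
Lemma mul_tgt a m n : mul (act (tgt B a) m) n = mul m (act (src B a) n).
Proof. by rewrite (YD_tgt YDP) (YDalg_bal NP) lactE. Qed.

(** Test functions on $U \otimes_A N$. *)
Definition balN W : (U -> N -> W) -> Prop :=
  bal2 (fun a u => tgt B a * u) (fun a n => act (src B a) n).

Lemma tensN_sum W (F : U -> N -> W) s t : balN F -> tensN B lact s t ->
  \sum_(x <- s) F x.1 x.2 = \sum_(x <- t) F x.1 x.2.
Proof.
move=> FP; apply: (tens2_sum (unital_tgtl B)).
  exact/lmodule_unital/(com_lmodule coP).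
by split=> *; rewrite ?lactE; case: FP => F1 F2 F3; [apply: F1|apply: F2|apply: F3].
Qed.

Section TwoVariables.
Variables (W : zmodType) (F : U -> N -> W).
Hypothesis FP : balN F.

Lemma co_sumD m n : \sum_(x <- co (m + n)) F x.1 x.2 =
  \sum_(x <- co m) F x.1 x.2 + \sum_(x <- co n) F x.1 x.2.
Proof.
rewrite -{1}[m]scale1r (tensN_sum FP (com_linear coP 1 m n)) big_cat big_map /=.
by under eq_bigr do rewrite scale1r.
Qed.

Lemma co_sum_src a n : \sum_(x <- co (act (src B a) n)) F x.1 x.2 =
  \sum_(x <- co n) F (src B a * x.1) x.2.
Proof. by rewrite -lactE (tensN_sum FP (com_lact coP a n)) big_map. Qed.

Lemma co_sumM m n : \sum_(x <- co (mul m n)) F x.1 x.2 =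
  \sum_(x <- co m) \sum_(y <- co n) F (x.1 * y.1) (mul x.2 y.2).
Proof. by rewrite (tensN_sum FP (YDalg_co NP m n)) big_allpairs_dep. Qed.

Lemma co_sum1 : \sum_(x <- co oneN) F x.1 x.2 = F 1 oneN.
Proof. by rewrite (tensN_sum FP (YDalg_co1 NP)) big_seq1. Qed.

Lemma balN_mull u : balN (fun x n => F (x * u) n).
Proof.
by split=> *; rewrite ?mulrDl ?(bal2Dl FP) ?(bal2Dr FP) // -mulrA (bal2A FP).
Qed.

Lemma balN_srcl a : balN (fun x n => F (src B a * x) n).
Proof.
split=> *; rewrite ?mulrDr ?(bal2Dl FP) ?(bal2Dr FP) //.
by rewrite mulrA src_tgtC -mulrA (bal2A FP).
Qed.

End TwoVariables.

Lemma co_counit n : \sum_(x <- co n) act (src B (cou B x.1)) x.2 = n.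
Proof.
by rewrite -[RHS](com_counit coP); apply: eq_bigr => x _; rewrite lactE.
Qed.

Lemma co_coassoc_sum W (F : U -> U -> N -> W) n :
  (forall z, balA B (fun x y => F x y z)) -> (forall x, balN (F x)) ->
  \sum_(x <- co n) \sum_(y <- cop B x.1) F y.1 y.2 x.2 =
  \sum_(x <- co n) \sum_(y <- co x.2) F x.1 y.1 y.2.
Proof.
move=> F1 F2.
have := tens3_sum (unital_tgtl B) (unital_srcl B) (unital_tgtl B)
  (lmodule_unital (com_lmodule coP)) F1 _ (com_coassoc coP n).
rewrite !big_allpairs_dep; apply=> x; split=> *.
- exact: (bal2Dl (F2 x)).
- exact: (bal2Dr (F2 x)).
- by rewrite lactE; apply: (bal2A (F2 x)).
Qed.

Lemma act_tgtE a n : act (tgt B a) n =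
  \sum_(x <- co n) act (src B (cou B (x.1 * src B a))) x.2.
Proof. by rewrite (YD_tgt YDP); apply: eq_bigr => x _; rewrite lactE. Qed.

Lemma co_sum_tgt W (F : U -> N -> W) a n : balN F ->
  \sum_(x <- co (act (tgt B a) n)) F x.1 x.2 =
  \sum_(x <- co n) F (x.1 * src B a) x.2.
Proof.
move=> FP; pose f n := \sum_(x <- co n) F x.1 x.2.
have fD : {morph f : m n / m + n} by move=> m m'; apply: co_sumD.
rewrite act_tgtE -/(f _) (additive_sum _ _ fD).
under eq_bigr do rewrite /f (co_sum_src FP).
rewrite -(@co_coassoc_sum _ (fun x y n =>
    F (src B (cou B (x * src B a)) * y) n)).
- apply: eq_bigr => x _; rewrite -src_counitl (additive_sum (f := F^~ x.2)) //.
  by move=> *; apply: (bal2Dl FP).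
- move=> z; split=> *.
  + by rewrite mulrDl linearD rmorphD mulrDl (bal2Dl FP).
  + by rewrite mulrDr (bal2Dl FP).
  + by rewrite -mulrA cou_tgt rmorphM mulrA.
- by move=> x; apply: balN_srcl.
Qed.

(** The two sides of the Yetter-Drinfel'd condition are well defined on
    $U \otimes_A U$. *)
Lemma balA_co W (F : U -> N -> W) n : balN F ->
  balA B (fun p q => \sum_(y <- co (act p n)) F (y.1 * q) y.2).
Proof.
move=> FP; split=> [p p' q|p q q'|a p q].
- by rewrite actDl (co_sumD (balN_mull FP q)).
- by rewrite -big_split; apply: eq_bigr => y _; rewrite mulrDr (bal2Dl FP).
- rewrite act_mul (co_sum_tgt _ _ (balN_mull FP q)).
  by apply: eq_bigr => y _; rewrite mulrA.
Qed.

Lemma balA_co_act W (F : U -> N -> W) n : balN F ->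
  balA B (fun p q => \sum_(y <- co n) F (p * y.1) (act q y.2)).
Proof.
move=> FP; split=> [p p' q|p q q'|a p q].
- by rewrite -big_split; apply: eq_bigr => y _; rewrite mulrDl (bal2Dl FP).
- by rewrite -big_split; apply: eq_bigr => y _; rewrite actDl (bal2Dr FP).
- by apply: eq_bigr => y _; rewrite -mulrA (bal2A FP) act_mul.
Qed.

Lemma YD_sum W (F : U -> N -> W) u n : balN F ->
  \sum_(x <- cop B u) \sum_(y <- co (act x.1 n)) F (y.1 * x.2) y.2 =
  \sum_(x <- cop B u) \sum_(y <- co n) F (x.1 * y.1) (act x.2 y.2).
Proof.
by move=> FP; have := tensN_sum FP (YD_compat YDP u n); rewrite !big_allpairs_dep.
Qed.

(** The coaction takes its values in the Takeuchi product; this is the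
    Yetter-Drinfel'd condition for $t(a)$. *)
Lemma co_takeuchi W (F : U -> N -> W) a n : balN F ->
  \sum_(x <- co n) F (x.1 * tgt B a) x.2 =
  \sum_(x <- co n) F x.1 (act (tgt B a) x.2).
Proof.
move=> FP; have := YD_sum (tgt B a) n FP.
rewrite (cop_sum_tgt a (balA_co n FP)) (cop_sum_tgt a (balA_co_act n FP)).
by rewrite act_one => ->; apply: eq_bigr => y _; rewrite mul1r.
Qed.

Lemma balA_mul m n : balA B (fun p q => mul (act p m) (act q n)).
Proof.
split=> *; rewrite ?actDl ?mulDl ?mulDr //.
by rewrite !act_mul mul_tgt.
Qed.

Lemma act_mulN u m n :
  act u (mul m n) = \sum_(x <- cop B u) mul (act x.1 m) (act x.2 n).
Proof. exact: (YDalg_act NP). Qed.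

Lemma src_mulN a m n : act (src B a) (mul m n) = mul (act (src B a) m) n.
Proof. by rewrite act_mulN (cop_sum_src a (balA_mul m n)) act_one. Qed.

Lemma tgt_mulN a m n : act (tgt B a) (mul m n) = mul m (act (tgt B a) n).
Proof. by rewrite act_mulN (cop_sum_tgt a (balA_mul m n)) act_one. Qed.

(** The unit map $a \mapsto a 1_N$ from $A$ to $N$. *)
Definition iot a : N := act (src B a) oneN.

Lemma act_iot u a : act u (iot a) = iot (cou B (u * src B a)).
Proof. by rewrite /iot -act_mul (YDalg_act1 NP) lactE. Qed.

Lemma iotD a b : iot (a + b) = iot a + iot b.
Proof. by rewrite /iot raddfD actDl. Qed.

Lemma iotE a : iot a = act (tgt B a) oneN.
Proof. by rewrite (YDalg_act1 NP) cou_tgtE lactE. Qed.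

Lemma mul_iotr m a : mul m (iot a) = act (tgt B a) m.
Proof. by rewrite iotE -tgt_mulN (YDalg_1r NP). Qed.

Lemma mul_iotl a m : mul (iot a) m = act (src B a) m.
Proof. by rewrite -src_mulN (YDalg_1l NP). Qed.

Lemma co_sum_iot W (F : U -> N -> W) a : balN F ->
  \sum_(x <- co (iot a)) F x.1 x.2 = F (src B a) oneN.
Proof.
move=> FP; rewrite (co_sum_src FP).
by rewrite (co_sum1 (balN_srcl FP a)) mulr1.
Qed.

End YDAlgebra.

(** * Partial compositions of cochains *)

Section Composition.
Variables (k : comNzRingType) (A U : algType k) (B : bialgebroid A U).
Variable H : left_hopf B.
Variables (N : lmodType k) (act : U -> {linear N -> N}).
Variables (lact : A -> {linear N -> N}) (co : N -> seq (U * N)).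
Variables (mul : N -> N -> N) (oneN : N).
Hypothesis NP : is_YDalgebra B act lact co mul oneN.
Implicit Types (a : A) (u v w : U) (m n : N) (W : zmodType).
Implicit Types (f g h : seq U -> N).
Local Notation Sw := (Sw B).
Local Notation balN := (balN B act).

(** Cochains, as functions on lists of arbitrary length: those that restrict to
    an element of $C^n(U, N)$ on the lists of each length $n$. *)
Record coch f : Prop := Coch {
  cochL : balL B f;
  coch_tgt : forall a u s, f (tgt B a * u :: s) = act (tgt B a) (f (u :: s))
}.

(** $F(g(b_{(1)})_{(-1)} b_{(2)}, g(b_{(1)})_{(0)})$ *)
Definition dl W g (b : seq U) (F : U -> N -> W) : W :=
  Sw b (fun ys z => \sum_(x <- co (g ys)) F (x.1 * z) x.2).

(** The composite of [f] and [g] evaluated at the concatenation of [a], [b]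
    and [c], where [g] is applied to [b]. *)
Definition circ3 f g (a b c : seq U) : N :=
  Sw a (fun xs y => dl g b (fun x n => mul (f (xs ++ x :: c)) (act y n))).

Lemma dl_sum W I (s : seq I) g b (F : I -> U -> N -> W) :
  dl g b (fun x n => \sum_(i <- s) F i x n) = \sum_(i <- s) dl g b (F i).
Proof.
rewrite /dl -Sw_sum; apply: eq_Sw => ys z _; exact: exchange_big.
Qed.

Lemma dlD W g b (F G : U -> N -> W) :
  dl g b (fun x n => F x n + G x n) = dl g b F + dl g b G.
Proof. by rewrite /dl -SwD; apply: eq_Sw => ys z _; rewrite -big_split. Qed.

Lemma eq_dl W g b (F G : U -> N -> W) :
  (forall x n, F x n = G x n) -> dl g b F = dl g b G.
Proof. by move=> FG; apply: eq_Sw => ys z _; apply: eq_bigr => x _. Qed.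

Lemma raddf_dl W W' (f : W -> W') g b (F : U -> N -> W) :
  {morph f : x y / x + y} -> f (dl g b F) = dl g b (fun x n => f (F x n)).
Proof.
move=> fD; rewrite /dl raddf_Sw //; apply: eq_Sw => ys z _.
by apply: (big_morph f fD); apply: (addrI (f 0)); rewrite -fD !addr0.
Qed.

Lemma exchange_dl_Sw W g b us (F : U -> N -> seq U -> U -> W) :
  dl g b (fun x n => Sw us (fun xs y => F x n xs y)) =
  Sw us (fun xs y => dl g b (fun x n => F x n xs y)).
Proof.
rewrite /dl [RHS]exchange_Sw; apply: eq_Sw => ys z _.
by rewrite -Sw_sum.
Qed.

Lemma exchange_dl W g b h c (F : U -> N -> U -> N -> W) :
  dl g b (fun x n => dl h c (fun y m => F x n y m)) =
  dl h c (fun y m => dl g b (fun x n => F x n y m)).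
Proof.
rewrite /(dl h) exchange_dl_Sw; apply: eq_Sw => ys z _.
by rewrite dl_sum.
Qed.

Lemma coch_co W g (F : U -> N -> W) : coch g -> balN F ->
  mix B (fun ys z => \sum_(x <- co (g ys)) F (x.1 * z) x.2).
Proof.
move=> gP FP; split=> [s1 s2 u v z|s z z'|s1 s2 a u v z|a u s z].
- by rewrite (balLD (cochL gP)) (co_sumD NP (balN_mull FP z)).
- by rewrite -big_split; apply: eq_bigr => x _; rewrite mulrDr (bal2Dl FP).
- by rewrite (balLB (cochL gP)).
- rewrite (coch_tgt gP) (co_sum_tgt NP a _ (balN_mull FP z)).
  by apply: eq_bigr => x _; rewrite mulrA.
Qed.

(** $\Delta(g(b_{(1)})_{(-1)} b_{(2)}) \otimes g(b_{(1)})_{(0)}$ *)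
Lemma dl_cop W g b (F : U -> U -> N -> W) : coch g ->
  (forall n, balA B (fun x y => F x y n)) -> (forall x, balN (F x)) ->
  dl g b (fun x n => \sum_(v <- cop B x) F v.1 v.2 n) =
  Sw b (fun ys z => dl g ys (fun x n => \sum_(m <- co n) F x (m.1 * z) m.2)).
Proof.
move=> gP F1 F2.
pose G ys y z := \sum_(x <- co (g ys)) \sum_(m <- co x.2) F (x.1 * y) (m.1 * z) m.2.
have GP : mix3 B G.
  have G1 z : balN (fun x n => \sum_(m <- co n) F x (m.1 * z) m.2).
    split=> [x x' n|x n n'|a x n].
    - by rewrite -big_split; apply: eq_bigr => m _; rewrite (bal2Dl (F1 _)).
    - by rewrite (co_sumD NP (balN_mull (F2 x) z)).
    - rewrite (co_sum_src NP (balN_mull (F2 x) z)).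
      by apply: eq_bigr => m _; rewrite (bal2A (F1 _)) mulrA.
  have mixG z := coch_co gP (G1 z).
  split=> [s1 s2 u v y z|s|s1 s2 a u v y z|a u s y z].
  - exact: (mixDl (mixG z)).
  - split=> [y y' z|y z z'|a y z].
    + exact: (mixDr (mixG z)).
    + rewrite -big_split; apply: eq_bigr => x _; rewrite -big_split.
      by apply: eq_bigr => m _; rewrite mulrDr (bal2Dr (F1 _)).
    + rewrite /G.
      transitivity (\sum_(x <- co (g s)) \sum_(m <- co x.2)
          F (x.1 * y) (m.1 * (src B a * z)) m.2); last by [].
      rewrite -!(@co_coassoc_sum _ _ _ _ _ _ _ _ _ _ NP _
        (fun p q n => F (p * _) (q * _) n)).
      * apply: eq_bigr => x _.
        have := cop_takeuchi_sum (balA_mull y (balA_mulr z (F1 x.2))) a x.1.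
        under eq_bigr do rewrite -mulrA; move=> ->.
        by apply: eq_bigr => v _; rewrite mulrA.
      * by move=> n; apply: balA_mull (balA_mulr _ (F1 n)).
      * by move=> p; apply: balN_mull.
      * by move=> n; apply: balA_mull (balA_mulr _ (F1 n)).
      * by move=> p; apply: balN_mull.
  - exact: (mixB (mixG z)).
  - exact: (mixA (mixG z)).
transitivity (Sw b (fun ys y => \sum_(z <- cop B y) G ys z.1 z.2)).
  apply: eq_Sw => ys y _.
  under eq_bigr do rewrite (cop_sumM (F1 _)).
  transitivity (\sum_(z <- cop B y) \sum_(x <- co (g ys)) \sum_(v <- cop B x.1)
      F (v.1 * z.1) (v.2 * z.2) x.2).
    by rewrite [RHS]exchange_big; apply: eq_bigr => x _; exact: exchange_big.
  apply: eq_bigr => z _.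
  rewrite (@co_coassoc_sum _ _ _ _ _ _ _ _ _ _ NP _
    (fun p q n => F (p * z.1) (q * z.2) n)) // => [n|p].
  - exact: balA_mull (balA_mulr _ (F1 n)).
  - exact: balN_mull.
by rewrite -(Sw_coassoc b GP).
Qed.

Lemma mul_Swl us (F : seq U -> U -> N) n :
  mul (Sw us F) n = Sw us (fun xs y => mul (F xs y) n).
Proof. by apply: (raddf_Sw B us (f := mul^~ n)) => m m' /=; rewrite (mulDl NP). Qed.

Lemma mul_dll g b (F : U -> N -> N) n :
  mul (dl g b F) n = dl g b (fun x m => mul (F x m) n).
Proof. by apply: (raddf_dl g b (f := mul^~ n)) => m m' /=; rewrite (mulDl NP). Qed.

Lemma mul_sumr I (s : seq I) (F : I -> N) n :
  mul n (\sum_(i <- s) F i) = \sum_(i <- s) mul n (F i).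
Proof.
apply: (big_morph (mul n)) => [m m'|]; first by rewrite (mulDr NP).
by apply: (addrI (mul n 0)); rewrite -(mulDr NP) !addr0.
Qed.

Lemma mul_suml I (s : seq I) (F : I -> N) n :
  mul (\sum_(i <- s) F i) n = \sum_(i <- s) mul (F i) n.
Proof.
apply: (big_morph (mul^~ n)) => [m m'|]; first by rewrite (mulDl NP).
by apply: (addrI (mul 0 n)); rewrite -(mulDl NP) !addr0.
Qed.

Lemma mix_mul f m : coch f -> mix B (fun l y => mul (f l) (act y m)).
Proof.
move=> fP; split=> [s1 s2 u v y|s y y'|s1 s2 a u v y|a u s y].
- by rewrite (balLD (cochL fP)) (mulDl NP).
- by rewrite (actDl NP) (mulDr NP).
- by rewrite (balLB (cochL fP)).
- by rewrite (coch_tgt fP) (mul_tgt NP) (act_mul NP).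
Qed.

Lemma balN_prefix f (a c : seq U) : coch f ->
  balN (fun x n => Sw a (fun xs y => mul (f (xs ++ x :: c)) (act y n))).
Proof.
move=> fP; split=> [x x' n|x n n'|b x n].
- by rewrite -SwD; apply: eq_Sw => xs y _; rewrite (balLD (cochL fP)) (mulDl NP).
- by rewrite -SwD; apply: eq_Sw => xs y _; rewrite actDr (mulDr NP).
- have := Sw_takeuchi b a x c 1 (mix_mul n fP).
  under eq_Sw do rewrite mulr1; move=> ->.
  by apply: eq_Sw => xs y _; rewrite mulr1 (act_mul NP).
Qed.

(** The action of the prefix [a] on a composite located further right. *)
Lemma circ3_prefix f g (a c d e : seq U) n : coch f ->
  Sw a (fun xs y => mul (circ3 f g (xs ++ c) d e) (act y n)) =
  Sw c (fun zs z => dl g d (fun x m => Sw a (fun xs y =>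
    mul (f (xs ++ zs ++ x :: e)) (act y (mul (act z m) n))))).
Proof.
move=> fP.
transitivity (Sw a (fun xs y => Sw c (fun zs z => dl g d (fun x m =>
    Sw xs (fun xs' y' =>
      mul (mul (f (xs' ++ zs ++ x :: e)) (act y' (act z m))) (act y n)))))).
  apply: eq_Sw => xs y _; rewrite /circ3 Sw_cat exchange_Sw.
  rewrite mul_Swl; apply: eq_Sw => zs z _.
  rewrite exchange_dl_Sw mul_Swl; apply: eq_Sw => xs' y' _; rewrite mul_dll.
  by apply: eq_dl => x m; rewrite -catA (act_mul NP).
rewrite exchange_Sw; apply: eq_Sw => zs z _.
rewrite -exchange_dl_Sw; apply: eq_dl => x m; set M := act z m.
set T := zs ++ x :: e.
rewrite (@Sw_coassoc _ _ _ _ _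
  (fun xs y' y => mul (mul (f (xs ++ T)) (act y' M)) (act y n))).
  apply: eq_Sw => xs y _; rewrite (act_mulN NP).
  by rewrite mul_sumr; apply: eq_bigr => v _; rewrite (YDalg_A NP).
split=> [s1 s2 u v y y'|s|s1 s2 b u v y y'|b u s y y'].
- by rewrite -!catA !cat_cons (balLD (cochL fP)) !(mulDl NP).
- split=> [y y' v|y v v'|b y v].
  + by rewrite (actDl NP) (mulDr NP) (mulDl NP).
  + by rewrite (actDl NP) (mulDr NP).
  + by rewrite !(act_mul NP) -(tgt_mulN NP) (mul_tgt NP).
- by rewrite -!catA !cat_cons (balLB (cochL fP)).
- by rewrite cat_cons (coch_tgt fP) (mul_tgt NP) (act_mul NP).
Qed.

(** The case of an empty list between prefix and insertion. *)
Lemma circ3_prefix0 f g (a d e : seq U) n : coch f ->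
  Sw a (fun xs y => mul (circ3 f g xs d e) (act y n)) =
  dl g d (fun x m => Sw a (fun xs y =>
    mul (f (xs ++ x :: e)) (act y (mul m n)))).
Proof.
move=> fP; have := circ3_prefix g a [::] d e n fP; rewrite Sw_nil.
under eq_Sw do rewrite cats0; move=> ->.
by apply: eq_dl => x m; rewrite (act_one NP).
Qed.

Lemma co_sum_Sw W (F : U -> N -> W) us (K : seq U -> U -> N) : balN F ->
  \sum_(x <- co (Sw us K)) F x.1 x.2 =
  Sw us (fun xs y => \sum_(x <- co (K xs y)) F x.1 x.2).
Proof.
move=> FP; apply: (raddf_Sw B us (f := fun n => \sum_(x <- co n) F x.1 x.2)).
by move=> m n; apply: (co_sumD NP).
Qed.

Lemma co_sum_big W (F : U -> N -> W) I (s : seq I) (K : I -> N) : balN F ->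
  \sum_(x <- co (\sum_(i <- s) K i)) F x.1 x.2 =
  \sum_(i <- s) \sum_(x <- co (K i)) F x.1 x.2.
Proof.
move=> FP; apply: (additive_sum (f := fun n => \sum_(x <- co n) F x.1 x.2)).
by move=> m n; apply: (co_sumD NP).
Qed.

Lemma co_sum_dl W (F : U -> N -> W) g b (K : U -> N -> N) : balN F ->
  \sum_(x <- co (dl g b K)) F x.1 x.2 =
  dl g b (fun y n => \sum_(x <- co (K y n)) F x.1 x.2).
Proof.
move=> FP; apply: (raddf_dl g b (f := fun n => \sum_(x <- co n) F x.1 x.2)).
by move=> m n; apply: (co_sumD NP).
Qed.

(** Coassociativity of a list in which an element [x] with coefficient [n],
    coming from [h] applied to [c], has been inserted between [b] and [d]: the
    coefficient moves past [b] by the Yetter-Drinfel'd condition. *)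
Lemma Sw_insert W h (b c d : seq U) (R : seq U -> U -> N -> W) :
  coch h -> (forall q, mix B (fun ls p => R ls p q)) ->
  (forall ls w, balN (fun p q => R ls (p * w) q)) ->
  Sw b (fun bs y => Sw c (fun cs z => Sw d (fun ds w =>
    dl h cs (fun x n => Sw bs (fun bs' y' => \sum_(z' <- co (act y' n))
      R (bs' ++ x :: ds) (z'.1 * y * (z * w)) z'.2))))) =
  Sw b (fun bs y => dl h c (fun x n => Sw (bs ++ x :: d) (fun ls p =>
    R ls p (act y n)))).
Proof.
move=> hP RM RP.
have RPact ls w n : balA B (fun p q => R ls (p * w) (act q n)).
  split=> [p p' q|p q q'|a p q].
  - exact: (bal2Dl (RP _ _)).
  - by rewrite (actDl NP) (bal2Dr (RP _ _)).
  - by rewrite (bal2A (RP _ _)) (act_mul NP).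
pose Q w n ls y := \sum_(v <- cop B y) R ls (v.1 * w) (act v.2 n).
have QD s1 s2 u v w n y : Q w n (s1 ++ (u + v) :: s2) y =
    Q w n (s1 ++ u :: s2) y + Q w n (s1 ++ v :: s2) y.
  by rewrite -big_split; apply: eq_bigr => v' _; rewrite (mixDl (RM _)).
have QP w n : mix B (Q w n).
  split=> [s1 s2 u v y|s y y'|s1 s2 a u v y|a u s y].
  - exact: QD.
  - exact: (cop_sumD (RPact _ _ _)).
  - by apply: eq_bigr => v' _; rewrite (mixB (RM _)).
  - rewrite /Q (cop_sum_srcl (RPact _ _ _)).
    by apply: eq_bigr => v' _; rewrite (mixA (RM _)) mulrA.
have QDw w w' n ls y : Q (w + w') n ls y = Q w n ls y + Q w' n ls y.
  by rewrite -big_split; apply: eq_bigr => v _; rewrite mulrDr (mixDr (RM _)).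
transitivity (Sw c (fun cs z => dl h cs (fun x n => Sw d (fun ds w =>
    Sw b (fun bs y => \sum_(z' <- co n) Q (z'.1 * z * w) z'.2 (bs ++ x :: ds) y))))).
  rewrite exchange_Sw; apply: eq_Sw => cs z _.
  rewrite exchange_Sw exchange_dl_Sw; apply: eq_Sw => ds w _.
  rewrite -exchange_dl_Sw; apply: eq_dl => x n.
  rewrite (@Sw_coassoc _ _ _ _ _ (fun bs' y' y => \sum_(z' <- co (act y' n))
      R (bs' ++ x :: ds) (z'.1 * y * (z * w)) z'.2)).
    apply: eq_Sw => bs y _; rewrite (YD_sum NP _ _ (RP _ (z * w))).
    rewrite exchange_big; apply: eq_bigr => z' _; apply: eq_bigr => v _ /=.
    by rewrite !mulrA.
  split=> [s1 s2 u v y y'|s|s1 s2 a u v y y'|a u s y y'].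
  - rewrite -big_split; apply: eq_bigr => z' _.
    by rewrite -!catA !cat_cons (mixDl (RM _)).
  - exact: (balA_co NP n (RP _ (z * w))).
  - by apply: eq_bigr => z' _; rewrite -!catA !cat_cons (mixB (RM _)).
  - rewrite (act_mul NP) (co_sum_src NP (balN_mull (RP _ (z * w)) y')).
    by apply: eq_bigr => z' _; rewrite cat_cons (mixA (RM _)) !mulrA.
pose P x y n := Sw d (fun ds w => Sw b (fun bs y' => Q (y * w) n (bs ++ x :: ds) y')).
transitivity (dl h c (fun x n => \sum_(v <- cop B x) P v.1 v.2 n)).
  rewrite (dl_cop c hP).
  - apply: eq_Sw => cs z _; apply: eq_dl => x n; rewrite /P -Sw_sum.
    by apply: eq_Sw => ds w _; rewrite -Sw_sum.
  - move=> n; split=> [x x' y|x y y'|a x y].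
    + rewrite -SwD; apply: eq_Sw => ds w _; rewrite -SwD.
      by apply: eq_Sw => bs y' _; rewrite QD.
    + rewrite -SwD; apply: eq_Sw => ds w _; rewrite -SwD; apply: eq_Sw => bs y0 _.
      by rewrite mulrDl QDw.
    + apply: eq_Sw => ds w _; have := Sw_takeuchi a b x ds 1 (QP (y * w) n).
      under eq_Sw do rewrite mulr1; move=> ->; apply: eq_Sw => bs y' _.
      rewrite mulr1 /Q (cop_sum_srcr _ _ (RPact _ _ _)).
      by apply: eq_bigr => v _; rewrite !mulrA.
  - move=> x; split=> [y y' n|y n n'|a y n].
    + rewrite -SwD; apply: eq_Sw => ds w _; rewrite -SwD; apply: eq_Sw => bs y0 _.
      by rewrite mulrDl QDw.
    + rewrite -SwD; apply: eq_Sw => ds w _; rewrite -SwD; apply: eq_Sw => bs y0 _.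
      rewrite -big_split; apply: eq_bigr => v _.
      by rewrite actDr (bal2Dr (RP _ (y * w))).
    + apply: eq_Sw => ds w _; apply: eq_Sw => bs y' _.
      have := cop_takeuchi_sum (RPact (bs ++ x :: ds) (y * w) n) a y'.
      under eq_bigr do rewrite -mulrA [tgt _ _ * _]mulrA.
      by under [in RHS]eq_bigr do rewrite (act_mul NP).
rewrite -exchange_dl_Sw; apply: eq_dl => x n.
transitivity (\sum_(v <- cop B x) Sw d (fun ds w => Sw b (fun bs y =>
    Sw bs (fun bs' y' => R (bs' ++ v.1 :: ds) (y' * (v.2 * w)) (act y n))))).
  apply: eq_bigr => v _; apply: eq_Sw => ds w _.
  rewrite (@Sw_coassoc _ _ _ _ _ (fun bs' y' y =>
    R (bs' ++ v.1 :: ds) (y' * (v.2 * w)) (act y n))) //.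
  split=> [s1 s2 u u' y y'|s|s1 s2 a u u' y y'|a u s y y'].
  - by rewrite -!catA !cat_cons (mixDl (RM _)).
  - exact: RPact.
  - by rewrite -!catA !cat_cons (mixB (RM _)).
  - by rewrite cat_cons (mixA (RM _)) mulrA.
under eq_bigr do rewrite exchange_Sw.
rewrite -Sw_sum; apply: eq_Sw => bs y _.
rewrite Sw_cat; under eq_bigr do rewrite exchange_Sw.
rewrite -Sw_sum; apply: eq_Sw => bs' y' _.
by rewrite Sw_cons; apply: eq_bigr => v _; apply: eq_Sw => ds w _.
Qed.

(** The maps [dl] turn partial composition into insertion. *)
Lemma dl_circ3 W g h (G : seq U -> N) b c d (F : U -> N -> W) :
  coch g -> coch h -> balN F ->
  (forall b' c' d', size b' = size b -> size c' = size c -> size d' = size d ->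
     G (b' ++ c' ++ d') = circ3 g h b' c' d') ->
  dl G (b ++ c ++ d) F =
  Sw b (fun bs y => dl h c (fun x n => dl g (bs ++ x :: d)
    (fun x' m => F x' (mul m (act y n))))).
Proof.
move=> gP hP FP GE.
pose R ls p q := \sum_(z <- co (g ls)) F (z.1 * p) (mul z.2 q) : W.
have FP' p q : balN (fun u m => F (u * p) (mul m q)).
  split=> *; rewrite ?mulrDl ?(mulDl NP) ?(bal2Dl FP) ?(bal2Dr FP) //.
  by rewrite -mulrA (bal2A FP) (src_mulN NP).
have FPq q : balN (fun u m => F u (mul m q)).
  split=> *; rewrite ?(mulDl NP) ?(bal2Dl FP) ?(bal2Dr FP) //.
  by rewrite (bal2A FP) (src_mulN NP).
rewrite -(@Sw_insert _ h b c d R hP).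
- rewrite {1}/dl Sw_cat.
  apply: eq_Sw => bs y szb; rewrite Sw_cat; apply: eq_Sw => cs z szc.
  apply: eq_Sw => ds w szd; rewrite GE // /circ3.
  rewrite (co_sum_Sw _ _ (balN_mull FP (y * (z * w)))).
  rewrite exchange_dl_Sw; apply: eq_Sw => bs' y' _.
  rewrite (co_sum_dl _ _ _ (balN_mull FP (y * (z * w)))); apply: eq_dl => x n.
  rewrite (co_sumM NP (balN_mull FP (y * (z * w)))) exchange_big.
  apply: eq_bigr => z' _; apply: eq_bigr => x' _.
  by rewrite !mulrA.
- by move=> q; apply: (coch_co gP (FPq q)).
- move=> ls w; split=> [p p' q|p q q'|a p q].
  + rewrite -big_split; apply: eq_bigr => z _.
    by rewrite mulrDl mulrDr (bal2Dl FP).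
  + by rewrite -big_split; apply: eq_bigr => z _; rewrite (mulDr NP) (bal2Dr FP).
  + transitivity (\sum_(z <- co (g ls)) F (z.1 * tgt B a * (p * w)) (mul z.2 q)).
      by apply: eq_bigr => z _; rewrite !mulrA.
    rewrite (co_takeuchi NP a _ (FP' (p * w) q)).
    by apply: eq_bigr => z _; rewrite (mul_tgt NP).
Qed.

(** Insertion of [g] and [h] at two different places.  [X] and [Y] stand for
    the two composites of [f], which are only prescribed on lists of the
    lengths that occur.  Braided commutativity interchanges the coefficients of
    [g] and [h]. *)
Lemma circ3_parallel f g h (X Y : seq U -> N) (a b c d e : seq U) :
  braided_comm act co mul -> coch f -> coch h ->
  (forall xs x, size xs = size a ->
     X (xs ++ x :: c ++ d ++ e) = circ3 f g (xs ++ x :: c) d e) ->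
  (forall xs bs zs x, size xs = size a -> size bs = size b ->
     size zs = size c ->
     Y (xs ++ bs ++ zs ++ x :: e) = circ3 f h xs bs (zs ++ x :: e)) ->
  circ3 X h a b (c ++ d ++ e) = circ3 Y g (a ++ b ++ c) d e.
Proof.
move=> BC fP hP XE YE.
pose P x y n := Sw c (fun zs z => dl g d (fun x' m => Sw a (fun xs y' =>
  mul (f (xs ++ (x :: zs) ++ x' :: e)) (act y' (mul (act (y * z) m) n))))).
transitivity (dl h b (fun x n => \sum_(v <- cop B x) P v.1 v.2 n)).
  rewrite {1}/circ3.
  under eq_Sw do under eq_dl do rewrite XE //.
  rewrite -exchange_dl_Sw; apply: eq_dl => x n.
  by rewrite circ3_prefix // Sw_cons.
rewrite (dl_cop b hP).
- transitivity (Sw b (fun bs w => dl h bs (fun x n => Sw c (fun zs z =>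
      dl g d (fun x' m => Sw a (fun xs y => mul (f (xs ++ (x :: zs) ++ x' :: e))
        (act y (mul n (act (w * z) m))))))))).
    apply: eq_Sw => bs w _.
    apply: eq_dl => x n; rewrite /P -Sw_sum; apply: eq_Sw => zs z _.
    rewrite -dl_sum; apply: eq_dl => x' m; rewrite -Sw_sum; apply: eq_Sw => xs y _.
    rewrite (BC n) linear_sum mul_sumr; apply: eq_bigr => n' _.
    by rewrite -mulrA (act_mul NP n'.1).
  rewrite [RHS]/circ3 Sw_cat.
  transitivity (Sw a (fun xs y => Sw b (fun bs w => Sw c (fun zs z =>
      dl g d (fun x' m => mul (circ3 f h xs bs (zs ++ x' :: e))
        (act y (act (w * z) m))))))); last first.
    apply: eq_Sw => xs y sza; rewrite Sw_cat; apply: eq_Sw => bs w szb.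
    apply: eq_Sw => zs z szc; apply: eq_dl => x' m.
    by rewrite -!catA YE // (act_mul NP y).
  rewrite exchange_Sw; apply: eq_Sw => bs w _.
  rewrite exchange_Sw exchange_dl_Sw; apply: eq_Sw => zs z _.
  rewrite -exchange_dl_Sw exchange_dl; apply: eq_dl => x' m.
  by rewrite circ3_prefix0.
- move=> n; split=> [x x' y|x y y'|a' x y].
  + rewrite -SwD; apply: eq_Sw => zs z _; rewrite -dlD; apply: eq_dl => x0 m.
    rewrite -SwD; apply: eq_Sw => xs y0 _.
    by rewrite cat_cons (balLD (cochL fP)) (mulDl NP).
  + rewrite -SwD; apply: eq_Sw => zs z _; rewrite -dlD; apply: eq_dl => x0 m.
    rewrite -SwD; apply: eq_Sw => xs y0 _.
    by rewrite mulrDl (actDl NP) (mulDl NP) actDr (mulDr NP).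
  + apply: eq_Sw => zs z _; apply: eq_dl => x0 m.
    have := bal2A (balN_prefix a (zs ++ x0 :: e) fP) a' x (mul (act (y * z) m) n).
    by rewrite (src_mulN NP) -(act_mul NP) mulrA.
- move=> x; split=> [y y' n|y n n'|a' y n].
  + rewrite -SwD; apply: eq_Sw => zs z _; rewrite -dlD; apply: eq_dl => x0 m.
    rewrite -SwD; apply: eq_Sw => xs y0 _.
    by rewrite mulrDl (actDl NP) (mulDl NP) actDr (mulDr NP).
  + rewrite -SwD; apply: eq_Sw => zs z _; rewrite -dlD; apply: eq_dl => x0 m.
    rewrite -SwD; apply: eq_Sw => xs y0 _.
    by rewrite (mulDr NP) actDr (mulDr NP).
  + apply: eq_Sw => zs z _; apply: eq_dl => x0 m; apply: eq_Sw => xs y0 _.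
    by rewrite -mulrA (act_mul NP (tgt B a')) (mul_tgt NP).
Qed.

(** Insertion of [h] into an argument of [g], with the same convention. *)
Lemma circ3_nested f g h (X Y : seq U -> N) (a b c d e : seq U) :
  coch f -> coch g -> coch h ->
  (forall xs bs x, size xs = size a -> size bs = size b ->
     X (xs ++ bs ++ x :: d ++ e) = circ3 f g xs (bs ++ x :: d) e) ->
  (forall b' c' d', size b' = size b -> size c' = size c -> size d' = size d ->
     Y (b' ++ c' ++ d') = circ3 g h b' c' d') ->
  circ3 X h (a ++ b) c (d ++ e) = circ3 f Y a (b ++ c ++ d) e.
Proof.
move=> fP gP hP XE YE; rewrite [RHS]/circ3 -exchange_dl_Sw.
rewrite (dl_circ3 gP hP (balN_prefix a e fP) YE) /circ3 Sw_cat exchange_Sw.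
apply: eq_Sw => bs w szb.
transitivity (dl h c (fun x n => Sw a (fun xs y =>
    mul (circ3 f g xs (bs ++ x :: d) e) (act y (act w n))))).
  rewrite exchange_dl_Sw; apply: eq_Sw => xs y sza; apply: eq_dl => x n.
  by rewrite -catA XE // (act_mul NP).
by apply: eq_dl => x n; rewrite circ3_prefix0.
Qed.

End Composition.

Section Prefixes.
Variables (k : comNzRingType) (A U : algType k) (B : bialgebroid A U).
Variable W : zmodType.
Implicit Types (a : A) (u v w : U).
Local Notation Sw := (Sw B).

(** Functions of a list, a further argument and a second list, such that the
    Sweedler sum over a prefix of a list is a balanced function of that list. *)
Record preK (K : seq U -> U -> seq U -> W) : Prop := PreK {
  pkD : forall s1 s2 u v y t,
    K (s1 ++ (u + v) :: s2) y t = K (s1 ++ u :: s2) y t + K (s1 ++ v :: s2) y t;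
  pkY : forall s y y' t, K s (y + y') t = K s y t + K s y' t;
  pkB : forall s1 s2 a u v y t,
    K (s1 ++ u * tgt B a :: v :: s2) y t = K (s1 ++ u :: tgt B a * v :: s2) y t;
  pkA : forall a u s y t, K (tgt B a * u :: s) y t = K (u :: s) (src B a * y) t;
  pkT : forall s y, balL B (K s y);
  pkTA : forall a s y v t, K s (y * tgt B a) (v :: t) = K s y (tgt B a * v :: t)
}.

(** The Sweedler sum over the first [p] arguments. *)
Definition Pre p (K : seq U -> U -> seq U -> W) (us : seq U) : W :=
  Sw (take p us) (fun xs y => K xs y (drop p us)).

Lemma preK_mix K t : preK K -> mix B (fun xs y => K xs y t).
Proof.
move=> KP; split=> *; first exact: (pkD KP).
- exact: (pkY KP).
- exact: (pkB KP).
- exact: (pkA KP).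
Qed.

Lemma preK_cop K u : preK K ->
  preK (fun xs y t => \sum_(x <- cop B u) K (x.1 :: xs) (x.2 * y) t).
Proof.
move=> KP; split=> [s1 s2 v v' y t|s y y' t|s1 s2 a v v' y t|a v s y t|s y|a s y v t].
- exact: (mixDl (mix_cop u (preK_mix t KP))).
- exact: (mixDr (mix_cop u (preK_mix t KP))).
- exact: (mixB (mix_cop u (preK_mix t KP))).
- exact: (mixA (mix_cop u (preK_mix t KP))).
- split=> [s1 s2 v v'|s1 s2 a v v'].
  + by rewrite -big_split; apply: eq_bigr => x _; rewrite (balLD (pkT KP _ _)).
  + by apply: eq_bigr => x _; rewrite (balLB (pkT KP _ _)).
- by apply: eq_bigr => x _; rewrite mulrA (pkTA KP).
Qed.

Lemma Pre0 K us : Pre 0 K us = K [::] 1 us.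
Proof. by rewrite /Pre take0 drop0 Sw_nil. Qed.

Lemma PreS_in p K u us : Pre p.+1 K (u :: us) =
  Pre p (fun xs y t => \sum_(x <- cop B u) K (x.1 :: xs) (x.2 * y) t) us.
Proof. exact: Sw_cons_in. Qed.

Lemma PreS p K u us : Pre p.+1 K (u :: us) =
  \sum_(x <- cop B u) Pre p (fun xs y t => K (x.1 :: xs) (x.2 * y) t) us.
Proof. exact: Sw_cons. Qed.

Lemma Pre_balA p K us : preK K ->
  balA B (fun x y => Pre p (fun xs y' t => K (x :: xs) (y * y') t) us).
Proof.
move=> KP; split=> [x x' y|x y y'|a x y].
- by rewrite -SwD; apply: eq_Sw => xs y' _; apply: (pkD KP [::]).
- by rewrite -SwD; apply: eq_Sw => xs y0 _; rewrite mulrDl (pkY KP).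
- by apply: eq_Sw => xs y' _; rewrite (pkA KP) mulrA.
Qed.

Lemma Pre_tgt p K a u us : preK K ->
  Pre p K (tgt B a * u :: us) = Pre p (fun xs y => K xs (tgt B a * y)) (u :: us).
Proof.
move=> KP; case: p => [|p].
  by rewrite !Pre0 -(pkTA KP) mulr1 mul1r.
rewrite !PreS (cop_sum_tgtl (Pre_balA p us KP)); apply: eq_bigr => x _.
by apply: eq_Sw => xs y _; rewrite mulrA.
Qed.

Lemma Pre_balL p K : preK K -> balL B (Pre p K).
Proof.
move=> KP; split=> [s1|s1].
- elim: p s1 K KP => [|p IH] [|u0 s1] K KP s2 u v.
  + by rewrite !Pre0 (balLD (pkT KP _ _)).
  + by rewrite !Pre0 (balLD (pkT KP _ _)).
  + by rewrite /= !PreS (cop_sumD (Pre_balA p s2 KP)).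
  + by rewrite !PreS_in; apply: IH; apply: preK_cop.
- elim: p s1 K KP => [|p IH] [|u0 s1] K KP s2 a u v.
  + by rewrite !Pre0 (balLB (pkT KP _ _)).
  + by rewrite !Pre0 (balLB (pkT KP _ _)).
  + rewrite [RHS]PreS_in Pre_tgt; last exact: preK_cop.
    rewrite /= PreS (cop_sum_tgtr _ _ (Pre_balA p (v :: s2) KP)) /Pre -Sw_sum.
    by apply: eq_Sw => xs y _; apply: eq_bigr => x _; rewrite mulrA.
  + by rewrite !PreS_in; apply: IH; apply: preK_cop.
Qed.

Lemma Sw_tgt F a u us : mix B F ->
  Sw (tgt B a * u :: us) F =
  Sw (u :: us) (fun xs y => F xs (tgt B a * y)) :> W.
Proof.
move=> FP.
have G : balA B (fun x y => Sw us (fun xs y' => F (x :: xs) (y * y'))).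
  split=> [x x' y|x y y'|b x y].
  - by rewrite -SwD; apply: eq_Sw => xs y' _; apply: (mixDl FP [::]).
  - by rewrite -SwD; apply: eq_Sw => xs y0 _; rewrite mulrDl (mixDr FP).
  - by apply: eq_Sw => xs y' _; rewrite (mixA FP) mulrA.
rewrite !Sw_cons (cop_sum_tgtl G); apply: eq_bigr => x _.
by apply: eq_Sw => xs y _; rewrite mulrA.
Qed.

Lemma Sw_balL F : mix B F -> balL B (fun us => Sw us F : W).
Proof.
move=> FP; split=> [s1|s1].
- elim: s1 F FP => [|u0 s1 IH] F FP s2 u v; last first.
    by rewrite !cat_cons !Sw_cons_in; apply: IH; apply: mix_cop.
  have G : balA B (fun x y => Sw s2 (fun xs y' => F (x :: xs) (y * y'))).
    split=> [x x' y|x y y'|b x y].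
    - by rewrite -SwD; apply: eq_Sw => xs y' _; apply: (mixDl FP [::]).
    - by rewrite -SwD; apply: eq_Sw => xs y0 _; rewrite mulrDl (mixDr FP).
    - by apply: eq_Sw => xs y' _; rewrite (mixA FP) mulrA.
  by rewrite !Sw_cons (cop_sumD G).
- elim: s1 F FP => [|u0 s1 IH] F FP s2 a u v; last first.
    by rewrite !cat_cons !Sw_cons_in; apply: IH; apply: mix_cop.
  have G : balA B (fun x y => Sw (v :: s2) (fun xs y' => F (x :: xs) (y * y'))).
    split=> [x x' y|x y y'|b x y].
    - by rewrite -SwD; apply: eq_Sw => xs y' _; apply: (mixDl FP [::]).
    - by rewrite -SwD; apply: eq_Sw => xs y0 _; rewrite mulrDl (mixDr FP).
    - by apply: eq_Sw => xs y' _; rewrite (mixA FP) mulrA.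
  rewrite [RHS]Sw_cons_in (Sw_tgt _ _ _ (mix_cop u FP)).
  rewrite /= Sw_cons (cop_sum_tgtr _ _ G) -Sw_sum; apply: eq_Sw => xs y _.
  by apply: eq_bigr => x _; rewrite mulrA.
Qed.

End Prefixes.

Section Insertion.
Variables (k : comNzRingType) (A U : algType k) (B : bialgebroid A U).
Variables (N : lmodType k) (act : U -> {linear N -> N}).
Variables (lact : A -> {linear N -> N}) (co : N -> seq (U * N)).
Variables (mul : N -> N -> N) (oneN : N).
Hypothesis NP : is_YDalgebra B act lact co mul oneN.
Implicit Types (a : A) (u v w : U) (m n : N) (W : zmodType) (g : seq U -> N).
Local Notation Sw := (Sw B).
Local Notation balN := (balN B act).

(** Functions of a list and an element of $N$ that are balanced over $A$
    between the first entry of the list and $N$. *)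
Record mixN W (F : seq U -> N -> W) : Prop := MixN {
  mixNDl : forall s1 s2 u v n,
    F (s1 ++ (u + v) :: s2) n = F (s1 ++ u :: s2) n + F (s1 ++ v :: s2) n;
  mixNDr : forall s n n', F s (n + n') = F s n + F s n';
  mixNB : forall s1 s2 a u v n,
    F (s1 ++ u * tgt B a :: v :: s2) n = F (s1 ++ u :: tgt B a * v :: s2) n;
  mixNA : forall a u s n, F (tgt B a * u :: s) n = F (u :: s) (act (src B a) n)
}.

(** Insertion of the [q]-ary cochain [g] after the first [j] arguments of [F],
    the coefficient of [g] becoming the last argument of [F]. *)
Definition Ins W j q g (F : seq U -> N -> W) (us : seq U) : W :=
  Sw (take j us) (fun xs y => dl B co g (take q (drop j us))
    (fun x n => F (xs ++ x :: drop q (drop j us)) (act y n))).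

Lemma Ins0 W q g (F : seq U -> N -> W) us : Ins 0 q g F us =
  Pre B q (fun ys z t => \sum_(x <- co (g ys)) F (x.1 * z :: t) x.2) us.
Proof.
rewrite /Ins take0 drop0 Sw_nil; apply: eq_Sw => ys z _.
by apply: eq_bigr => x _; rewrite (act_one NP).
Qed.

Lemma InsS W j q g (F : seq U -> N -> W) u us : Ins j.+1 q g F (u :: us) =
  Ins j q g (fun l n => \sum_(x <- cop B u) F (x.1 :: l) (act x.2 n)) us.
Proof.
rewrite /Ins Sw_cons_in; apply: eq_Sw => xs y _; rewrite -dl_sum.
by apply: eq_dl => x n; apply: eq_bigr => v _; rewrite (act_mul NP).
Qed.

Lemma mixN_balA W (F : seq U -> N -> W) l n :
  mixN F -> balA B (fun x y => F (x :: l) (act y n)).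
Proof.
move=> FP; split=> *; first exact: (mixNDl FP [::]).
- by rewrite (actDl NP) (mixNDr FP).
- by rewrite (mixNA FP) (act_mul NP).
Qed.

Lemma mixN_cop W (F : seq U -> N -> W) u : mixN F ->
  mixN (fun l n => \sum_(x <- cop B u) F (x.1 :: l) (act x.2 n)).
Proof.
move=> FP; split=> [s1 s2 v v' n|s n n'|s1 s2 a v v' n|a v s n].
- by rewrite -big_split; apply: eq_bigr => x _; rewrite -!cat_cons (mixNDl FP).
- by rewrite -big_split; apply: eq_bigr => x _; rewrite actDr (mixNDr FP).
- by apply: eq_bigr => x _; rewrite -!cat_cons (mixNB FP).
- have := cop_takeuchi_sum (mixN_balA (v :: s) n FP) a u.
  under eq_bigr do rewrite -[_ :: _ :: _]cat0s (mixNB FP) /=; move=> ->.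
  by apply: eq_bigr => x _; rewrite (act_mul NP).
Qed.

Lemma Ins0_preK W g (F : seq U -> N -> W) : coch B act g -> mixN F ->
  preK B (fun ys z t => \sum_(x <- co (g ys)) F (x.1 * z :: t) x.2).
Proof.
move=> gP FP.
have G t : balN (fun x n => F (x :: t) n).
  split=> *; first exact: (mixNDl FP [::]).
    exact: (mixNDr FP).
  exact: (mixNA FP).
have M t := coch_co NP gP (G t).
split=> [s1 s2 u v y t|s y y' t|s1 s2 a u v y t|a u s y t|s y|a s y v t].
- exact: (mixDl (M t)).
- exact: (mixDr (M t)).
- exact: (mixB (M t)).
- exact: (mixA (M t)).
- split=> [s1 s2 u v|s1 s2 a u v].
  + by rewrite -big_split; apply: eq_bigr => x _; rewrite -!cat_cons (mixNDl FP).
  + by apply: eq_bigr => x _; rewrite -!cat_cons (mixNB FP).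
- by apply: eq_bigr => x _; rewrite mulrA; apply: (mixNB FP [::]).
Qed.

Lemma Ins_balA W j q g (F : seq U -> N -> W) us : mixN F ->
  balA B (fun x y => Ins j q g (fun l n => F (x :: l) (act y n)) us).
Proof.
move=> FP; split=> [x x' y|x y y'|a x y].
- rewrite -SwD; apply: eq_Sw => xs y' _; rewrite -dlD; apply: eq_dl => *.
  exact: (mixNDl FP [::]).
- rewrite -SwD; apply: eq_Sw => xs y0 _; rewrite -dlD; apply: eq_dl => *.
  by rewrite (actDl NP) (mixNDr FP).
- apply: eq_Sw => xs y' _; apply: eq_dl => *.
  by rewrite (mixNA FP) (act_mul NP).
Qed.

Lemma InsS_sum W j q g (F : seq U -> N -> W) u us : Ins j.+1 q g F (u :: us) =
  \sum_(x <- cop B u) Ins j q g (fun l n => F (x.1 :: l) (act x.2 n)) us.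
Proof.
rewrite InsS /Ins -Sw_sum; apply: eq_Sw => xs y _; exact: dl_sum.
Qed.

Lemma Ins_tgt W j q g (F : seq U -> N -> W) a u us : coch B act g -> mixN F ->
  Ins j q g F (tgt B a * u :: us) =
  Ins j q g (fun l n => F l (act (tgt B a) n)) (u :: us).
Proof.
move=> gP FP; case: j => [|j].
  rewrite !Ins0 (Pre_tgt _ _ _ _ (Ins0_preK gP FP)); apply: eq_Sw => ys z _.
  rewrite -(co_takeuchi NP (F := fun x n => F (x * z :: _) n)).
    by apply: eq_bigr => x _; rewrite mulrA.
  split=> *; first by rewrite mulrDl; apply: (mixNDl FP [::]).
    exact: (mixNDr FP).
  by rewrite -mulrA (mixNA FP).
rewrite !InsS_sum (cop_sum_tgtl (Ins_balA j q g us FP)); apply: eq_bigr => x _.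
by apply: eq_Sw => xs y _; apply: eq_dl => z n; rewrite (act_mul NP).
Qed.

Lemma Ins_balL W j q g (F : seq U -> N -> W) : coch B act g -> mixN F ->
  balL B (Ins j q g F).
Proof.
move=> gP; elim: j F => [|j IH] F FP.
  have := Pre_balL q (Ins0_preK gP FP).
  by case=> F1 F2; split=> *; rewrite !Ins0 ?F1 ?F2.
have IHu u := IH _ (mixN_cop u FP).
split=> [[|u0 s1] s2 u v|[|u0 s1] s2 a u v].
- by rewrite /= !InsS_sum (cop_sumD (Ins_balA j q g s2 FP)).
- by rewrite !cat_cons !InsS (balLD (IHu u0)).
- rewrite [RHS]InsS Ins_tgt //; last exact: mixN_cop.
  rewrite /= InsS_sum (cop_sum_tgtr _ _ (Ins_balA j q g (v :: s2) FP)).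
  rewrite /Ins -Sw_sum; apply: eq_Sw => xs y _; rewrite -dl_sum; apply: eq_dl => z n.
  by apply: eq_bigr => x _; rewrite (act_mul NP).
- by rewrite !cat_cons !InsS (balLB (IHu u0)).
Qed.

Lemma mixN_mul f : coch B act f -> mixN (fun l n => mul (f l) n).
Proof.
move=> fP; split=> *; first by rewrite (balLD (cochL fP)) (mulDl NP).
- by rewrite (mulDr NP).
- by rewrite (balLB (cochL fP)).
- by rewrite (coch_tgt fP) (mul_tgt NP).
Qed.

(** Partial composition of cochains given on lists of arbitrary length; [g] is
    applied to the [q] arguments that follow the first [j] ones. *)
Definition lcirc j q (f g : seq U -> N) : seq U -> N :=
  Ins j q g (fun l n => mul (f l) n).

Lemma lcirc_coch j q f g : coch B act f -> coch B act g -> coch B act (lcirc j q f g).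
Proof.
move=> fP gP; split; first exact: (Ins_balL j q gP (mixN_mul fP)).
move=> a u s; rewrite /lcirc Ins_tgt //; last exact: mixN_mul.
rewrite (raddf_Sw B _ (f := act (tgt B a))); last exact: actDr.
apply: eq_Sw => xs y _.
rewrite (raddf_dl _ _ _ _ (f := act (tgt B a))); last exact: actDr.
by apply: eq_dl => x n; rewrite (tgt_mulN NP).
Qed.

Lemma InsE W j q g (F : seq U -> N -> W) (a b c : seq U) : size a = j -> size b = q ->
  Ins j q g F (a ++ b ++ c) =
  Sw a (fun xs y => dl B co g b (fun x n => F (xs ++ x :: c) (act y n))).
Proof.
by move=> <- <-; rewrite /Ins take_size_cat // drop_size_cat // take_size_cat //
  drop_size_cat.
Qed.

Lemma lcircE j q f g (a b c : seq U) : size a = j -> size b = q ->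
  lcirc j q f g (a ++ b ++ c) = circ3 B act co mul f g a b c.
Proof. exact: InsE. Qed.

End Insertion.

(** * The cyclic operator *)

Section Cyclic.
Variables (k : comNzRingType) (A U : algType k) (B : bialgebroid A U).
Variable H : left_hopf B.
Variables (N : lmodType k) (act : U -> {linear N -> N}).
Variables (lact : A -> {linear N -> N}) (co : N -> seq (U * N)).
Variables (mul : N -> N -> N) (oneN : N).
Hypothesis NP : is_YDalgebra B act lact co mul oneN.
Implicit Types (u v w : U) (m n : N) (W : zmodType) (g : seq U -> N).
Local Notation Sw := (Sw B).
Local Notation Tr := (Tr H).
Local Notation balN := (balN B act).
Local Notation coch := (coch B act).

(** The elements of $\mathrm{Hom}_{A^{op}}(U, N)$. *)
Record homN (f : U -> N) : Prop := HomN {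
  homND : forall u v, f (u + v) = f u + f v;
  homN_tgt : forall a u, f (tgt B a * u) = act (tgt B a) (f u)
}.

(** The properties of a stable contraaction on $N$ from which the cyclic operad
    axioms follow.  In [cc_aYD] the tensor $u_{+(1)} \otimes u_{+(2)} \otimes
    u_-$ is written as in [tr_cop_sum]; in [cc_mul] compatibility with the right
    $A$-action is strengthened to right $N$-linearity. *)
Record cyc_contra (gm : (U -> N) -> N) : Prop := CycContra {
  cc_add : forall f h, homN f -> homN h ->
    gm (fun u => f u + h u) = gm f + gm h;
  cc_assoc : forall h : U -> U -> N, balA B h -> (forall u, homN (h u)) ->
    gm (fun u => gm (h u)) = gm (fun u => \sum_(x <- cop B u) h x.1 x.2);
  cc_mul : forall f n, homN f ->
    gm (fun u => \sum_(x <- co n) mul (f (x.1 * u)) x.2) = mul (gm f) n;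
  cc_counit : forall m, gm (fun u => act (tgt B (cou B u)) m) = m;
  cc_stable : forall m, gm (fun u => act u m) = m;
  cc_tgtr : forall a f, homN f ->
    gm (fun w => f (w * tgt B a)) = gm (fun w => act (src B a) (f w));
  cc_aYD : forall u f, homN f ->
    act u (gm f) = gm (fun w =>
      \sum_(x <- cop B u) \sum_(p <- tr H x.2) act p.1 (f (p.2 * w * x.1)))
}.

Lemma homN0 : homN (fun=> 0).
Proof. by split=> *; rewrite ?addr0 ?linear0. Qed.

Lemma homN_sum I (s : seq I) (F : I -> U -> N) :
  (forall i, homN (F i)) -> homN (fun u => \sum_(i <- s) F i u).
Proof.
move=> FP; split=> [u v|a u].
- by rewrite -big_split; apply: eq_bigr => i _; apply: homND.
- by rewrite linear_sum; apply: eq_bigr => i _; apply: homN_tgt.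
Qed.

Lemma homN_mul f n : homN f -> homN (fun u => \sum_(x <- co n) mul (f (x.1 * u)) x.2).
Proof.
move=> fP; split=> [u v|a u].
- rewrite -big_split; apply: eq_bigr => x _.
  by rewrite mulrDr (homND fP) (mulDl NP).
- under eq_bigr do rewrite mulrA.
  rewrite (@co_takeuchi _ _ _ _ _ _ _ _ _ _ NP _ (fun x n => mul (f (x * u)) n)).
    by rewrite linear_sum; apply: eq_bigr => x _; rewrite /= (tgt_mulN NP).
  split=> *; first by rewrite mulrDl (homND fP) (mulDl NP).
    by rewrite (mulDr NP).
  by rewrite -mulrA (homN_tgt fP) (mul_tgt NP).
Qed.

Variable gm : (U -> N) -> N.
Hypothesis gmP : cyc_contra gm.
Hypothesis BC : braided_comm act co mul.

Lemma eq_gm f h : (forall u, f u = h u) -> gm f = gm h.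
Proof. by move=> fh; congr gm; apply: funext. Qed.

Lemma gm0 : gm (fun=> 0) = 0.
Proof.
apply: (addrI (gm (fun=> 0))); rewrite -(cc_add gmP homN0 homN0) [RHS]addr0.
by apply: eq_gm => u; rewrite addr0.
Qed.

Lemma gm_sum I (s : seq I) (F : I -> U -> N) : (forall i, homN (F i)) ->
  gm (fun u => \sum_(i <- s) F i u) = \sum_(i <- s) gm (F i).
Proof.
move=> FP; elim: s => [|i s IH].
  by rewrite big_nil -[RHS]gm0; apply: eq_gm => u; rewrite big_nil.
rewrite big_cons -IH -(cc_add gmP (FP i) (homN_sum s FP)).
by apply: eq_gm => u; rewrite big_cons.
Qed.

Lemma gm_Sw us (F : seq U -> U -> U -> N) : (forall xs y, homN (F xs y)) ->
  gm (fun w => Sw us (fun xs y => F xs y w)) = Sw us (fun xs y => gm (F xs y)).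
Proof. by move=> FP; apply: gm_sum => xs. Qed.

Lemma homN_Sw us (F : seq U -> U -> U -> N) : (forall xs y, homN (F xs y)) ->
  homN (fun w => Sw us (fun xs y => F xs y w)).
Proof. by move=> FP; apply: homN_sum => xs. Qed.

Lemma gm_dl g b (F : U -> N -> U -> N) : (forall x n, homN (F x n)) ->
  gm (fun w => dl B co g b (fun x n => F x n w)) =
  dl B co g b (fun x n => gm (F x n)).
Proof.
move=> FP; rewrite (gm_Sw b (F := fun ys z w =>
  \sum_(x <- co (g ys)) F (x.1 * z) x.2 w)).
  by apply: eq_Sw => ys z _; apply: gm_sum.
by move=> ys z; apply: homN_sum.
Qed.

Lemma homN_dl g b (F : U -> N -> U -> N) : (forall x n, homN (F x n)) ->
  homN (fun w => dl B co g b (fun x n => F x n w)).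
Proof.
move=> FP; apply: (homN_Sw b (F := fun ys z w =>
  \sum_(x <- co (g ys)) F (x.1 * z) x.2 w)) => ys z.
by apply: homN_sum.
Qed.

(** [cc_mul] for the multiples $a 1_N$ of the unit. *)
Lemma gm_src a f : homN f ->
  gm (fun u => f (src B a * u)) = act (tgt B a) (gm f).
Proof.
move=> fP; rewrite -(mul_iotr NP) -(cc_mul gmP _ fP); apply: eq_gm => u.
rewrite (@co_sum_iot _ _ _ _ _ _ _ _ _ _ NP _ (fun x n => mul (f (x * u)) n)).
  by rewrite (YDalg_1r NP).
split=> *; first by rewrite mulrDl (homND fP) (mulDl NP).
  by rewrite (mulDr NP).
by rewrite -mulrA (homN_tgt fP) (mul_tgt NP).
Qed.

(** $f(u^1, \ldots, u^n)$ extended $U$-linearly: $u^0 f(u^1, \ldots, u^n)$ *)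
Definition tilde f (us : seq U) : N := if us is u :: us' then act u (f us') else 0.

Lemma tilde_coch f : coch f -> coch (tilde f).
Proof.
move=> fP; split; last by move=> a u s /=; rewrite (act_mul NP).
split=> [[|u0 s1] s2 u v|[|u0 s1] s2 a u v] /=.
- exact: (actDl NP).
- by rewrite (balLD (cochL fP)) actDr.
- by rewrite (act_mul NP) (coch_tgt fP).
- by rewrite (balLB (cochL fP)).
Qed.

Lemma Tr_coch f a us w : coch f -> Tr f us (tgt B a * w) = act (tgt B a) (Tr f us w).
Proof.
move=> fP; case: us => [|u us]; first by rewrite !Tr_nil (coch_tgt fP).
rewrite (Tr_tgtr H _ _ _ _ (cochL fP)) Tr_cons linear_sum; apply: eq_bigr => x _.
rewrite /= (raddf_Tr _ _ _ _ (f := act (tgt B a))); last exact: actDr.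
by apply: eq_Tr => l _; rewrite (coch_tgt fP).
Qed.

Lemma Tr_homN f us : coch f -> homN (Tr f us).
Proof.
move=> fP; split=> [w w'|a w]; last exact: Tr_coch.
exact: (mixDr (Tr_mix H (cochL fP))).
Qed.

(** $u^1_+ f(u^2_+, \ldots, u^n_+, u^n_- \cdots u^1_- w)$, the function of $w$
    to which the cyclic operator applies the contraaction. *)
Definition Et f := Tr (tilde f).

Lemma Et_mix f : coch f -> mix B (Et f).
Proof. by move=> fP; apply/Tr_mix/cochL/tilde_coch. Qed.

Lemma Et_homN f us : coch f -> homN (Et f us).
Proof. by move=> fP; apply/Tr_homN/tilde_coch. Qed.

Lemma Et_homNr f us w : coch f -> homN (fun x => Et f us (x * w)).
Proof.
move=> fP; split=> *; first by rewrite mulrDl (homND (Et_homN us fP)).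
by rewrite -mulrA (homN_tgt (Et_homN us fP)).
Qed.

Lemma Et_cons f u us w : Et f (u :: us) w =
  \sum_(p <- tr H u) act p.1 (Tr f us (p.2 * w)).
Proof.
rewrite /Et Tr_cons; apply: eq_bigr => p _.
by rewrite (raddf_Tr _ _ _ _ (f := act p.1)) //; apply: actDr.
Qed.

Lemma act_balAop (F : U -> N) : homN F -> balAop B (fun x y => act x (F y)).
Proof.
move=> FP; split=> *; first exact: (actDl NP).
  by rewrite (homND FP) actDr.
by rewrite (act_mul NP) (homN_tgt FP).
Qed.

Lemma homN_mulr (F : U -> N) w : homN F -> homN (fun x => F (x * w)).
Proof.
move=> FP; split=> *; first by rewrite mulrDl (homND FP).
by rewrite -mulrA (homN_tgt FP).
Qed.

Lemma Et_mul f v u us w : coch f -> Et f (v * u :: us) w =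
  \sum_(p <- tr H v) act p.1 (Et f (u :: us) (p.2 * w)).
Proof.
move=> fP; rewrite Et_cons.
have G := act_balAop (homN_mulr w (Tr_homN us fP)).
rewrite (tr_sumM H G); apply: eq_bigr => p _; rewrite Et_cons linear_sum.
by apply: eq_bigr => q _; rewrite /= (act_mul NP) mulrA.
Qed.

Lemma Et_src f a u us w : coch f ->
  Et f (src B a * u :: us) w = act (src B a) (Et f (u :: us) w).
Proof.
move=> fP; rewrite !Et_cons.
rewrite (tr_sum_srcl H (act_balAop (homN_mulr w (Tr_homN us fP)))) linear_sum.
by apply: eq_bigr => p _; rewrite /= (act_mul NP).
Qed.

Lemma Et_cop f u us w :
  coch f -> \sum_(x <- cop B u) Et f (x.1 :: us) (x.2 * w) = act u (Tr f us w).
Proof.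
move=> fP; have := cop_tr_sum H (act_balAop (homN_mulr w (Tr_homN us fP))) u.
rewrite mul1r => <-; apply: eq_bigr => x _; rewrite Et_cons; apply: eq_bigr => p _.
by rewrite mulrA.
Qed.

Lemma Et_lin f v u us w : coch f ->
  \sum_(x <- cop B v) Et f (x.1 * u :: us) (x.2 * w) = act v (Et f (u :: us) w).
Proof.
move=> fP.
have := cop_tr_sum H (act_balAop (homN_mulr w (Et_homN (u :: us) fP))) v.
rewrite mul1r => <-; apply: eq_bigr => x _.
by rewrite Et_mul //; apply: eq_bigr => p _; rewrite mulrA.
Qed.

(** The cyclic operator on functions of lists. *)
Definition ltau f (us : seq U) : N :=
  if us is [::] then gm (fun u => act u (f [::])) else gm (Et f us).

Lemma ltau_nil f : ltau f [::] = f [::].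
Proof. exact: (cc_stable gmP). Qed.

Lemma ltau_coch f : coch f -> coch (ltau f).
Proof.
move=> fP; have EM := Et_mix fP; split; last first.
  move=> a u s; rewrite /= -(gm_src a (Et_homN _ fP)); apply: eq_gm => w.
  exact: (mixA EM).
have ltauE s1 u s2 : ltau f (s1 ++ u :: s2) = gm (Et f (s1 ++ u :: s2)).
  by case: s1.
split=> *; rewrite !ltauE.
- rewrite -(cc_add gmP (Et_homN _ fP) (Et_homN _ fP)); apply: eq_gm => w.
  exact: (mixDl EM).
- by apply: eq_gm => w; apply: (mixB EM).
Qed.

Lemma tilde_circ3 f g u (a b c : seq U) :
  circ3 B act co mul (tilde f) g (u :: a) b c =
  act u (circ3 B act co mul f g a b c).
Proof.
rewrite /circ3 (raddf_Sw B _ (f := act u)); last exact: actDr.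
rewrite Sw_cons_in; apply: eq_Sw => xs y _.
rewrite (raddf_dl _ _ _ _ (f := act u)); last exact: actDr.
rewrite -dl_sum; apply: eq_dl => x n; rewrite (act_mulN NP).
by apply: eq_bigr => v _; rewrite (act_mul NP).
Qed.

(** The function by which [ltau_circ] identifies the argument of the
    contraaction of a composite: its coproducts give back the composite. *)
Lemma Et_insert f g (b c d : seq U) x : coch f -> coch g ->
  Sw b (fun bs y => Sw c (fun cs z => Sw d (fun ds w =>
    Ins B act co (size b) (size c) g (fun l m => \sum_(t <- co m)
      mul (Et f l (t.1 * (y * (z * w) * x))) t.2) (bs ++ cs ++ ds)))) =
  circ3 B act co mul (tilde f) g b c (rcons d x).
Proof.
move=> fP gP; have EM := Et_mix fP.
transitivity (Sw b (fun bs y => Sw c (fun cs z => Sw d (fun ds w =>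
    dl B co g cs (fun X n => Sw bs (fun bs' y' => \sum_(z' <- co (act y' n))
      mul (Et f (bs' ++ X :: ds) (z'.1 * y * (z * w) * x)) z'.2)))))).
  apply: eq_Sw => bs y sb; apply: eq_Sw => cs z sc; apply: eq_Sw => ds w _.
  rewrite InsE // exchange_dl_Sw; apply: eq_Sw => bs' y' _; apply: eq_dl => X n.
  by apply: eq_bigr => z' _; rewrite !mulrA.
rewrite (@Sw_insert _ _ _ _ _ _ _ _ _ _ NP _ g b c d
    (fun ls p q => mul (Et f ls (p * x)) q) gP).
- rewrite /circ3; apply: eq_Sw => bs y _; apply: eq_dl => X n.
  rewrite -rcons_cons -rcons_cat.
  rewrite -(Sw_Tr H (bs ++ X :: d) x (cochL (tilde_coch fP))).
  by rewrite (mul_Swl NP).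
- move=> q; have EM' := mix_mulr x EM; split=> *.
  + by rewrite (mixDl EM') (mulDl NP).
  + by rewrite (mixDr EM') (mulDl NP).
  + by rewrite (mixB EM').
  + by rewrite (mixA EM').
- move=> ls w; split=> *.
  + by rewrite !mulrDl (homND (Et_homN ls fP)) (mulDl NP).
  + by rewrite (mulDr NP).
  + by rewrite -!mulrA (homN_tgt (Et_homN ls fP)) (mul_tgt NP).
Qed.

(** $\tau(f \circ_j g) = \tau f \circ_{j+1} g$, for inputs numbered from the
    left. *)
Lemma ltau_circ f g (X : seq U -> N) u (a b c : seq U) : coch f -> coch g ->
  (forall a' b' c' x, size a' = size a -> size b' = size b -> size c' = size c ->
     X (a' ++ b' ++ rcons c' x) = circ3 B act co mul f g a' b' (rcons c' x)) ->
  ltau X (u :: a ++ b ++ c) = circ3 B act co mul (ltau f) g (u :: a) b c.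
Proof.
move=> fP gP XE; have EM := Et_mix fP.
pose Y us w := Ins B act co (size a).+1 (size b) g (fun l m => \sum_(t <- co m)
  mul (Et f l (t.1 * w)) t.2) us.
have FP w : mixN B act (fun l m => \sum_(t <- co m) mul (Et f l (t.1 * w)) t.2).
  have G l : balN (fun t m => mul (Et f l (t * w)) m).
    split=> *; first by rewrite mulrDl (homND (Et_homN l fP)) (mulDl NP).
      by rewrite (mulDr NP).
    by rewrite -mulrA (homN_tgt (Et_homN l fP)) (mul_tgt NP).
  split=> *.
  - rewrite -big_split; apply: eq_bigr => t _.
    by rewrite (mixDl EM) (mulDl NP).
  - exact: (co_sumD NP (G _)).
  - by apply: eq_bigr => t _; rewrite (mixB EM).
  - rewrite (co_sum_src NP (G _)); apply: eq_bigr => t _.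
    by rewrite (mixA EM) mulrA.
have YM : mix B Y.
  split=> [s1 s2 v v' w|s w w'|s1 s2 a0 v v' w|a0 v s w].
  - exact: (balLD (Ins_balL NP _ _ gP (FP w))).
  - rewrite -SwD; apply: eq_Sw => xs y _; rewrite -dlD; apply: eq_dl => x n.
    rewrite -big_split; apply: eq_bigr => t _.
    by rewrite mulrDr (mixDr EM) (mulDl NP).
  - exact: (balLB (Ins_balL NP _ _ gP (FP w))).
  - rewrite /Y (Ins_tgt NP _ _ _ _ _ gP (FP w)).
    apply: eq_Sw => xs y _; apply: eq_dl => x n.
    rewrite (@co_sum_tgt _ _ _ _ _ _ _ _ _ _ NP _
      (fun t m => mul (Et f _ (t * w)) m)).
      by apply: eq_bigr => t _; rewrite mulrA.
    split=> *; first by rewrite mulrDl (homND (Et_homN _ fP)) (mulDl NP).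
      by rewrite (mulDr NP).
    by rewrite -mulrA (homN_tgt (Et_homN _ fP)) (mul_tgt NP).
rewrite [LHS]/= /circ3.
(* The translation maps cancel against the coproducts in [Et_insert]. *)
transitivity (gm (Y ((u :: a) ++ b ++ c))).
  apply: eq_gm => w; apply: (Tr_Sw H w YM) => xs x szx.
  pose xa := take (size a).+1 xs; pose xr := drop (size a).+1 xs.
  pose xb := take (size b) xr; pose xc := drop (size b) xr.
  have sza : size xa = (size a).+1.
    by rewrite size_takel // szx /= size_cat ltnS leq_addr.
  have szr : size xr = (size b + size c)%N.
    by rewrite size_drop szx /= !size_cat subSS addKn.
  have szb : size xb = size b by rewrite size_takel // szr leq_addr.
  have szc : size xc = size c by rewrite size_drop szr addKn.
  have -> : xs = xa ++ xb ++ xc by rewrite !cat_take_drop.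
  rewrite !rcons_cat; case: xa sza => // u0 a0 [sza].
  rewrite /= XE // -tilde_circ3 -Et_insert //.
  rewrite -cat_cons Sw_cat; apply: eq_Sw => bs y _; rewrite Sw_cat.
  apply: eq_Sw => cs z _; apply: eq_Sw => ds w' _.
  by rewrite /Y /= sza szb.
rewrite /Y.
transitivity (gm (fun w => Sw (u :: a) (fun xs y => dl B co g b (fun x n =>
    \sum_(t <- co (act y n)) mul (Et f (xs ++ x :: c) (t.1 * w)) t.2)))).
  by apply: eq_gm => w; rewrite InsE.
(* The coefficient of [g] leaves the contraaction by right linearity. *)
rewrite gm_Sw => [|xs y].
  apply: eq_Sw => xs y _; rewrite gm_dl => [|x n].
    apply: eq_dl => x n.
    rewrite (cc_mul gmP (f := Et f (xs ++ x :: c))); last exact: Et_homN.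
    by case: xs.
  exact: homN_mul (Et_homN _ fP).
by apply: homN_dl => x n; apply: homN_mul (Et_homN _ fP).
Qed.

(** Evaluation of [dl] at a list whose last entry has been translated. *)
Lemma Tr_dl g (F : U -> N -> N) d y : coch g -> balN F ->
  Tr (fun l => dl B co g l F) d y =
  \sum_(v <- cop B y) \sum_(n <- co (Tr g d v.1)) F (n.1 * v.2) n.2.
Proof.
move=> gP FP.
have GA ds : balA B (fun p q => \sum_(n <- co (Tr g ds p)) F (n.1 * q) n.2).
  split=> [p p' q|p q q'|a p q].
  - by rewrite (homND (Tr_homN ds gP)) (co_sumD NP (balN_mull FP q)).
  - by rewrite -big_split; apply: eq_bigr => n _; rewrite mulrDr (bal2Dl FP).
  - rewrite Tr_coch // (co_sum_tgt NP _ _ (balN_mull FP q)).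
    by apply: eq_bigr => n _; rewrite mulrA.
have TM := Tr_mix H (cochL gP).
pose G ds y := \sum_(v <- cop B y) \sum_(n <- co (Tr g ds v.1)) F (n.1 * v.2) n.2.
have GM : mix B G.
  split=> [s1 s2 u v z|s z z'|s1 s2 a u v z|a u s z].
  - rewrite -big_split; apply: eq_bigr => v' _.
    by rewrite (mixDl TM) (co_sumD NP (balN_mull FP v'.2)).
  - exact: (cop_sumD (GA s)).
  - by apply: eq_bigr => v' _; rewrite (mixB TM).
  - rewrite /G (cop_sum_srcl (GA _)).
    by apply: eq_bigr => v' _; rewrite (mixA TM).
apply: (Tr_Sw H y GM) => xs x _.
pose K ys y z := \sum_(v <- cop B x) \sum_(n <- co (Tr g ys (y * v.1)))
  F (n.1 * (z * v.2)) n.2.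
have KM : mix3 B K.
  split=> [s1 s2 u v p q|s|s1 s2 a u v p q|a u s p q].
  - rewrite -big_split; apply: eq_bigr => v' _.
    by rewrite (mixDl TM) (co_sumD NP (balN_mull FP (q * v'.2))).
  - apply: bal2_sum => v; exact: (balA_mull v.1 (balA_mulr v.2 (GA s))).
  - by apply: eq_bigr => v' _; rewrite (mixB TM).
  - by apply: eq_bigr => v' _; rewrite (mixA TM) mulrA.
transitivity (Sw xs (fun ys y0 => \sum_(z <- cop B y0) K ys z.1 z.2)).
  by apply: eq_Sw => ys y0 _; rewrite /G (cop_sumM (GA ys)).
rewrite -(Sw_coassoc xs KM) -cats1 /dl Sw_cat; apply: eq_Sw => ys z _.
rewrite Sw_cons Sw_sum; apply: eq_bigr => v _; rewrite Sw_nil mulr1.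
rewrite -(co_sum_Sw NP ys (fun ys' y => Tr g ys' (y * v.1))
  (balN_mull FP (z * v.2))).
by rewrite (Sw_Tr H _ _ (cochL gP)) cats1.
Qed.

(** $\tau(f \circ_p g) = \tau g \circ_1 \tau f$ for $f$ of arity $p$ and
    inputs numbered from the left. *)
Lemma ltau_circ_last f g (X : seq U -> N) u (b d : seq U) : coch f -> coch g ->
  (forall b' d' x, size b' = size b -> size d' = size d ->
     X (b' ++ rcons d' x) = circ3 B act co mul f g b' (rcons d' x) [::]) ->
  ltau X (u :: b ++ d) = circ3 B act co mul (ltau g) (ltau f) [::] (u :: b) d.
Proof.
move=> fP gP XE; have EfM := Et_mix fP; have EgM := Et_mix gP.
have FP bs : balN (fun z n => mul (Et f bs z) n).
  split=> *; first by rewrite (homND (Et_homN bs fP)) (mulDl NP).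
    by rewrite (mulDr NP).
  by rewrite (homN_tgt (Et_homN bs fP)) (mul_tgt NP).
pose K bs y p q := \sum_(z <- co (Et g (y :: d) p)) mul (Et f bs (z.1 * q)) z.2.
have KA bs y : balA B (K bs y).
  split=> [p p' q|p q q'|a p q].
  - by rewrite /K (homND (Et_homN _ gP)) (co_sumD NP (balN_mull (FP bs) q)).
  - rewrite -big_split; apply: eq_bigr => z _.
    by rewrite mulrDr (bal2Dl (FP bs)).
  - rewrite /K (homN_tgt (Et_homN _ gP)) (co_sum_tgt NP _ _ (balN_mull (FP bs) q)).
    by apply: eq_bigr => z _; rewrite mulrA.
have K1 s1 s2 v v' y p q : K (s1 ++ (v + v') :: s2) y p q =
    K (s1 ++ v :: s2) y p q + K (s1 ++ v' :: s2) y p q.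
  rewrite -big_split; apply: eq_bigr => z _.
  by rewrite (mixDl EfM) (mulDl NP).
have K2 bs y y' p q : K bs (y + y') p q = K bs y p q + K bs y' p q.
  by rewrite /K (mixDl EgM [::]) (co_sumD NP (balN_mull (FP bs) q)).
have K3 s1 s2 a v v' y p q : K (s1 ++ v * tgt B a :: v' :: s2) y p q =
    K (s1 ++ v :: tgt B a * v' :: s2) y p q.
  by apply: eq_bigr => z _; rewrite (mixB EfM).
have K4 a v s y p q : K (tgt B a * v :: s) y p q = K (v :: s) (src B a * y) p q.
  rewrite /K Et_src // (co_sum_src NP (balN_mull (FP (v :: s)) q)).
  by apply: eq_bigr => z _; rewrite (mixA EfM) mulrA.
have K5 a bs y p q : K bs (tgt B a * y) p q = K bs y (src B a * p) q.
  by rewrite /K (mixA EgM).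
pose F us w := Sw us (fun bs y => \sum_(v <- cop B w) K bs y v.1 v.2).
have mixK w : mix B (fun bs y => \sum_(v <- cop B w) K bs y v.1 v.2).
  split=> *.
  - by rewrite -big_split; apply: eq_bigr => v' _; rewrite K1.
  - by rewrite -big_split; apply: eq_bigr => v' _; rewrite K2.
  - by apply: eq_bigr => v' _; rewrite K3.
  - by apply: eq_bigr => v' _; rewrite K4.
have FM : mix B F.
  split=> [s1 s2 v v' w|s w w'|s1 s2 a v v' w|a v s w].
  - exact: (balLD (Sw_balL (mixK w))).
  - by rewrite -SwD; apply: eq_Sw => bs y _; apply: (cop_sumD (KA bs y)).
  - exact: (balLB (Sw_balL (mixK w))).
  - rewrite /F (Sw_tgt _ _ _ (mixK w)); apply: eq_Sw => bs y _.
    by rewrite (cop_sum_srcl (KA bs y)); apply: eq_bigr => v' _; rewrite K5.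
(* The arguments [d] of [g] are translated first ([Tr_dl]); for those of [f]
   it suffices to compare after taking coproducts. *)
transitivity (gm (F (u :: b))).
  apply: eq_gm => w; rewrite /Et -cat_cons Tr_cat.
  pose P bs y := \sum_(v <- cop B y) \sum_(n <- co (Tr g d v.1))
    Sw bs (fun xs z => mul (tilde f (xs ++ [:: n.1 * v.2])) (act z n.2)).
  rewrite -(tr_Sw H (P := P) w FM).
    apply: eq_sweedler => xs szx.
    rewrite /P -(Tr_dl d _ gP (balN_prefix NP (unzip1 xs) [::] (tilde_coch fP))).
    apply: eq_Tr => l; case/lastP: l => // d' x; rewrite size_rcons => -[szd].
    have: size (unzip1 xs) = (size b).+1 by rewrite size_map.
    case: (unzip1 xs) => //= u' b' [szb]; rewrite XE // -tilde_circ3.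
    by rewrite exchange_dl_Sw.
  move=> xs x szx.
  have GA bs : balA B (fun p q => \sum_(z <- co (Tr g d p))
      Sw bs (fun xs z' => mul (tilde f (xs ++ [:: z.1 * q])) (act z' z.2))).
    have FP' := balN_prefix NP bs [::] (tilde_coch fP).
    split=> [p p' q|p q q'|a p q].
    - by rewrite (homND (Tr_homN d gP)) (co_sumD NP (balN_mull FP' q)).
    - rewrite -big_split; apply: eq_bigr => z _.
      by rewrite mulrDr (bal2Dl FP').
    - rewrite Tr_coch // (co_sum_tgt NP _ _ (balN_mull FP' q)).
      by apply: eq_bigr => z _; rewrite mulrA.
  pose G bs y z := \sum_(v <- cop B z) \sum_(v' <- cop B x)
    K bs y (v.1 * v'.1) (v.2 * v'.2).
  have GB bs y : balA B (fun p q => \sum_(v' <- cop B x) K bs y (p * v'.1) (q * v'.2)).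
    by apply: bal2_sum => v'; apply: (balA_mull v'.1 (balA_mulr v'.2 (KA bs y))).
  have GM : mix3 B G.
    split=> [s1 s2 v v' y z|s|s1 s2 a v v' y z|a v s y z].
    - rewrite -big_split; apply: eq_bigr => t _; rewrite -big_split.
      by apply: eq_bigr => t' _; rewrite K1.
    - split=> [y y' z|y z z'|a y z].
      + rewrite -big_split; apply: eq_bigr => t _; rewrite -big_split.
        by apply: eq_bigr => t' _; rewrite K2.
      + exact: (cop_sumD (GB s y)).
      + rewrite /G (cop_sum_srcl (GB s y)); apply: eq_bigr => t _.
        by apply: eq_bigr => t' _; rewrite K5 mulrA.
    - by apply: eq_bigr => t _; apply: eq_bigr => t' _; rewrite K3.
    - by apply: eq_bigr => t _; apply: eq_bigr => t' _; rewrite K4.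
  transitivity (Sw xs (fun ys z => Sw ys (fun ys' y => G ys' y z))).
    apply: eq_Sw => ys y _; apply: eq_Sw => ys' y' _.
    by rewrite (cop_sumM (KA ys' y')).
  rewrite (Sw_coassoc xs GM) /G.
  pose R ys y (v' : U * U) := \sum_(t <- cop B y) \sum_(n <- co (Tr g d v'.1))
    mul (Et f ys (t.1 * n.1 * v'.2)) (act t.2 n.2).
  transitivity (Sw xs (fun ys y => \sum_(v' <- cop B x) R ys y v')).
    apply: eq_Sw => ys y _.
    rewrite -(@cop_coassoc_sum _ _ _ _ _ (fun p q r =>
      \sum_(v' <- cop B x) K ys p (q * v'.1) (r * v'.2))); last first.
    - by move=> p; apply: GB.
    - move=> r; apply: bal2_sum => v'; split=> *; first exact: K2.
        by rewrite mulrDl (bal2Dl (KA _ _)).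
      by rewrite K5 mulrA.
    under eq_bigr do rewrite exchange_big /=.
    rewrite exchange_big; apply: eq_bigr => v' _.
    rewrite /R -(YD_sum NP _ _ (balN_mull (FP ys) v'.2)); apply: eq_bigr => t _.
    rewrite -(Et_cop t.1 d v'.1 gP) (co_sum_big NP _ _
      (balN_mull (balN_mull (FP ys) v'.2) t.2)).
    by apply: eq_bigr => v _; apply: eq_bigr => z _; rewrite mulrA.
  rewrite Sw_sum; apply: eq_bigr => v' _.
  rewrite /R; under eq_Sw do rewrite exchange_big /=.
  rewrite Sw_sum; apply: eq_bigr => n _.
  rewrite -(@Sw_coassoc _ _ _ _ _ (fun ys y z =>
    mul (Et f ys (y * n.1 * v'.2)) (act z n.2))).
    apply: eq_Sw => ys z _; rewrite cats1.
    rewrite -(Sw_Tr H ys (n.1 * v'.2) (cochL (tilde_coch fP))) (mul_Swl NP).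
    by apply: eq_Sw => ys' y _; rewrite mulrA.
  split=> [s1 s2 v v0 y z|s|s1 s2 a v v0 y z|a v s y z].
  - by rewrite (mixDl EfM) (mulDl NP).
  - split=> *; rewrite -?mulrA ?mulrDl.
    + by rewrite (homND (Et_homN s fP)) (mulDl NP).
    + by rewrite (actDl NP) (mulDr NP).
    + by rewrite (homN_tgt (Et_homN s fP)) (mul_tgt NP) (act_mul NP).
  - by rewrite (mixB EfM).
  - by rewrite (mixA EfM) !mulrA.
have KH bs y p : homN (K bs y p).
  exact: (homN_mul _ (Et_homN bs fP)).
have KHs bs y : homN (fun w => \sum_(v <- cop B w) K bs y v.1 v.2).
  split=> [w w'|a w]; first exact: (cop_sumD (KA bs y)).
  rewrite (cop_sum_tgtl (KA bs y)) linear_sum; apply: eq_bigr => v _.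
  exact: (homN_tgt (KH _ _ _)).
rewrite /circ3 Sw_nil gm_Sw //; apply: eq_Sw => bs y szb.
(* Contraassociativity separates the variables of [f] and [g]. *)
rewrite -(cc_assoc gmP (KA bs y) (KH bs y)).
have -> : ltau f bs = gm (Et f bs) by case: bs szb.
set M := gm (Et f bs).
transitivity (gm (fun p => mul M (Et g (y :: d) p))).
  by apply: eq_gm => p; rewrite /M -(cc_mul gmP _ (Et_homN bs fP)).
(* Braided commutativity moves $M = \tau f$ to the right of [g]. *)
transitivity (\sum_(m <- co M) gm (fun w => \sum_(z <- co m.2)
    mul (Et g (m.1 * y :: d) (z.1 * w)) z.2)).
  rewrite -gm_sum => [|m]; last exact: (homN_mul _ (Et_homN _ gP)).
  apply: eq_gm => w; rewrite BC.
  rewrite -(@co_coassoc_sum _ _ _ _ _ _ _ _ _ _ NP _ (fun p q n =>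
    mul (Et g (p * y :: d) (q * w)) n)).
  - apply: eq_bigr => m _; rewrite -(Et_lin m.1 y d w gP) (mul_suml NP).
    by apply: eq_bigr => v _.
  - move=> n; split=> *.
    + by rewrite mulrDl (mixDl EgM [::]) (mulDl NP).
    + by rewrite mulrDl (homND (Et_homN _ gP)) (mulDl NP).
    + by rewrite -!mulrA (mixA EgM).
  - move=> p; split=> *.
    + by rewrite mulrDl (homND (Et_homN _ gP)) (mulDl NP).
    + by rewrite (mulDr NP).
    + by rewrite -mulrA (homN_tgt (Et_homN _ gP)) (mul_tgt NP).
apply: eq_bigr => m _.
by rewrite (cc_mul gmP _ (Et_homN _ gP)) (act_one NP).
Qed.

End Cyclic.

(** * Homogeneous coordinates *)

Section Homogeneous.
Variables (k : comNzRingType) (A U : algType k) (B : bialgebroid A U).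
Variable H : left_hopf B.
Implicit Types (a : A) (u v w : U) (W : zmodType).
Local Notation Tr := (Tr H).

(** $f(v_+, v_- y, z)$ *)
Definition bt W (f : seq U -> W) (v : U) (z : seq U) : W :=
  if z is y :: z' then \sum_(x <- tr H v) f (x.1 :: x.2 * y :: z') else 0.

(** $f(v^0_+, v^0_- v^1_+, v^1_- v^2_+, \ldots, v^{n-1}_- v^n)$ *)
Fixpoint hom W (f : seq U -> W) (vs : seq U) : W :=
  match vs with
  | [::] => f [::]
  | v :: vs' => if vs' is [::] then f [:: v] else hom (bt f v) vs'
  end.

(** Multiplication of the first argument by [u] from the left. *)
Definition lmul W (u : U) (f : seq U -> W) (z : seq U) : W :=
  if z is y :: z' then f (u * y :: z') else 0.

(** The diagonal action $G(u_{(1)} v^0, \ldots, u_{(n+1)} v^n)$. *)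
Fixpoint dact W (u : U) (G : seq U -> W) (vs : seq U) : W :=
  match vs with
  | [::] => 0
  | v :: vs' => if vs' is [::] then G [:: u * v] else
      \sum_(x <- cop B u) dact x.2 (fun l => G (x.1 * v :: l)) vs'
  end.

Lemma hom_cons2 W (f : seq U -> W) v v' vs :
  hom f (v :: v' :: vs) = hom (bt f v) (v' :: vs).
Proof. by []. Qed.

Lemma dact_cons2 W u (G : seq U -> W) v v' vs :
  dact u G (v :: v' :: vs) =
  \sum_(x <- cop B u) dact x.2 (fun l => G (x.1 * v :: l)) (v' :: vs).
Proof. by []. Qed.

Lemma eq_hom W (f g : seq U -> W) v vs :
  (forall y z, size z = size vs -> f (y :: z) = g (y :: z)) ->
  hom f (v :: vs) = hom g (v :: vs).
Proof.
elim: vs v f g => [|v' vs IH] v f g fg; first exact: fg.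
rewrite !hom_cons2; apply: IH => y z sz; apply: eq_bigr => x _.
by apply: fg; rewrite /= sz.
Qed.

Lemma eq_dact W u (f g : seq U -> W) v vs :
  (forall y z, f (y :: z) = g (y :: z)) ->
  dact u f (v :: vs) = dact u g (v :: vs).
Proof.
elim: vs u v f g => [|v' vs IH] u v f g fg; first exact: fg.
by rewrite !dact_cons2; apply: eq_bigr => x _; apply: IH => y z.
Qed.

Lemma hom_sum W I (s : seq I) (F : I -> seq U -> W) vs :
  hom (fun l => \sum_(i <- s) F i l) vs = \sum_(i <- s) hom (F i) vs.
Proof.
elim: vs F => [|v vs IH] F //; case: vs IH => [|v' vs] // IH.
rewrite hom_cons2 -[RHS]IH; apply: eq_hom => y z _; exact: exchange_big.
Qed.

Lemma homD W (f g : seq U -> W) vs : hom (fun l => f l + g l) vs = hom f vs + hom g vs.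
Proof.
elim: vs f g => [|v vs IH] f g //; case: vs IH => [|v' vs] // IH.
rewrite !hom_cons2 -IH; apply: eq_hom => y z _; exact: big_split.
Qed.

Lemma raddf_hom W W' (h : W -> W') (f : seq U -> W) v vs :
  {morph h : x y / x + y} -> h (hom f (v :: vs)) = hom (fun l => h (f l)) (v :: vs).
Proof.
move=> hD; elim: vs v f => [|v' vs IH] v f //.
rewrite !hom_cons2 IH; apply: eq_hom => y z _.
exact: additive_sum.
Qed.

Lemma dactD W u (f g : seq U -> W) v vs :
  dact u (fun l => f l + g l) (v :: vs) = dact u f (v :: vs) + dact u g (v :: vs).
Proof.
elim: vs u v f g => [|v' vs IH] u v f g //.
rewrite !dact_cons2 -big_split; apply: eq_bigr => x _; exact: IH.
Qed.

Lemma bt_balAop W (f : seq U -> W) y z :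
  balL B f -> balAop B (fun p q => f (p :: q * y :: z)).
Proof.
move=> fP; split=> *; first exact: (balLD fP [::]).
  by rewrite mulrDl (balLD fP [:: _]).
by rewrite (balLB fP [::]) mulrA.
Qed.

Lemma bt_balL W (f : seq U -> W) v : balL B f -> balL B (bt f v).
Proof.
move=> fP; split=> [[|y s1] s2 u u'|[|y s1] s2 a u u'] /=.
- rewrite -big_split; apply: eq_bigr => x _.
  by rewrite mulrDr (balLD fP [:: _]).
- by rewrite -big_split; apply: eq_bigr => x _; rewrite -!cat_cons (balLD fP).
- by apply: eq_bigr => x _; rewrite mulrA (balLB fP [:: _]).
- by apply: eq_bigr => x _; rewrite -!cat_cons (balLB fP).
Qed.

Lemma bt_cop W (f : seq U -> W) u y z : balL B f ->
  \sum_(x <- cop B u) bt f x.1 (x.2 * y :: z) = f (u :: y :: z).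
Proof.
move=> fP; have := cop_tr_sum H (bt_balAop y z fP) u.
by rewrite mul1r => <-; apply: eq_bigr => x _; apply: eq_bigr => p _; rewrite mulrA.
Qed.

(** The change of coordinates is injective, since [bt_cop] undoes one step. *)
Lemma hom_inj W (f g : seq U -> W) n : balL B f -> balL B g ->
  (forall vs, size vs = n.+1 -> hom f vs = hom g vs) ->
  forall us, size us = n.+1 -> f us = g us.
Proof.
move=> fP gP; elim: n f g fP gP => [|n IH] f g fP gP fg.
  by case=> [|u [|? ?]] // _; apply: (fg [:: u]).
case=> [|u [|y z]] // [szz].
rewrite -(bt_cop _ _ _ fP) -(bt_cop _ _ _ gP); apply: eq_bigr => x _.
apply: IH; [exact: bt_balL|exact: bt_balL| |by rewrite /= szz].
by case=> [|v vs] // [szv]; apply: (fg (x.1 :: v :: vs)); rewrite /= szv.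
Qed.

(** The diagonal action in homogeneous coordinates is left multiplication in
    the first of the original variables. *)
Lemma dact_hom W (f : seq U -> W) u v vs : balL B f ->
  dact u (hom f) (v :: vs) = hom (lmul u f) (v :: vs).
Proof.
elim: vs u v f => [|v' vs IH] u v f fP //.
rewrite dact_cons2 hom_cons2.
transitivity (\sum_(x <- cop B u) hom (lmul x.2 (bt f (x.1 * v))) (v' :: vs)).
  by apply: eq_bigr => x _; rewrite -IH; [apply: eq_dact|apply: bt_balL].
rewrite -hom_sum; apply: eq_hom => y z _ /=.
have := cop_tr_sum H (balAop_tr_out H (bt_balAop y z fP) v) u.
under [RHS]eq_bigr do rewrite mulr1; move=> <-; apply: eq_bigr => x _.
rewrite (tr_sumM H (bt_balAop _ z fP)); apply: eq_bigr => p _.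
by apply: eq_bigr => q _; rewrite !mulrA.
Qed.

Lemma hom_src W (f : seq U -> W) a v vs : balL B f ->
  hom f (src B a * v :: vs) = hom (lmul (src B a) f) (v :: vs).
Proof.
move=> fP; case: vs => [|v' vs] //; rewrite !hom_cons2; apply: eq_hom => y z _.
exact: (tr_sum_srcl H (bt_balAop y z fP)).
Qed.

Lemma hom_tgt W (f : seq U -> W) a v v' vs : balL B f ->
  hom f (tgt B a * v :: v' :: vs) = hom f (v :: src B a * v' :: vs).
Proof.
move=> fP; rewrite !hom_cons2 hom_src; last exact: bt_balL.
apply: eq_hom => y z _ /=; rewrite (tr_sum_tgtl H (bt_balAop y z fP)).
by apply: eq_bigr => x _; rewrite mulrA.
Qed.

(** Functions on $U \otimes_A \cdots \otimes_A U$. *)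
Record balH W (G : seq U -> W) : Prop := BalH {
  balHD : forall s1 s2 u v,
    G (s1 ++ (u + v) :: s2) = G (s1 ++ u :: s2) + G (s1 ++ v :: s2);
  balHA : forall s1 s2 a u v,
    G (s1 ++ tgt B a * u :: v :: s2) = G (s1 ++ u :: src B a * v :: s2)
}.

Lemma balH_cons W (G : seq U -> W) u : balH G -> balH (fun l => G (u :: l)).
Proof.
by move=> GP; split=> *; rewrite -!cat_cons; [apply: balHD|apply: balHA].
Qed.

Lemma hom_balH W (f : seq U -> W) : balL B f -> balH (hom f).
Proof.
move=> fP; split=> [s1 s2 u v|s1 s2 a u v].
- elim: s1 f fP => [|x s1 IH] f fP; last first.
    have := IH _ (bt_balL x fP); case: s1 {IH} => [|x' s1] IH; exact: IH.
  case: s2 => [|y s2]; first exact: (balLD fP [::]).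
  rewrite !hom_cons2 -homD; apply: eq_hom => y' z _.
  exact: (tr_sumD H (bt_balAop y' z fP)).
- elim: s1 f fP => [|x s1 IH] f fP; first exact: hom_tgt.
  have := IH _ (bt_balL x fP); case: s1 {IH} => [|x' s1] IH; exact: IH.
Qed.

Lemma Tr_cop W (p : seq U -> W) u y z w : balL B p ->
  \sum_(x <- cop B u) Tr p (x.1 * y :: z) (x.2 * w) =
  \sum_(q <- tr H y) Tr (fun l => p (u * q.1 :: l)) z (q.2 * w).
Proof.
move=> pP; have G := Tr_balAop H z w pP.
have := cop_tr_sum H (balAop_tr_out H G y) u.
under [RHS]eq_bigr do rewrite mulr1; move=> <-; apply: eq_bigr => x _.
rewrite Tr_cons (tr_sumM H (Tr_balAop H z (x.2 * w) pP)); apply: eq_bigr => r _.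
by apply: eq_bigr => q _; rewrite !mulrA.
Qed.

Lemma bt_Tr W (p : seq U -> W) v y z w : balL B p ->
  bt (fun l => Tr p l w) v (y :: z) = Tr (bt p v) (y :: z) w.
Proof.
move=> pP.
transitivity (\sum_(x <- tr H v) \sum_(q <- tr H x.1)
    Tr (fun l => p (q.1 :: l)) (x.2 * y :: z) (q.2 * w)).
  by apply: eq_bigr => x _; rewrite Tr_cons.
rewrite -(@tr_cop_snd_sum _ _ _ _ H _
    (fun p1 q1 r1 => Tr (fun l => p (p1 :: l)) (q1 * y :: z) (r1 * w))).
- under eq_bigr do rewrite (Tr_cop _ _ _ _ (balL_cons _ pP)).
  rewrite Tr_cons exchange_big; apply: eq_bigr => q _.
  by rewrite -Tr_sum; apply: eq_Tr.
- by move=> y1; apply: Tr_balAop.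
- move=> x; have M := Tr_mix H (balL_cons x pP); split=> *.
  + by rewrite mulrDl (mixDl M [::]).
  + by rewrite mulrDl (mixDr M).
  + by rewrite -!mulrA (mixA M).
Qed.

(** The last argument of [Tr] is homogeneous. *)
Lemma hom_Tr W (p : seq U -> W) v vs w : balL B p ->
  hom p (rcons (v :: vs) w) = hom (fun l => Tr p l w) (v :: vs).
Proof.
elim: vs v p => [|v' vs IH] v p pP.
  by rewrite /= Tr_cons; apply: eq_bigr => x _; rewrite Tr_nil.
rewrite !rcons_cons !hom_cons2 -rcons_cons IH; last exact: bt_balL.
by apply: eq_hom => y z _; rewrite -bt_Tr.
Qed.

End Homogeneous.

Section CyclicPower.
Variables (k : comNzRingType) (A U : algType k) (B : bialgebroid A U).
Variable H : left_hopf B.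
Variables (N : lmodType k) (act : U -> {linear N -> N}).
Variables (lact : A -> {linear N -> N}) (co : N -> seq (U * N)).
Variables (mul : N -> N -> N) (oneN : N).
Hypothesis NP : is_YDalgebra B act lact co mul oneN.
Variable gm : (U -> N) -> N.
Hypothesis gmP : cyc_contra H act co mul gm.
Implicit Types (u v w : U).
Local Notation coch := (coch B act).
Local Notation homN := (homN B act).
Local Notation tilde := (tilde act).
Local Notation Et := (Et H act).
Local Notation ltau := (ltau H act gm).

Lemma gm_hom v vs (F : seq U -> U -> N) :
  (forall y z, homN (F (y :: z))) ->
  gm (fun w => hom H (fun l => F l w) (v :: vs)) =
  hom H (fun l => gm (F l)) (v :: vs).
Proof.
elim: vs v F => [|v' vs IH] v F FP //.
transitivity (hom H (fun z => gm (fun w => bt H (fun l => F l w) v z)) (v' :: vs)).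
  apply: (IH v' (fun z w => bt H (fun l => F l w) v z)) => y z.
  by apply: homN_sum => x; apply: FP.
rewrite hom_cons2; apply: eq_hom => y z _.
by apply: (gm_sum gmP) => x; apply: FP.
Qed.

(** The anti Yetter-Drinfel'd condition in homogeneous coordinates. *)
Lemma tilde_ltau f v y z : coch f ->
  bt H (tilde (ltau f)) v (y :: z) = gm (fun w => Et f (y :: z) (w * v)).
Proof.
move=> fP; have EM := Et_mix H NP fP.
have EH p r : homN (fun w => Et f (r * y :: z) (w * p)) by apply: (Et_homNr H NP).
pose K p r := gm (fun w => Et f (r * y :: z) (w * p)).
have KP : balA B K.
  split=> [p p' r|p r r'|a p r].
  - rewrite /K -(cc_add gmP (EH _ _) (EH _ _)); congr gm; apply: funext => w.
    by rewrite mulrDr (mixDr EM).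
  - rewrite /K -(cc_add gmP (EH _ _) (EH _ _)); congr gm; apply: funext => w.
    by rewrite mulrDl (mixDl EM [::]).
  - transitivity (gm (fun w => Et f (r * y :: z) (w * tgt B a * p))).
      by congr gm; apply: funext => w; rewrite mulrA.
    rewrite (cc_tgtr gmP a (EH p r)); congr gm; apply: funext => w.
    by rewrite -mulrA (Et_src H NP).
transitivity (\sum_(q <- tr H v) \sum_(x <- cop B q.1) K x.1 (x.2 * q.2)).
  apply: eq_bigr => q _ /=.
  rewrite (cc_aYD gmP); last exact: (Et_homN H NP).
  rewrite -(gm_sum gmP) => [|x]; last exact: EH.
  congr gm; apply: funext => w; apply: eq_bigr => x _.
  rewrite -mulrA (Et_mul H NP) //; apply: eq_bigr => p _.
  by rewrite mulrA.
rewrite (tr_galois_sum H v KP) /K; congr gm; apply: funext => w.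
by rewrite mul1r.
Qed.

(** In homogeneous coordinates the cyclic operator is
    $G \mapsto \gamma(w \mapsto G(v^1, \ldots, v^n, w v^0))$. *)
Lemma hom_ltau f v vs : coch f ->
  hom H (tilde (ltau f)) (v :: vs) =
  gm (fun w => hom H (tilde f) (rcons vs (w * v))).
Proof.
move=> fP; case: vs => [|v' vs].
  transitivity (act v (f [::])); first by rewrite /= (cc_stable gmP).
  rewrite -(cc_stable gmP (act v _)); congr gm; apply: funext => w.
  by rewrite /= (act_mul NP).
rewrite hom_cons2.
transitivity (hom H (fun l => gm (fun w => Et f l (w * v))) (v' :: vs)).
  by apply: eq_hom => y z _; apply: tilde_ltau.
rewrite -gm_hom => [|y z]; last exact: (Et_homNr H NP).
congr gm; apply: funext => w; rewrite hom_Tr //.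
exact: cochL (tilde_coch NP fP).
Qed.

(** $\gamma(w^0 \mapsto \gamma(w^1 \mapsto \cdots G(w^0 v^0, w^1 v^1, \ldots)))$ *)
Fixpoint gam (G : seq U -> N) (vs : seq U) : N :=
  if vs is v :: vs' then gm (fun w => gam (fun l => G (w * v :: l)) vs')
  else G [::].

Lemma eq_gam (F G : seq U -> N) vs : (forall l, F l = G l) -> gam F vs = gam G vs.
Proof.
elim: vs F G => [|v vs IH] F G FG //=.
by congr gm; apply: funext => w; apply: IH => l.
Qed.

Lemma gam_rcons (G : seq U -> N) vs v :
  gam G (rcons vs v) = gam (fun l => gm (fun w => G (rcons l (w * v)))) vs.
Proof.
elim: vs G => [|v' vs IH] G //=.
by congr gm; apply: funext => w; rewrite IH.
Qed.

(** Test functions on $U \otimes_A \cdots \otimes_A U$ with values in $N$ that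
    are right $A$-linear in the last argument. *)
Record ginv (G : seq U -> N) : Prop := Ginv {
  ginvH : balH B G;
  ginv_tgt : forall a s u,
    G (rcons s (tgt B a * u)) = act (tgt B a) (G (rcons s u))
}.

Lemma ginv_cons G u : ginv G -> ginv (fun l => G (u :: l)).
Proof.
by move=> GP; split; [apply: balH_cons (ginvH GP)|move=> *; rewrite -rcons_cons (ginv_tgt GP)].
Qed.

Lemma dact_balA (G : seq U -> N) v v' vs : balH B G ->
  balA B (fun x y => dact B y (fun l => G (x * v :: l)) (v' :: vs)).
Proof.
move=> GP; elim: vs v v' G GP => [|v2 vs IH] v v' G GP.
  split=> *.
  - by rewrite mulrDl; apply: (balHD GP [::]).
  - by rewrite /= mulrDl; apply: (balHD GP [:: _]).
  - by rewrite /= -!mulrA; apply: (balHA GP [::]).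
have IHx x : balA B (fun p q => dact B q (fun l => G (x :: p * v' :: l)) (v2 :: vs)).
  exact: (IH v' v2 _ (balH_cons x GP)).
split=> [x x' y|x y y'|a x y].
- rewrite -dactD; apply: eq_dact => y0 z.
  by rewrite mulrDl (balHD GP [::]).
- by rewrite !dact_cons2 (cop_sumD (IHx (x * v))).
- rewrite !dact_cons2 (cop_sum_srcl (IHx (x * v))); apply: eq_bigr => p _.
  by apply: eq_dact => y0 z; rewrite -!mulrA (balHA GP [::]).
Qed.

Lemma dact_homN (G : seq U -> N) v vs : ginv G ->
  homN (fun w => dact B w G (v :: vs)).
Proof.
elim: vs v G => [|v' vs IH] v G GP.
  split=> [w w'|a w] /=; first by rewrite mulrDl (balHD (ginvH GP) [::]).
  by rewrite -mulrA (ginv_tgt GP a [::]).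
have GA := dact_balA v v' vs (ginvH GP).
split=> [w w'|a w]; first by rewrite !dact_cons2 (cop_sumD GA).
rewrite !dact_cons2 (cop_sum_tgtl GA) linear_sum; apply: eq_bigr => x _.
exact: (homN_tgt (IH v' _ (ginv_cons (x.1 * v) GP))).
Qed.

(** Contraassociativity turns the iterated contraaction into a single one along
    the diagonal action. *)
Lemma gam_dact (G : seq U -> N) v vs : ginv G ->
  gam G (v :: vs) = gm (fun w => dact B w G (v :: vs)).
Proof.
elim: vs v G => [|v' vs IH] v G GP //.
transitivity (gm (fun u => gm (fun w => dact B w (fun l => G (u * v :: l)) (v' :: vs)))).
  by congr gm; apply: funext => u; apply: IH; apply: ginv_cons.
rewrite (cc_assoc gmP (dact_balA v v' vs (ginvH GP))) // => u.
exact: (dact_homN v' vs (ginv_cons _ GP)).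
Qed.

Lemma hom_ginv f : coch f -> ginv (hom H (tilde f)).
Proof.
move=> fP; have tP := tilde_coch NP fP; split; first exact: hom_balH (cochL tP).
move=> a [|v vs] u; first exact: (coch_tgt tP).
rewrite !hom_Tr; try exact: cochL tP.
rewrite (raddf_hom _ _ (h := act (tgt B a))); last exact: actDr.
by apply: eq_hom => y z _; apply: Tr_coch.
Qed.

(** Since [tilde f] is $U$-linear in its first argument, stability removes the
    contraaction along the diagonal action. *)
Lemma gam_hom f v vs : coch f ->
  gam (hom H (tilde f)) (v :: vs) = hom H (tilde f) (v :: vs).
Proof.
move=> fP; rewrite gam_dact; last exact: hom_ginv.
rewrite -[RHS](cc_stable gmP); congr gm; apply: funext => w.
rewrite dact_hom; last exact: cochL (tilde_coch NP fP).
rewrite (raddf_hom _ _ (h := act w)); last exact: actDr.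
by apply: eq_hom => y z _ /=; rewrite (act_mul NP).
Qed.

Lemma iter_ltau_coch j f : coch f -> coch (iter j ltau f).
Proof. by move=> fP; elim: j => //= j IH; apply: (ltau_coch NP gmP). Qed.

(** The cyclic operator, applied once for each entry of [a]. *)
Lemma hom_iter_ltau f (a b : seq U) : coch f -> (0 < size (a ++ b))%N ->
  hom H (tilde (iter (size a) ltau f)) (a ++ b) =
  gam (fun l => hom H (tilde f) (b ++ l)) a.
Proof.
elim/last_ind: a b f => [|a v IH] b f fP sz.
  by rewrite /= cats0.
rewrite size_rcons iterSr cat_rcons IH; last by rewrite size_cat /= addnS.
  rewrite gam_rcons; apply: eq_gam => l; rewrite cat_cons hom_ltau //.
  by congr gm; apply: funext => w; rewrite rcons_cat.
exact: (ltau_coch NP gmP).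
Qed.

(** $\tau^{n+1} = \mathrm{id}$ *)
Lemma iter_ltau f (us : seq U) : coch f ->
  iter (size us).+1 ltau f us = f us.
Proof.
move=> fP; have fP' := iter_ltau_coch (size us).+1 fP.
(* [f us] is recovered from [tilde f] at the first argument 1. *)
have := hom_inj (n := size us) (cochL (tilde_coch NP fP')) (cochL (tilde_coch NP fP)).
move=> inj; have := inj H _ (1 :: us); rewrite /= !(act_one NP); apply => //.
case=> // v vs szv; have := @hom_iter_ltau f (v :: vs) [::] fP.
by rewrite cats0 szv => -> //; apply: gam_hom.
Qed.

End CyclicPower.

(** * Unit and multiplication *)

Section Units.
Variables (k : comNzRingType) (A U : algType k) (B : bialgebroid A U).
Variable H : left_hopf B.
Variables (N : lmodType k) (act : U -> {linear N -> N}).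
Variables (lact : A -> {linear N -> N}) (co : N -> seq (U * N)).
Variables (mul : N -> N -> N) (oneN : N).
Hypothesis NP : is_YDalgebra B act lact co mul oneN.
Implicit Types (a : A) (u v w : U) (us : seq U).
Local Notation coch := (coch B act).
Local Notation Sw := (Sw B).

(** $\varepsilon(u^1 \cdots u^n) 1_N$: the identity, the multiplication and the
    unit are its instances in arities 1, 2 and 0. *)
Definition lunit us : N := iot B act oneN (cou B (\prod_(u <- us) u)).

Lemma iotM a b :
  iot B act oneN (a * b) = act (tgt B b) (iot B act oneN a).
Proof.
by rewrite {2}/iot (act_tgt_src NP) -(iotE NP) /iot rmorphM (act_mul NP).
Qed.

Lemma lunit_coch : coch lunit.
Proof.
split; last by move=> a u s; rewrite /lunit !big_cons -mulrA cou_tgt iotM.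
split=> [s1 s2 u v|s1 s2 a u v]; rewrite /lunit !big_cat !big_cons /=.
  by rewrite mulrDl mulrDr linearD (iotD NP).
by rewrite !mulrA.
Qed.

Lemma Sw_counitl us :
  Sw us (fun ys z => src B (cou B (\prod_(y <- ys) y)) * z) = \prod_(u <- us) u.
Proof.
elim: us => [|u us IH].
  by rewrite Sw_nil !big_nil cou1 rmorph1 mulr1.
rewrite Sw_cons_in big_cons -IH (raddf_Sw B us (f := fun x => u * x)); last first.
  by move=> x y; rewrite mulrDr.
apply: eq_Sw => ys z _; set b := cou B _.
rewrite mulrA -src_counitl mulr_suml; apply: eq_bigr => x _.
by rewrite big_cons couM_src mulrA.
Qed.

Lemma dl_lunit (W : zmodType) us (F : U -> N -> W) : balN B act F ->
  dl B co lunit us F = F (\prod_(u <- us) u) oneN.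
Proof.
move=> FP; rewrite -Sw_counitl (raddf_Sw B us (f := F^~ oneN)); last first.
  by move=> x y /=; rewrite (bal2Dl FP).
apply: eq_Sw => ys z _.
exact: (co_sum_iot NP _ (balN_mull FP z)).
Qed.

Lemma Sw_counitr (W : zmodType) us l (F : seq U -> N -> W) : mixN B act F ->
  Sw us (fun xs y => F (xs ++ l) (act y oneN)) = F (us ++ l) oneN.
Proof.
elim: us F => [|u us IH] F FP; first by rewrite Sw_nil (act_one NP).
rewrite Sw_cons_in cat_cons -[u in RHS](counitr B).
transitivity (\sum_(x <- cop B u) F (x.1 :: us ++ l) (act x.2 oneN)).
  rewrite -(IH _ (mixN_cop NP u FP)); apply: eq_Sw => xs y _.
  by apply: eq_bigr => x _; rewrite (act_mul NP).
pose f x := F (x :: us ++ l) oneN.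
have fD : {morph f : x y / x + y} by move=> x y; apply: (mixNDl FP [::]).
rewrite -/(f _) (additive_sum _ _ fD).
apply: eq_bigr => x _.
by rewrite /f (mixNA FP) (YDalg_act1 NP) (lactE NP).
Qed.

Lemma circ3_lunitr f (a b c : seq U) : coch f ->
  circ3 B act co mul f lunit a b c = f (a ++ \prod_(u <- b) u :: c).
Proof.
move=> fP; rewrite /circ3 -exchange_dl_Sw (dl_lunit _ (balN_prefix NP a c fP)).
rewrite (Sw_counitr a (\prod_(u <- b) u :: c) (mixN_mul NP fP)).
exact: (YDalg_1r NP).
Qed.

Lemma circ3_lunitl f us : coch f ->
  circ3 B act co mul lunit f [::] us [::] = f us.
Proof.
move=> fP; rewrite /circ3 Sw_nil.
have := Sw_counitr us [::] (mixN_mul NP fP).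
rewrite cats0 (YDalg_1r NP) => <-; apply: eq_Sw => ys z _.
rewrite cats0 (YDalg_act1 NP) (lactE NP) -/(iot B act oneN _) (mul_iotr NP).
rewrite -[f ys in RHS](co_counit NP) linear_sum.
transitivity (\sum_(x <- co (f ys))
    act (src B (cou B (x.1 * tgt B (cou B z)))) x.2).
  apply: eq_bigr => x _; rewrite /lunit big_seq1 (act_one NP) (mul_iotl NP).
  by rewrite couM_tgt.
rewrite (@co_takeuchi _ _ _ _ _ _ _ _ _ _ NP _ (fun x n => act (src B (cou B x)) n)).
  by apply: eq_bigr => x _; rewrite /= (act_tgt_src NP).
split=> *; first by rewrite linearD rmorphD (actDl NP).
  exact: actDr.
by rewrite cou_tgt rmorphM (act_mul NP).
Qed.

Variable gm : (U -> N) -> N.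
Hypothesis gmP : cyc_contra H act co mul gm.

Lemma ltau_lunit us : ltau H act gm lunit us = lunit us.
Proof.
case: us => [|u us]; first by rewrite (ltau_nil gmP).
rewrite -[RHS](cc_counit gmP); congr gm; apply: funext => w.
pose F us w := iot B act oneN (cou B (src B (cou B (\prod_(u <- us) u)) * w)).
have FM : mix B F.
  split=> *.
  - by rewrite /F !big_cat !big_cons /= mulrDl mulrDr linearD rmorphD mulrDl linearD (iotD NP).
  - by rewrite /F mulrDr linearD (iotD NP).
  - by rewrite /F !big_cat !big_cons /= !mulrA.
  - by rewrite /F !big_cons -mulrA cou_tgt rmorphM mulrA.
rewrite /Et (Tr_Sw H w FM); first by rewrite /F cou_src iotM.
case=> // v vs x szv; rewrite /F.
rewrite /= (act_iot NP) -couM_src -cats1 big_cat big_seq1 /= mulrA.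
have -> : v * \prod_(i <- vs) i = \prod_(i <- v :: vs) i by rewrite big_cons.
rewrite -Sw_counitl.
rewrite (raddf_Sw B (v :: vs) (f := fun y => iot B act oneN (cou B (y * x)))).
  by apply: eq_Sw => ys z _; rewrite mulrA.
by move=> y y'; rewrite mulrDl linearD (iotD NP).
Qed.

End Units.

(** * Operads *)

Section ReversedOperad.
Local Open Scope nat_scope.
Variables (k : comNzRingType) (O : nat -> lmodType k).
Variables (one : O 1) (circ : forall p q : nat, nat -> O p -> O q -> O (p + q).-1).

Lemma eqop0 m n : m = n -> eqop (0%R : O m) (0%R : O n).
Proof. by move->. Qed.

Hypothesis oP : is_operad one circ.

Lemma circ0l p q i (y : O q) : 0 < i -> circ i (0%R : O p) y = 0%R.
Proof.
move=> i0; have := circ_linl oP (p := p) y i0 1%R 0%R 0%R.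
by rewrite !scale1r addr0 -[LHS in LHS = _]addr0 => /addrI.
Qed.

Lemma rev_in p q i (x : O p) (y : O q) :
  i <= p -> rev_circ circ i x y = circ (p.+1 - i) x y.
Proof. by rewrite /rev_circ => ->. Qed.

Lemma rev_out p q i (x : O p) (y : O q) :
  p < i -> rev_circ circ i x y = 0%R.
Proof. by move=> pi; rewrite /rev_circ; have -> : (i <= p) = false by lia. Qed.

Lemma rev0l p q i (y : O q) : 0 < i -> rev_circ circ i (0%R : O p) y = 0%R.
Proof.
move=> i0; case: (leqP i p) => ip; last exact: rev_out.
by rewrite rev_in // circ0l // subn_gt0 ltnS.
Qed.

(** Numbering the inputs from the right yields an operad again. *)
Lemma rev_operad : is_operad one (rev_circ circ).
Proof.
split.
- move=> p q i x i0; case: (leqP i p) => ip; rewrite /rev_circ.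
    by rewrite ip; apply: (circ_linr oP); lia.
  have -> : (i <= p) = false by lia.
  by move=> c y z; rewrite GRing.scaler0 GRing.addr0.
- move=> p q i y i0; case: (leqP i p) => ip; rewrite /rev_circ.
    by rewrite ip; apply: (circ_linl oP); lia.
  have -> : (i <= p) = false by lia.
  by move=> c x z; rewrite GRing.scaler0 GRing.addr0.
- by move=> p q i x y; apply: rev_out.
- move=> p i x /andP[i0 ip]; rewrite rev_in //.
  by apply: (circ_unitr oP); lia.
- by move=> p x; rewrite rev_in //; apply: (circ_unitl oP).
- move=> p q r i j x y z p0 /andP[j0 ji]; case: (leqP i p) => ip; last first.
    rewrite (rev_out _ _ ip) rev0l // rev_out; last lia.
    by apply: eqop0; lia.
  rewrite !rev_in //; try lia.
  have := @circ_A3 _ _ _ _ oP p q r (p.+1 - i) ((p + q).-1.+1 - j) x y z p0.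
  have -> : ((p + q).-1.+1 - j - q).+1 = p.+1 - j by lia.
  have -> : (p + r).-1.+1 - (i + r).-1 = p.+1 - i by lia.
  by apply; lia.
- move=> p q r i j x y z p0 /andP[i0 ij] jq; case: (leqP i p) => ip; last first.
    rewrite (rev_out _ _ ip) rev0l; last lia.
    by rewrite rev_out //; apply: eqop0; lia.
  rewrite !rev_in //; try lia.
  have := @circ_A2 _ _ _ _ oP p q r (p.+1 - i) ((p + q).-1.+1 - j) x y z p0.
  have -> : ((p + q).-1.+1 - j - (p.+1 - i)).+1 = q.+1 - (j - i).+1 by lia.
  by apply; lia.
- move=> p q r i j x y z p0 i0 qij; case: (leqP i p) => ip; last first.
    rewrite (rev_out _ _ ip) rev0l; last lia.
    rewrite (@rev_out _ _ (j - q).+1) ?rev0l //; last lia.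
    by apply: eqop0; lia.
  case: (leqP j (p + q).-1) => jp; last first.
    rewrite (rev_out _ _ jp) (@rev_out _ _ (j - q).+1) ?rev0l //; last lia.
    by apply: eqop0; lia.
  rewrite !rev_in //; try lia.
  have := @circ_A1 _ _ _ _ oP p q r (p.+1 - i) ((p + q).-1.+1 - j) x y z p0.
  have -> : (p.+1 - i + r).-1 = (p + r).-1.+1 - i by lia.
  have -> : p.+1 - (j - q).+1 = (p + q).-1.+1 - j by lia.
  by apply; lia.
Qed.

Lemma rev_operad_mult (mu : O 2) (e : O 0) :
  is_operad_mult one circ mu e -> is_operad_mult one (rev_circ circ) mu e.
Proof.
case=> _ A e1 e2; split; first exact: rev_operad.
- by rewrite /rev_circ /= A.
- by rewrite /rev_circ /= e2.
- by rewrite /rev_circ /= e1.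
Qed.

End ReversedOperad.

(** * The cyclic operad of cochains *)

Lemma circ3_eq (k : comNzRingType) (A U : algType k) (B : bialgebroid A U)
    (N : lmodType k) (act : U -> {linear N -> N}) (co : N -> seq (U * N))
    (mul : N -> N -> N) (f f' g g' : seq U -> N) (a b c : seq U) :
  (forall l, size l = (size a + size c).+1 -> f l = f' l) ->
  (forall l, size l = size b -> g l = g' l) ->
  circ3 B act co mul f g a b c = circ3 B act co mul f' g' a b c.
Proof.
move=> ff gg; apply: eq_Sw => xs y szx; apply: eq_Sw => ys z szy.
rewrite gg //; apply: eq_bigr => x _.
by rewrite ff // size_cat /= szx addnS.
Qed.

Lemma split2 (T : Type) (s : seq T) n1 n2 : size s = (n1 + n2)%N ->
  exists a b, [/\ s = a ++ b, size a = n1 & size b = n2].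
Proof.
move=> sz; exists (take n1 s), (drop n1 s); split; first by rewrite cat_take_drop.
  by rewrite size_takel // sz leq_addr.
by rewrite size_drop sz addKn.
Qed.

Section CochainOperad.
Variables (k : comNzRingType) (A U : algType k) (B : bialgebroid A U).
Variable H : left_hopf B.
Variables (N : lmodType k) (act : U -> {linear N -> N}).
Variables (lact : A -> {linear N -> N}) (co : N -> seq (U * N)).
Variables (mul : N -> N -> N) (oneN : N).
Hypothesis NP : is_YDalgebra B act lact co mul oneN.
Hypothesis BC : braided_comm act co mul.
Variable gm : (U -> N) -> N.
Hypothesis gmP : cyc_contra H act co mul gm.
Variable ract : A -> {linear N -> N}.
Hypothesis ractE : forall a n, ract a n = act (tgt B a) n.
Implicit Types (a : A) (u v w : U).
Local Notation coch := (coch B act).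
Local Notation lunit := (lunit B act oneN).
Local Notation lcirc := (lcirc B act co mul).
Local Notation ltau := (ltau H act gm).
Local Notation C := (fun n => cochain B ract n).

Lemma tgt_scal (c : k) : tgt B c%:A = c%:A.
Proof. by rewrite linearZ /= tgt1. Qed.

Lemma src_scal (c : k) : src B c%:A = c%:A.
Proof. by rewrite linearZ /= rmorph1. Qed.

Lemma act_scal (c : k) n : act c%:A n = c *: n.
Proof. exact: (lmodule_unital (YD_module (YDalg_YD NP))). Qed.

(** Linearity over the ground ring comes for free, since scalars act through
    $t$. *)
Lemma coch_scale f s1 s2 (c : k) u : coch f ->
  f (s1 ++ (c *: u) :: s2) = c *: f (s1 ++ u :: s2).
Proof.
move=> fP; rewrite -[c *: u]mul1r -scalerAr scalerAl -tgt_scal.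
elim/last_ind: s1 u s2 => [|s1 v IH] u s2.
  by rewrite (coch_tgt fP) tgt_scal act_scal.
rewrite !cat_rcons -(balLB (cochL fP)).
have -> : v * tgt B c%:A = tgt B c%:A * v.
  by rewrite tgt_scal -scalerAl -scalerAr mul1r mulr1.
exact: IH.
Qed.

Lemma evs_coch n (f : C n) : coch (evs f).
Proof.
have /asboolP [f1 f2 f3] := cofunP f; split; last first.
  by move=> a u s; rewrite f3 ractE.
split=> [s1 s2 u v|s1 s2 a u v]; last exact: f2.
by have := f1 s1 s2 1 u v; rewrite !scale1r.
Qed.

Lemma evs_tuple n (F : seq U -> N) s :
  evs (fun t : n.-tuple U => F t) s = if size s == n then F s else 0.
Proof. by rewrite /evs; case: insubP => [t -> ->|/negPf ->]. Qed.

Fact mk_cochain_subproof n (F : seq U -> N) (FP : coch F) :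
  (fun t : n.-tuple U => F t) \in cochain_pred B ract (n := n).
Proof.
apply/asboolP; split=> [s1 s2 c u v|s1 s2 a u v|s a u]; rewrite !evs_tuple.
- rewrite !size_cat /=; case: ifP => _; last by rewrite scaler0 addr0.
  by rewrite (balLD (cochL FP)) coch_scale.
- rewrite !size_cat /=; case: ifP => _ //; exact: (balLB (cochL FP)).
- rewrite /=; case: ifP => _; last by rewrite linear0.
  by rewrite (coch_tgt FP) ractE.
Qed.

(** The cochain of arity [n] given by a function on lists. *)
Definition mk_cochain n (F : seq U -> N) (FP : coch F) : C n :=
  Cochain (mk_cochain_subproof n FP).

Lemma evs_mk n (F : seq U -> N) (FP : coch F) s :
  evs (mk_cochain n FP) s = if size s == n then F s else 0.
Proof. exact: evs_tuple. Qed.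

Lemma evs_mkE n (F : seq U -> N) (FP : coch F) s : size s = n ->
  evs (mk_cochain n FP) s = F s.
Proof. by rewrite evs_mk => ->; rewrite eqxx. Qed.

Lemma evs_t n (f : n.-tuple U -> N) (t : n.-tuple U) : evs f t = f t.
Proof. by rewrite /evs valK. Qed.

Lemma cochain_ext n (f g : C n) :
  (forall s, size s = n -> evs f s = evs g s) -> f = g.
Proof.
move=> fg; apply/val_inj/funext => t.
by rewrite -[LHS]evs_t -[RHS]evs_t fg // size_tuple.
Qed.

Lemma eqop_ext m n (f : C m) (g : C n) : m = n ->
  (forall s, size s = m -> evs f s = evs g s) -> eqop (O := C) f g.
Proof. by move=> mn; case: n / mn g => g /cochain_ext ->. Qed.

(** [cunit 1], [cunit 2] and [cunit 0] are the identity, the multiplication and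
    the unit of the operad. *)
Definition cunit n : C n := mk_cochain n (lunit_coch NP).

(** Partial composition, with inputs numbered from the left. *)
Definition ccirc p q i (f : C p) (g : C q) : C (p + q).-1 :=
  if (0 < i <= p)%N then
    mk_cochain _ (lcirc_coch NP i.-1 q (evs_coch f) (evs_coch g))
  else 0.

Definition ctau n (f : C n) : C n := mk_cochain n (ltau_coch NP gmP (evs_coch f)).

Lemma evs_circ p q i (f : C p) (g : C q) (a b c : seq U) :
  size a = i.-1 -> size b = q -> (0 < i)%N -> (i + size c)%N = p ->
  evs (ccirc i f g) (a ++ b ++ c) = circ3 B act co mul (evs f) (evs g) a b c.
Proof.
move=> sza szb i0 szc; have ip : (0 < i <= p)%N by lia.
rewrite /ccirc ip evs_mkE; first exact: lcircE.
by rewrite !size_cat; lia.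
Qed.

Lemma ccirc_out p q i (f : C p) (g : C q) : (p < i)%N -> ccirc i f g = 0.
Proof. by move=> pi; rewrite /ccirc; have -> : (0 < i <= p)%N = false by lia. Qed.

Lemma circN_lcirc p q i (f : p.-tuple U -> N) (g : q.-tuple U -> N) us :
  circN B act co mul i f g us = lcirc i.-1 q (evs f) (evs g) us.
Proof.
rewrite /circN; apply: eq_bigr => xs _; apply: eq_bigr => ys _.
by apply: eq_bigr => n _; rewrite drop_drop addnC.
Qed.

Lemma ccirc_split p q i (P : seq U -> Prop) : (0 < i <= p)%N ->
  (forall a b c : seq U, size a = i.-1 -> size b = q -> (i + size c)%N = p ->
     P (a ++ b ++ c)) ->
  forall s, size s = (p + q).-1 -> P s.
Proof.
move=> ip h s sz.
have [a [s' [-> sza szs']]] := @split2 _ s i.-1 (q + (p - i)) ltac:(lia).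
have [b [c [-> szb szc]]] := split2 szs'.
by apply: h => //; lia.
Qed.

Lemma evsCD n (f g : C n) s : evs (f + g) s = evs f s + evs g s.
Proof. exact: evsD. Qed.

Lemma evsCZ n c (f : C n) s : evs (c *: f) s = c *: evs f s.
Proof. exact: evsZ. Qed.

Lemma mul_scall c m n : mul (c *: m) n = c *: mul m n.
Proof. by rewrite -!act_scal -src_scal (src_mulN NP). Qed.

Lemma Sw_scale c us (F : seq U -> U -> N) :
  c *: Sw B us F = Sw B us (fun xs y => c *: F xs y).
Proof. exact: scaler_sumr. Qed.

Lemma dl_scale c g b (F : U -> N -> N) :
  c *: dl B co g b F = dl B co g b (fun x n => c *: F x n).
Proof.
by rewrite /dl Sw_scale; apply: eq_Sw => ys z _; apply: scaler_sumr.
Qed.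

Lemma ccirc_linl p q i (g : C q) : (0 < i)%N -> linear ((@ccirc p q i)^~ g).
Proof.
move=> i0 c f f'; case: (leqP i p) => ip; last first.
  by rewrite !ccirc_out // scaler0 addr0.
apply: cochain_ext; apply: (ccirc_split (i := i)) => [|xa xb xc sza szb szc].
  by rewrite i0.
rewrite evsCD evsCZ !evs_circ // /circ3 Sw_scale -SwD; apply: eq_Sw => xs y _.
rewrite dl_scale -dlD; apply: eq_dl => x n.
by rewrite evsCD evsCZ (mulDl NP) mul_scall.
Qed.

Lemma ccirc0l p q i (g : C q) : (0 < i)%N -> ccirc i (0 : C p) g = 0.
Proof.
move=> i0; have := @ccirc_linl p q i g i0 1 0 0.
by rewrite !scale1r addr0 -[LHS in LHS = _]addr0 => /addrI.
Qed.

Lemma ccirc_linr p q i (f : C p) : (0 < i)%N -> linear (@ccirc p q i f).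
Proof.
move=> i0 c g g'; case: (leqP i p) => ip; last first.
  by rewrite !ccirc_out // scaler0 addr0.
apply: cochain_ext; apply: (ccirc_split (i := i)) => [|xa xb xc sza szb szc].
  by rewrite i0.
have fP := evs_coch f; have FP := balN_prefix NP xa xc fP.
rewrite evsCD evsCZ !evs_circ // /circ3 -!exchange_dl_Sw dl_scale /dl -SwD.
apply: eq_Sw => ys z _.
rewrite evsCD evsCZ (co_sumD NP (balN_mull FP z)); congr (_ + _).
rewrite -act_scal -src_scal (co_sum_src NP (balN_mull FP z)).
apply: eq_bigr => x _; rewrite Sw_scale; apply: eq_Sw => xs y _.
by rewrite src_scal -!scalerAl mul1r coch_scale // mul_scall.
Qed.

Lemma ccirc_unitr p i (f : C p) : (0 < i <= p)%N ->
  eqop (O := C) (ccirc i f (cunit 1)) f.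
Proof.
move=> ip; apply: eqop_ext => [|s sz]; first lia.
move: s sz; apply: (ccirc_split ip) => xa xb xc sza szb szc.
rewrite evs_circ //; try lia.
transitivity (circ3 B act co mul (evs f) lunit xa xb xc).
  by apply: circ3_eq => // l sz; rewrite evs_mkE // sz szb.
rewrite (circ3_lunitr NP) //; last exact: evs_coch.
by case: xb szb => [|u []] //= _; rewrite big_seq1.
Qed.

Lemma ccirc_unitl p (f : C p) : eqop (O := C) (ccirc 1 (cunit 1) f) f.
Proof.
apply: eqop_ext => [|s sz]; first by rewrite add1n.
have := @evs_circ _ _ 1 (cunit 1) f [::] s [::].
rewrite cats0 => ->; rewrite ?sz //.
rewrite -[RHS](circ3_lunitl NP _ (evs_coch f)).
by apply: circ3_eq => // l szl; rewrite evs_mkE.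
Qed.

Lemma ccirc_A1 p q r i j (f : C p) (g : C q) (h : C r) :
  (0 < p)%N -> (0 < j < i)%N ->
  eqop (O := C) (ccirc j (ccirc i f g) h) (ccirc (i + r).-1 (ccirc j f h) g).
Proof.
move=> p0 /andP[j0 ji]; case: (leqP i p) => ip; last first.
  rewrite (ccirc_out _ _ ip) ccirc0l // (@ccirc_out _ _ (i + r).-1); last lia.
  by apply: eqop0; lia.
apply: eqop_ext => [|s sz]; first lia.
have [a [s1 [-> sza sz1]]] := @split2 _ s j.-1 (r + (i - j).-1 + q + (p - i)) ltac:(lia).
have [b [s2 [-> szb sz2]]] := @split2 _ s1 r ((i - j).-1 + q + (p - i)) ltac:(lia).
have [c [s3 [-> szc sz3]]] := @split2 _ s2 (i - j).-1 (q + (p - i)) ltac:(lia).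
have [d [e [-> szd sze]]] := @split2 _ s3 q (p - i) ltac:(lia).
rewrite evs_circ ?size_cat //; try lia.
rewrite (@circ3_parallel _ _ _ _ _ _ _ _ _ _ NP (evs f) (evs g) (evs h)
  _ (evs (ccirc j f h))) //; try exact: evs_coch.
- have -> : a ++ b ++ c ++ d ++ e = (a ++ b ++ c) ++ d ++ e by rewrite -!catA.
  by rewrite evs_circ ?size_cat //; lia.
- move=> xs x szx.
  have -> : xs ++ x :: c ++ d ++ e = (xs ++ x :: c) ++ d ++ e by rewrite -!catA.
  by rewrite evs_circ ?size_cat //=; lia.
- by move=> xs bs zs x szx szbs szzs; rewrite evs_circ ?size_cat //=; lia.
Qed.

Lemma ccirc_A2 p q r i j (f : C p) (g : C q) (h : C r) :
  (0 < p)%N -> (0 < i <= j)%N -> (j < q + i)%N ->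
  eqop (O := C) (ccirc j (ccirc i f g) h) (ccirc i f (ccirc (j - i).+1 g h)).
Proof.
move=> p0 /andP[i0 ij] jq; case: (leqP i p) => ip; last first.
  rewrite !(ccirc_out _ _ ip) ccirc0l; last lia.
  by apply: eqop0; lia.
apply: eqop_ext => [|s sz]; first lia.
have [a [s1 [-> sza sz1]]] :=
  @split2 _ s i.-1 (j - i + r + (q + i - j).-1 + (p - i)) ltac:(lia).
have [b [s2 [-> szb sz2]]] := @split2 _ s1 (j - i) (r + (q + i - j).-1 + (p - i)) ltac:(lia).
have [c [s3 [-> szc sz3]]] := @split2 _ s2 r ((q + i - j).-1 + (p - i)) ltac:(lia).
have [d [e [-> szd sze]]] := @split2 _ s3 (q + i - j).-1 (p - i) ltac:(lia).
rewrite [in LHS]catA evs_circ ?size_cat //; try lia.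
rewrite (@circ3_nested _ _ _ _ _ _ _ _ _ _ NP (evs f) (evs g) (evs h)
  _ (evs (ccirc (j - i).+1 g h))) //; try exact: evs_coch.
- have -> : a ++ b ++ c ++ d ++ e = a ++ (b ++ c ++ d) ++ e by rewrite -!catA.
  by rewrite evs_circ ?size_cat //; lia.
- move=> xs bs x szx szbs.
  have -> : xs ++ bs ++ x :: d ++ e = xs ++ (bs ++ x :: d) ++ e by rewrite -!catA.
  by rewrite evs_circ ?size_cat //=; lia.
- by move=> b' c' d' szb' szc' szd'; rewrite evs_circ //; lia.
Qed.

Lemma eqop_sym m n (x : C m) (y : C n) : eqop (O := C) x y -> eqop (O := C) y x.
Proof. by rewrite /eqop => ->. Qed.

Lemma ccirc_operad : is_operad (O := C) (cunit 1) ccirc.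
Proof.
split.
- by move=> p q i f; apply: ccirc_linr.
- by move=> p q i g; apply: ccirc_linl.
- by move=> p q i f g; apply: ccirc_out.
- by move=> p i f; apply: ccirc_unitr.
- by move=> p f; apply: ccirc_unitl.
- by move=> p q r i j f g h; apply: ccirc_A1.
- by move=> p q r i j f g h; apply: ccirc_A2.
- move=> p q r i j f g h p0 i0 qij.
  have := @ccirc_A1 p r q (j - q).+1 i f h g p0.
  have -> : ((j - q).+1 + q).-1 = j by lia.
  by move=> E; apply/eqop_sym/E; lia.
Qed.

Lemma ccirc_operad_mult :
  is_operad_mult (O := C) (cunit 1) ccirc (cunit 2) (cunit 0).
Proof.
have circ_unit p q i (a b c : seq U) : size a = i.-1 -> size b = q ->
    (0 < i)%N -> (i + size c)%N = p ->
    evs (ccirc i (cunit p) (cunit q)) (a ++ b ++ c) = lunit (a ++ b ++ c).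
  move=> sza szb i0 szc; rewrite evs_circ //.
  transitivity (circ3 B act co mul lunit lunit a b c).
    by apply: circ3_eq => l szl; rewrite evs_mkE //; lia.
  rewrite (circ3_lunitr NP) //; last exact: (lunit_coch NP).
  by rewrite /lunit !big_cat !big_cons /=.
have circ_unitE p q i : (0 < i <= p)%N -> forall s, size s = (p + q).-1 ->
    evs (ccirc i (cunit p) (cunit q)) s = lunit s.
  move=> ip; apply: (ccirc_split ip) => a b c sza szb szc.
  by apply: circ_unit => //; lia.
split; first exact: ccirc_operad.
- by apply: cochain_ext => s sz; rewrite !circ_unitE.
- by apply: cochain_ext => s sz; rewrite circ_unitE // evs_mkE.
- by apply: cochain_ext => s sz; rewrite circ_unitE // evs_mkE.
Qed.

Lemma Et_eq f g us w : (forall l, size l = size us -> f l = g l) ->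
  Et H act f us w = Et H act g us w.
Proof. by move=> fg; apply: eq_Tr => -[|u l] //= [szl]; rewrite fg. Qed.

Lemma ltau_eq f g us : (forall l, size l = size us -> f l = g l) ->
  ltau f us = ltau g us.
Proof.
case: us => [|u us] fg; first by rewrite /ltau fg.
by congr gm; apply: funext => w; apply: Et_eq.
Qed.

Lemma evs_tau n (f : C n) s : size s = n -> evs (ctau f) s = ltau (evs f) s.
Proof. exact: evs_mkE. Qed.

Lemma gm_scale c f : homN B act f -> gm (fun w => c *: f w) = c *: gm f.
Proof.
move=> fP; rewrite -act_scal -tgt_scal -(gm_src NP gmP _ fP).
congr gm; apply: funext => w.
by rewrite src_scal -tgt_scal (homN_tgt fP) tgt_scal act_scal.
Qed.

Lemma Et_scale c f us w :
  Et H act (fun l => c *: f l) us w = c *: Et H act f us w.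
Proof.
rewrite /Et (raddf_Tr _ _ _ _ (f := *:%R c)) => [|x y]; last exact: scalerDr.
by apply: eq_Tr => -[|u l] _ /=; rewrite ?scaler0 ?linearZ.
Qed.

Lemma EtD f g us w :
  Et H act (fun l => f l + g l) us w = Et H act f us w + Et H act g us w.
Proof.
by rewrite /Et -TrD; apply: eq_Tr => -[|u l] _ /=; rewrite ?addr0 ?linearD.
Qed.

Lemma ctau_linear n : linear (@ctau n).
Proof.
move=> c f g; apply: cochain_ext => -[|u us] sz; rewrite evsCD evsCZ !evs_tau //.
  by rewrite !(ltau_nil gmP) evsCD evsCZ.
have EH (h : C n) us' : homN B act (Et H act (evs h) us').
  exact: (Et_homN H NP us' (evs_coch h)).
have EHc (h : C n) us' : homN B act (fun w => c *: Et H act (evs h) us' w).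
  split=> [v w|a w]; first by rewrite (homND (EH _ _)) scalerDr.
  by rewrite (homN_tgt (EH _ _)) linearZ.
rewrite /= -(gm_scale _ (EH f _)) -(cc_add gmP (EHc _ _) (EH _ _)).
congr gm; apply: funext => w.
rewrite -Et_scale -EtD; apply: Et_eq => l _.
by rewrite [LHS]evsD [X in X + _]evsZ.
Qed.

Lemma ctau_circ p q i (f : C p) (g : C q) : (0 < i < p)%N ->
  ctau (ccirc i f g) = ccirc i.+1 (ctau f) g.
Proof.
move=> /andP[i0 ip]; apply: cochain_ext => s sz; rewrite evs_tau //.
have [a [s1 [-> sza sz1]]] := @split2 _ s i (q + (p - i).-1) ltac:(lia).
have [b [c [-> szb szc]]] := @split2 _ s1 q (p - i).-1 ltac:(lia).
rewrite evs_circ //; try lia.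
case: a sza => [|u a] sza; first by rewrite -sza in i0.
rewrite (@ltau_circ _ _ _ _ _ _ _ _ _ _ _ NP _ gmP (evs f) (evs g)) //;
  try exact: evs_coch.
  apply: circ3_eq => // l szl; rewrite evs_tau // szl.
  by rewrite /= in sza *; lia.
move=> a' b' c' x sza' szb' szc'; rewrite evs_circ ?size_rcons //.
- by rewrite sza' -[size a]/((size (u :: a)).-1) sza.
- by rewrite szb'.
- by lia.
Qed.

Lemma ctau_circ_last p q (f : C p) (g : C q) : (0 < p)%N -> (0 < q)%N ->
  eqop (O := C) (ctau (ccirc p f g)) (ccirc 1 (ctau g) (ctau f)).
Proof.
move=> p0 q0; apply: eqop_ext => [|s sz]; first lia.
rewrite evs_tau //.
have [b [d [-> szb szd]]] := @split2 _ s p q.-1 ltac:(lia).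
have := @evs_circ _ _ 1 (ctau g) (ctau f) [::] b d.
rewrite cat0s => ->; rewrite ?szb //; try lia.
case: b szb {sz} => [|u b] szb; first by rewrite -szb in p0.
rewrite cat_cons.
rewrite (@ltau_circ_last _ _ _ _ _ _ _ _ _ _ _ NP _ gmP BC (evs f) (evs g)) //;
  try exact: evs_coch.
  apply: circ3_eq => l szl; rewrite evs_tau //; last by rewrite szl szb.
  by rewrite szl /= szd; lia.
move=> b' d' x szb' szd'; have := @evs_circ _ _ p f g b' (rcons d' x) [::].
rewrite cats0; apply; rewrite ?size_rcons //=; try lia.
by rewrite szb' -szb.
Qed.

Lemma ctau_iter n (f : C n) : iter n.+1 (@ctau n) f = f.
Proof.
apply: cochain_ext => s sz; rewrite -[RHS](iter_ltau NP gmP _ (evs_coch f)) sz.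
move: s sz; elim: n.+1 => [|j IH] s sz //.
by rewrite /= evs_tau //; apply: ltau_eq => l szl; apply: IH; rewrite szl.
Qed.

Lemma ctau_cunit n : ctau (cunit n) = cunit n.
Proof.
apply: cochain_ext => s sz; rewrite evs_tau // evs_mkE //.
rewrite -[RHS](ltau_lunit NP gmP); apply: ltau_eq => l szl.
by rewrite evs_mkE // szl.
Qed.

Lemma ccirc_cyclic :
  is_cyclic_operad_mult (O := C) (cunit 1) (rev_circ (O := C) ccirc)
    (cunit 2) (cunit 0) ctau.
Proof.
split.
- exact: rev_operad_mult ccirc_operad _ _ ccirc_operad_mult.
- exact: ctau_linear.
- move=> p q f g p0 q0; rewrite !rev_in //.
  rewrite subSS subn0 subSnn; exact: ctau_circ_last.
- move=> p q i f g /andP[i1 ip]; rewrite !rev_in //; try lia.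
  have -> : (p.+1 - i.-1 = (p.+1 - i).+1)%N by lia.
  by apply: ctau_circ; lia.
- exact: ctau_cunit.
- exact: ctau_iter.
- exact: ctau_cunit.
Qed.

Lemma ctauE n (f : C n) us : ctau f us = tau_fun H act gm f us.
Proof.
rewrite -evs_t evs_tau ?size_tuple //; case: (tval us) => [|u us'] //=.
congr gm; apply: funext => w; rewrite /Et Tr_cons; apply: eq_bigr => x _.
by apply: eq_bigr => xs _; rewrite mulrA.
Qed.

(** The cochains with values in a braided commutative Yetter-Drinfel'd algebra
    with a suitable contraaction form an operad with multiplication, which is
    cyclic once the inputs are numbered from the right. *)
Theorem cochain_cyclic_operad :
  exists (one : C 1%N) (circ : forall p q : nat, nat -> C p -> C q -> C (p + q).-1)
         (mu : C 2%N) (e : C 0%N) (tau : forall n, C n -> C n),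
    [/\ forall u, one [tuple u] = lact (cou B u) oneN,
        forall u v, mu [tuple u; v] = lact (cou B (u * v)) oneN,
        e [tuple] = oneN,
        forall p q i (f : C p) (h : C q), (0 < i <= p)%N ->
          forall us, circ p q i f h us = circN B act co mul i f h us &
        forall n (f : C n) us, tau n f us = tau_fun H act gm f us]
    /\ is_operad_mult (O := C) one circ mu e
    /\ is_cyclic_operad_mult (O := C) one (rev_circ circ) mu e tau.
Proof.
exists (cunit 1), ccirc, (cunit 2), (cunit 0), ctau; split; last first.
  by split; [exact: ccirc_operad_mult|exact: ccirc_cyclic].
split.
- by move=> u; rewrite (lactE NP) /= /lunit big_seq1.
- by move=> u v; rewrite (lactE NP) /= /lunit big_cons big_seq1.
- by rewrite /= /lunit big_nil cou1 /iot rmorph1 (act_one NP).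
- by move=> p q i f h ip us; rewrite /ccirc ip /= circN_lcirc.
- exact: ctauE.
Qed.

End CochainOperad.

(** * The base algebra *)

Section Base.
Variables (k : comNzRingType) (A U : algType k) (B : bialgebroid A U).
Variable H : left_hopf B.
Implicit Types (a b : A) (u v w : U).

(** The structure of $A$ as a comodule: the unit object of the comodules. *)
Definition base_lact (a : A) : {linear A -> A} := canact B (src B a).
Definition base_co (a : A) : seq (U * A) := [:: (src B a, 1)].

Lemma canactE u a : canact B u a = cou B (u * src B a). Proof. by []. Qed.

Lemma canact_src a b : canact B (src B a) b = a * b.
Proof. by rewrite canactE -rmorphM cou_srcE. Qed.

Lemma canact_tgt a b : canact B (tgt B a) b = b * a.
Proof. by rewrite canactE cou_tgt cou_srcE. Qed.

Lemma canact_module : is_lmodule (canact B).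
Proof.
split=> [c u v m|m|u v m].
- by rewrite !canactE mulrDl -scalerAl linearP.
- by rewrite canactE mul1r cou_srcE.
- by rewrite !canactE -mulrA couM_src.
Qed.

Lemma base_lact_module : is_lmodule base_lact.
Proof.
split=> [c a b m|m|a b m]; rewrite /base_lact !canact_src.
- by rewrite mulrDl scalerAl.
- by rewrite mul1r.
- by rewrite mulrA.
Qed.

Lemma base_YDalgebra : is_YDalgebra B (canact B) base_lact base_co *%R 1.
Proof.
have comP : is_comodule B base_lact base_co.
  split.
  - exact: base_lact_module.
  - move=> c m n; rewrite /base_co /= linearP; apply: fsum_gen; exact: tens2Dl.
  - move=> a n; rewrite /base_co /= /base_lact canact_src rmorphM.
    exact: fsum_refl.
  - move=> n; apply: tens3_complete => [a x|W F F1 F2]; first exact: mulrN.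
    rewrite !big_allpairs_dep /base_co !big_seq1 /=.
    by rewrite (cop_sum_src n (F1 1)) rmorph1.
  - by move=> n; rewrite big_seq1 /base_lact canact_src cou_srcE mulr1.
have YD : is_YD B (canact B) base_lact base_co.
  split=> //.
  - exact: canact_module.
  - by move=> a n; rewrite /com_ract big_seq1 /= /base_lact canact_tgt
      canact_src -rmorphM cou_srcE mulr1.
  - move=> u n; apply: tens2_complete => [a x|W F FP]; first exact: mulrN.
    have FD : {morph F^~ 1 : x y / x + y} by move=> x y; apply: (bal2Dl FP).
    rewrite !big_allpairs_dep.
    under eq_bigr do rewrite big_seq1 /=.
    under [RHS]eq_bigr do rewrite big_seq1 /=.
    rewrite -(additive_sum _ _ FD).
    transitivity (F (u * src B n) 1); first by rewrite src_counitl.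
    rewrite -{1}[u](counitr B) mulr_suml (additive_sum _ _ FD).
    apply: eq_bigr => x _; rewrite -mulrA (bal2A FP) /base_lact canact_src.
    by rewrite canactE rmorph1 !mulr1.
split=> //.
- by move=> n c l m; rewrite mulrDl scalerAl.
- by move=> l c m n; rewrite mulrDr scalerAr.
- move=> a m n; rewrite /com_ract big_seq1 /= /base_lact !canact_src -rmorphM.
  by rewrite cou_srcE mulr1 mulrA.
- exact: mulrA.
- exact: mul1r.
- exact: mulr1.
- move=> u m n; rewrite canactE rmorphM mulrA -(src_counitl B u m) mulr_suml linear_sum.
  by apply: eq_bigr => x _; rewrite -mulrA cou_src.
- by move=> u; rewrite canactE rmorph1 mulr1 /base_lact canact_src mulr1.
- move=> m n; rewrite /base_co /= mulr1 rmorphM; exact: fsum_refl.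
- by rewrite /base_co rmorph1; exact: fsum_refl.
Qed.

Lemma base_braided : braided_comm (canact B) base_co *%R.
Proof. by move=> m n; rewrite big_seq1 /= canact_src mulr1. Qed.

Lemma homN_scale f c u : homN B (canact B) f -> f (c *: u) = c *: f u.
Proof.
by move=> fP; rewrite -(unital_tgtl B) (homN_tgt fP) canact_tgt mulr_algr.
Qed.

Lemma homN_homA f : homN B (canact B) f -> homA B (@mulract k A) f.
Proof.
move=> fP; split=> [c u v|a u]; last by rewrite (homN_tgt fP) canact_tgt.
by rewrite (homND fP) homN_scale.
Qed.

Variable gA : (U -> A) -> A.
Hypothesis gAP : is_aYD H (canact B) (@mulract k A) gA.
Hypothesis gA_stable : stable (canact B) gA.

(** For $N = A$ right $N$-linearity is right $A$-linearity; the only further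
    point is [cc_tgtr], which contraassociativity derives from the left
    $A$-action. *)
Lemma base_cyc_contra : cyc_contra H (canact B) base_co *%R gA.
Proof.
have [_ gC gsrc gtgt gY] := gAP; have [_ glin gsr gas gcou] := gC.
have gassoc h : balA B h -> (forall u, homN B (canact B) (h u)) ->
    gA (fun u => gA (h u)) = gA (fun u => \sum_(x <- cop B u) h x.1 x.2).
  move=> hP hN; apply: gas => [u|v|a u v|a u v].
  - by have [] := homN_homA (hN u).
  - move=> c u u'; rewrite (bal2Dl hP); congr (_ + _).
    rewrite -(unital_tgtl B) (bal2A hP) (unital_srcl B).
    exact: homN_scale.
  - exact: (bal2A hP).
  - by have [_ ->] := homN_homA (hN u).
split.
- move=> f h fP hP; have := glin 1 f h (homN_homA fP) (homN_homA hP).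
  rewrite scale1r => <-; congr gA; apply: funext => u; by rewrite scale1r.
- exact: gassoc.
- move=> f n fP; rewrite -[RHS](gsr n f (homN_homA fP)); congr gA.
  by apply: funext => u; rewrite big_seq1 mulr1.
- move=> m; rewrite -[RHS]gcou; congr gA; apply: funext => u.
  by rewrite canact_tgt.
- exact: gA_stable.
- move=> a f fP.
  pose h u v := f u * cou B (v * src B a).
  have hP : balA B h.
    split=> [u u' v|u v v'|b u v].
    - by rewrite /h (homND fP) mulrDl.
    - by rewrite /h mulrDl linearD mulrDr.
    - by rewrite /h (homN_tgt fP) canact_tgt -mulrA cou_src mulrA.
  have hN u : homN B (canact B) (h u).
    split=> [v v'|b v]; first exact: (bal2Dr hP).
    by rewrite /h -mulrA cou_tgt canact_tgt mulrA.
  transitivity (gA (fun u => \sum_(x <- cop B u) h x.1 x.2)).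
    congr gA; apply: funext => u.
    rewrite /h -(cop_takeuchi_sum (F := fun p q => f p * cou B q)).
      rewrite -{1}[u](counitr B) mulr_suml.
      rewrite (additive_sum _ _ (homND fP)).
      by apply: eq_bigr => x _; rewrite -mulrA (homN_tgt fP) canact_tgt.
    split=> *; first by rewrite (homND fP) mulrDl.
      by rewrite linearD mulrDr.
    by rewrite (homN_tgt fP) canact_tgt cou_src mulrA.
  rewrite -gassoc //; congr gA; apply: funext => u.
  by rewrite gsrc.
- by move=> u f fP; apply: gY; [apply: homN_homA|apply: tr_cop_cong].
Qed.

End Base.

(** * The induced contraaction *)

Section Induced.
Variables (k : comNzRingType) (A U : algType k) (B : bialgebroid A U).
Variable H : left_hopf B.
Variables (N : lmodType k) (act : U -> {linear N -> N}).
Variables (lact : A -> {linear N -> N}) (co : N -> seq (U * N)).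
Variables (mul : N -> N -> N) (oneN : N).
Hypothesis NP : is_YDalgebra B act lact co mul oneN.
Variable gA : (U -> A) -> A.
Hypothesis gAP : cyc_contra H (canact B) (base_co B) *%R gA.
Implicit Types (a b : A) (u v w : U) (m n : N) (phi psi chi : U -> A).
Local Notation balN := (balN B act).
(* Membership in $U^*$, the case $N = A$ of [homN]. *)
Local Notation dualU := (homN B (canact B)).
Local Notation homN := (homN B act).

Lemma dualU_tgt phi a u : dualU phi -> phi (tgt B a * u) = phi u * a.
Proof. by move=> phiP; rewrite (homN_tgt phiP) canact_tgt. Qed.

Lemma dualU_sum phi I (s : seq I) (F : I -> U) : dualU phi ->
  phi (\sum_(i <- s) F i) = \sum_(i <- s) phi (F i).
Proof. by move=> phiP; apply: additive_sum => x y; apply: (homND phiP). Qed.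

Lemma homN_sumr (F : U -> N) I (s : seq I) (f : I -> U) : homN F ->
  F (\sum_(i <- s) f i) = \sum_(i <- s) F (f i).
Proof. by move=> FP; apply: additive_sum => x y; apply: (homND FP). Qed.

Lemma gA_src a phi : dualU phi -> gA (fun u => phi (src B a * u)) = gA phi * a.
Proof.
by move=> phiP; rewrite (gm_src (base_YDalgebra B) gAP a phiP) canact_tgt.
Qed.

Lemma harpoon_balAop phi v : dualU phi ->
  balAop B (fun x y => cou B (x * tgt B (phi (y * v)))).
Proof.
move=> phiP; split=> [x x' y|x y y'|a x y].
- by rewrite mulrDl linearD.
- by rewrite mulrDl (homND phiP) linearD mulrDr linearD.
- by rewrite -(mulrA (tgt B a)) dualU_tgt // tgtM mulrA.
Qed.

Lemma harpoon_dualU u phi : dualU phi -> dualU (harpoon H u phi).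
Proof.
move=> phiP; split=> [v v'|a v].
  rewrite /harpoon -big_split; apply: eq_bigr => x _.
  by rewrite mulrDr (homND phiP) linearD mulrDr linearD.
rewrite canact_tgt /harpoon.
under eq_bigr do rewrite mulrA.
rewrite -(tr_takeuchi_sum H (harpoon_balAop v phiP)) mulr_suml.
by apply: eq_bigr => x _; rewrite -mulrA cou_tgt.
Qed.

Lemma harpoonD u u' phi v : dualU phi ->
  harpoon H (u + u') phi v = harpoon H u phi v + harpoon H u' phi v.
Proof. by move=> phiP; rewrite /harpoon (tr_sumD H (harpoon_balAop v phiP)). Qed.

Lemma harpoon_tgt a u phi v : dualU phi ->
  harpoon H (tgt B a * u) phi v = harpoon H u phi (src B a * v).
Proof.
move=> phiP; rewrite /harpoon (tr_sum_tgtl H (harpoon_balAop v phiP)).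
by apply: eq_bigr => x _; rewrite mulrA.
Qed.

Lemma harpoon_src a u phi v : dualU phi ->
  harpoon H (src B a * u) phi v = a * harpoon H u phi v.
Proof.
move=> phiP; rewrite /harpoon (tr_sum_srcl H (harpoon_balAop v phiP)) mulr_sumr.
by apply: eq_bigr => x _; rewrite -mulrA cou_src.
Qed.

Lemma eq_gA phi psi : (forall u, phi u = psi u) -> gA phi = gA psi.
Proof. by move=> e; congr gA; apply: funext. Qed.

Lemma act_src_sum I (s : seq I) (f : I -> A) n :
  act (src B (\sum_(i <- s) f i)) n = \sum_(i <- s) act (src B (f i)) n.
Proof. by rewrite rmorph_sum (act_suml NP). Qed.

Lemma act_srcM a b n : act (src B (a * b)) n = act (src B a) (act (src B b) n).
Proof. by rewrite rmorphM (act_mul NP). Qed.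

Lemma harpoon_balN phi : dualU phi ->
  balN (fun x n => act (src B (gA (harpoon H x phi))) n).
Proof.
move=> phiP; have hP x := harpoon_dualU x phiP; split=> [x x' n|x n n'|a x n].
- rewrite -(actDl NP) -rmorphD -(cc_add gAP (hP x) (hP x')).
  by congr (act (src B _) n); apply: eq_gA => v; rewrite harpoonD.
- exact: linearD.
- rewrite -act_srcM -(gA_src a (hP x)).
  by congr (act (src B _) n); apply: eq_gA => v; rewrite harpoon_tgt.
Qed.

(** The map $w \mapsto \chi(n_{(-1)} w) n_{(0)}$. *)
Definition dual_tens chi n w : N := \sum_(z <- co n) act (src B (chi (z.1 * w))) z.2.

Lemma dual_tens_balN chi w : dualU chi ->
  balN (fun x n => act (src B (chi (x * w))) n).
Proof.
move=> cP; split=> [x x' n|x n n'|a x n].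
- by rewrite mulrDl (homND cP) rmorphD (actDl NP).
- exact: linearD.
- by rewrite -mulrA dualU_tgt // act_srcM.
Qed.

Lemma dual_tens_homN chi n : dualU chi -> homN (dual_tens chi n).
Proof.
move=> cP; split=> [u v|a u].
- rewrite -big_split; apply: eq_bigr => z _.
  by rewrite mulrDr (homND cP) rmorphD (actDl NP).
- rewrite /dual_tens; under eq_bigr do rewrite mulrA.
  rewrite (co_takeuchi NP a n (dual_tens_balN u cP)) linear_sum.
  by apply: eq_bigr => z _; rewrite /= -(act_tgt_src NP).
Qed.

(** $t(\psi(u)) m = (m_{(-2)} \rightharpoondown \psi)(m_{(-1)} u) m_{(0)}$.
    For $\psi$ in the dual basis and $m$ the value of $f$ at a basis element,
    this writes $f$ as a sum of maps [dual_tens]. *)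
Lemma act_tgt_dual_tens psi m u : dualU psi ->
  act (tgt B (psi u)) m =
  \sum_(z <- co m) dual_tens (harpoon H z.1 psi) z.2 u.
Proof.
move=> pP; rewrite /dual_tens.
rewrite -(@co_coassoc_sum _ _ _ _ _ _ _ _ _ _ NP _ (fun x y n =>
  act (src B (harpoon H x psi (y * u))) n)).
- rewrite (act_tgtE NP); apply: eq_bigr => z _; rewrite -act_src_sum.
  have := cop_tr_sum H (harpoon_balAop u pP) z.1; rewrite mul1r cou_mul_src_tgt.
  move=> <-; congr (act (src B _) _); apply: eq_bigr => y _.
  by apply: eq_bigr => q _; rewrite mulrA.
- move=> n; split=> [x x' y|x y y'|a x y].
  + by rewrite harpoonD // rmorphD (actDl NP).
  + by rewrite mulrDl (homND (harpoon_dualU x pP)) rmorphD (actDl NP).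
  + by rewrite harpoon_tgt // mulrA.
- by move=> x; apply/dual_tens_balN/harpoon_dualU.
Qed.

Variables (r : nat) (e_ : 'I_r -> U) (e' : 'I_r -> U -> A).
Hypothesis EP : dual_basis B e_ e'.

Lemma dual_basis_dualU j : dualU (e' j).
Proof.
have [D T] := EP.1 j; split=> [u v|a u]; last by rewrite T canact_tgt.
by have := D 1 u v; rewrite !scale1r.
Qed.
Local Notation ejP := dual_basis_dualU.

Lemma dual_basisE u : u = \sum_(j < r) tgt B (e' j u) * e_ j.
Proof. exact: EP.2. Qed.

(** When $U$ has a dual basis, the maps [dual_tens chi n] span
    $\mathrm{Hom}_{A^{op}}(U, N)$. *)
Lemma homN_ind (P : (U -> N) -> Prop) :
  P (fun=> 0) ->
  (forall f h, homN f -> homN h -> P f -> P h -> P (fun u => f u + h u)) ->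
  (forall chi n, dualU chi -> P (dual_tens chi n)) ->
  forall f, homN f -> P f.
Proof.
move=> P0 PD PT f fP.
have PS I (s : seq I) (F : I -> U -> N) : (forall i, homN (F i)) ->
    (forall i, P (F i)) -> P (fun u => \sum_(i <- s) F i u).
  move=> FP PF; elim: s => [|i s IH].
    by rewrite (_ : (fun u => _) = (fun=> 0)) //; apply: funext => u; rewrite big_nil.
  rewrite (_ : (fun u => _) = (fun u => F i u + \sum_(i <- s) F i u)).
    by apply: PD => //; apply: homN_sum.
  by apply: funext => u; rewrite big_cons.
have hP j x := harpoon_dualU x (ejP j).
rewrite (_ : f = fun u => \sum_(j < r) \sum_(z <- co (f (e_ j)))
    dual_tens (harpoon H z.1 (e' j)) z.2 u).
  apply: (PS) => j; first by apply: homN_sum => z; apply: dual_tens_homN.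
  by apply: PS => z; [apply: dual_tens_homN|apply: PT].
apply: funext => u; rewrite {1}(dual_basisE u) homN_sumr //.
by apply: eq_bigr => j _; rewrite (homN_tgt fP) (act_tgt_dual_tens _ _ (ejP j)).
Qed.

Local Notation gN := (induced_contra H gA lact co e_ e').

Lemma gNE f : gN f = \sum_(j < r) \sum_(x <- co (f (e_ j)))
  act (src B (gA (harpoon H x.1 (e' j)))) x.2.
Proof.
by apply: eq_bigr => j _; apply: eq_bigr => x _; rewrite (lactE NP).
Qed.

Lemma gND f h : gN (fun u => f u + h u) = gN f + gN h.
Proof.
rewrite !gNE -big_split; apply: eq_bigr => j _.
exact: (co_sumD NP (harpoon_balN (ejP j))).
Qed.

Lemma eq_gN f h : (forall u, f u = h u) -> gN f = gN h.
Proof. by move=> e; congr gN; apply: funext. Qed.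

Lemma gN0 : gN (fun=> 0) = 0.
Proof.
apply: (addrI (gN (fun=> 0))); rewrite -gND [RHS]addr0.
by apply: eq_gN => u; rewrite addr0.
Qed.

Lemma gN_sum I (s : seq I) (F : I -> U -> N) :
  gN (fun u => \sum_(i <- s) F i u) = \sum_(i <- s) gN (F i).
Proof.
elim: s => [|i s IH].
  by rewrite big_nil -[RHS]gN0; apply: eq_gN => u; rewrite big_nil.
by rewrite big_cons -IH -gND; apply: eq_gN => u; rewrite big_cons.
Qed.

(** $\sum_j \chi(u_{(1)} e_j) (u_{(2)} \rightharpoondown e^j)(v) =
    \chi(s(\varepsilon(u)) v)$ *)
Lemma harpoon_dual_basis chi u v : dualU chi ->
  \sum_(j < r) \sum_(y <- cop B u) chi (y.1 * e_ j) * harpoon H y.2 (e' j) v =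
  chi (src B (cou B u) * v).
Proof.
move=> cP.
transitivity (\sum_(j < r) \sum_(p <- tr H u) chi (p.1 * tgt B (e' j (p.2 * v)) * e_ j)).
  apply: eq_bigr => j _; have bP := harpoon_balAop v (ejP j).
  pose F x y z : A := chi (x * e_ j) * cou B (y * tgt B (e' j (z * v))).
  transitivity (\sum_(y <- cop B u) \sum_(p <- tr H y.2) F y.1 p.1 p.2).
    by apply: eq_bigr => y _; rewrite mulr_sumr.
  rewrite -(tr_cop_sum H (F := F)).
  - apply: eq_bigr => p _; rewrite -tgt_counitr mulr_suml dualU_sum //.
    by apply: eq_bigr => y _; rewrite -mulrA dualU_tgt.
  - move=> z; split=> *.
    + by rewrite /F mulrDl (homND cP) mulrDl.
    + by rewrite /F mulrDl linearD mulrDr.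
    + by rewrite /F -!mulrA dualU_tgt // cou_src mulrA.
  - by move=> x; split=> *; rewrite /F ?(bal2Dl bP) ?(bal2Dr bP) ?(bal2A bP) // mulrDr.
rewrite exchange_big -(tr_mul H) mulr_suml dualU_sum //; apply: eq_bigr => p _.
rewrite -mulrA {2}(dual_basisE (p.2 * v)) mulr_sumr dualU_sum //.
by apply: eq_bigr => j _; rewrite mulrA.
Qed.

(** The induced contraaction on the spanning maps; by [homN_ind] these values
    determine it. *)
Lemma gN_dual_tens chi n : dualU chi -> gN (dual_tens chi n) = act (src B (gA chi)) n.
Proof.
move=> cP; rewrite gNE.
pose G j x y m := act (src B (gA (fun v => chi (x * e_ j) * harpoon H y (e' j) v))) m.
have dP j a y : dualU (fun v => a * harpoon H y (e' j) v).
  split=> [v v'|b v]; first by rewrite (homND (harpoon_dualU y (ejP j))) mulrDr.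
  by rewrite (dualU_tgt _ _ (harpoon_dualU y (ejP j))) canact_tgt mulrA.
have gaD phi psi : dualU phi -> dualU psi ->
    gA (fun v => phi v + psi v) = gA phi + gA psi by exact: (cc_add gAP).
transitivity (\sum_(j < r) \sum_(z <- co n) \sum_(y <- cop B z.1) G j y.1 y.2 z.2).
  apply: eq_bigr => j _; rewrite (@co_coassoc_sum _ _ _ _ _ _ _ _ _ _ NP _ (G j)).
  - rewrite (co_sum_big NP _ _ (harpoon_balN (ejP j))); apply: eq_bigr => z _.
    rewrite (co_sum_src NP (harpoon_balN (ejP j))); apply: eq_bigr => y _.
    by congr (act (src B _) _); apply: eq_gA => v; rewrite harpoon_src //; apply: ejP.
  - move=> m; split=> [x x' y|x y y'|a x y].
    + rewrite -(actDl NP) -rmorphD -gaD //.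
      by congr (act (src B _) m); apply: eq_gA => v; rewrite mulrDl (homND cP) mulrDl.
    + rewrite -(actDl NP) -rmorphD -gaD //; congr (act (src B _) m); apply: eq_gA => v.
      by rewrite harpoonD ?mulrDr //; apply: ejP.
    + congr (act (src B _) m); apply: eq_gA => v.
      by rewrite -mulrA dualU_tgt // harpoon_src ?mulrA //; apply: ejP.
  - move=> x; split=> [y y' m|y m m'|a y m].
    + rewrite -(actDl NP) -rmorphD -gaD //; congr (act (src B _) m); apply: eq_gA => v.
      by rewrite harpoonD ?mulrDr //; apply: ejP.
    + exact: linearD.
    + rewrite /G -act_srcM -(gA_src a (dP j _ y)); congr (act (src B _) m).
      by apply: eq_gA => v; rewrite harpoon_tgt //; apply: ejP.
rewrite exchange_big -[RHS](congr1 _ (co_counit NP n)) linear_sum.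
apply: eq_bigr => z _; rewrite /= -act_srcM -(gA_src _ cP).
under eq_bigr do rewrite -act_src_sum.
rewrite -act_src_sum; congr (act (src B _) _).
transitivity (gA (fun v => \sum_(j < r) \sum_(y <- cop B z.1)
    chi (y.1 * e_ j) * harpoon H y.2 (e' j) v)); last first.
  by apply: eq_gA => v; rewrite harpoon_dual_basis.
rewrite (gm_sum gAP) => [|j]; last by apply: homN_sum => y; apply: dP.
by apply: eq_bigr => j _; rewrite (gm_sum gAP) // => y; apply: dP.
Qed.

Lemma gN_src a f : homN f -> gN (fun u => f (src B a * u)) = act (tgt B a) (gN f).
Proof.
move: f; apply: homN_ind => [|f h _ _ Ef Eh|chi n cP].
- by rewrite gN0 linear0.
- by rewrite gND Ef Eh gND linearD.
- rewrite (gN_dual_tens _ cP) (act_tgt_src NP) -(gN_dual_tens _ cP); apply: eq_gN => u.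
  rewrite [RHS](co_sum_tgt NP _ _ (dual_tens_balN u cP)).
  by apply: eq_bigr => z _; rewrite mulrA.
Qed.

Lemma gN_tgtr a f : homN f ->
  gN (fun w => f (w * tgt B a)) = gN (fun w => act (src B a) (f w)).
Proof.
move: f; apply: homN_ind => [|f h _ _ Ef Eh|chi n cP].
- by apply: eq_gN => u; rewrite linear0.
- by rewrite gND Ef Eh -gND; apply: eq_gN => u; rewrite linearD.
- have c1P : dualU (fun w => chi (w * tgt B a)) by apply: homN_mulr.
  have c2P : dualU (fun w => canact B (src B a) (chi w)).
    split=> [u v|b u]; first by rewrite (homND cP) linearD.
    by rewrite dualU_tgt // !canact_src canact_tgt mulrA.
  transitivity (gN (dual_tens (fun w => chi (w * tgt B a)) n)).
    by apply: eq_gN => w; apply: eq_bigr => z _; rewrite mulrA.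
  rewrite (gN_dual_tens _ c1P) (cc_tgtr gAP) // -(gN_dual_tens _ c2P).
  apply: eq_gN => w; rewrite /dual_tens linear_sum; apply: eq_bigr => z _.
  by rewrite canact_src act_srcM.
Qed.

Lemma gN_mul f n : homN f ->
  gN (fun u => \sum_(x <- co n) mul (f (x.1 * u)) x.2) = mul (gN f) n.
Proof.
move: f; apply: homN_ind => [|f h _ _ Ef Eh|chi m cP].
- have mul0 p : mul 0 p = 0 by apply: (addrI (mul 0 p)); rewrite -(mulDl NP) !addr0.
  by rewrite gN0 mul0 -[RHS]gN0; apply: eq_gN => u; rewrite big1.
- rewrite gND (mulDl NP) -Ef -Eh -gND; apply: eq_gN => u; rewrite -big_split.
  by apply: eq_bigr => x _; rewrite (mulDl NP).
- rewrite (gN_dual_tens _ cP) -(src_mulN NP) -(gN_dual_tens _ cP); apply: eq_gN => u.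
  rewrite [RHS](co_sumM NP (dual_tens_balN u cP)) [RHS]exchange_big.
  apply: eq_bigr => x _; rewrite (mul_suml NP); apply: eq_bigr => z _ /=.
  by rewrite (src_mulN NP) mulrA.
Qed.

Lemma gN_counit m : gN (fun u => act (tgt B (cou B u)) m) = m.
Proof.
have cP : dualU (cou B).
  by split=> [u v|a u]; rewrite ?linearD // cou_tgt canact_tgt.
have g1 : gA (cou B) = 1.
  by rewrite -[RHS](cc_counit gAP); apply: eq_gA => u; rewrite canact_tgt mul1r.
rewrite -[RHS](act_one NP) -(rmorph1 (src B)) -g1 -(gN_dual_tens _ cP).
apply: eq_gN => u; rewrite (act_tgtE NP); apply: eq_bigr => z _.
by rewrite -couM_src.
Qed.

Lemma gN_tgt psi m : dualU psi -> gN (fun u => act (tgt B (psi u)) m) =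
  \sum_(z <- co m) act (src B (gA (harpoon H z.1 psi))) z.2.
Proof.
move=> pP; transitivity (gN (fun u =>
    \sum_(z <- co m) dual_tens (harpoon H z.1 psi) z.2 u)).
  by apply: eq_gN => u; rewrite (act_tgt_dual_tens _ _ pP).
rewrite gN_sum; apply: eq_bigr => z _; apply: gN_dual_tens.
exact: harpoon_dualU.
Qed.

(** The product $u \mapsto \phi(s(\psi(u_{(1)})) u_{(2)})$ of $U^*$. *)
Definition conv psi phi u : A := \sum_(x <- cop B u) phi (src B (psi x.1) * x.2).

Lemma conv_balA psi phi : dualU psi -> dualU phi ->
  balA B (fun x y => phi (src B (psi x) * y)).
Proof.
move=> pP fP; split=> [x x' y|x y y'|a x y].
- by rewrite (homND pP) rmorphD mulrDl (homND fP).
- by rewrite mulrDr (homND fP).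
- by rewrite dualU_tgt // rmorphM mulrA.
Qed.

Lemma conv_dualU psi phi : dualU psi -> dualU phi -> dualU (conv psi phi).
Proof.
move=> pP fP; have bP := conv_balA pP fP; split=> [u v|a u].
  exact: (cop_sumD bP).
rewrite /conv (cop_sum_tgtl bP) canact_tgt mulr_suml; apply: eq_bigr => x _.
by rewrite mulrA src_tgtC -mulrA dualU_tgt.
Qed.

Lemma gA_conv psi phi : dualU psi -> dualU phi ->
  gA (conv psi phi) = gA (fun u => gA phi * psi u).
Proof.
move=> pP fP; rewrite -(cc_assoc gAP (conv_balA pP fP)).
  by apply: eq_gA => u; rewrite gA_src.
move=> u; split=> [v v'|a v]; first by rewrite mulrDr (homND fP).
by rewrite mulrA src_tgtC -mulrA (homN_tgt fP).
Qed.

Lemma dual_tens_conv psi phi n u : dualU psi -> dualU phi ->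
  \sum_(x <- cop B u) dual_tens phi n (src B (psi x.1) * x.2) =
  \sum_(z <- co n) dual_tens (conv (harpoon H z.1 psi) phi) z.2 u.
Proof.
move=> pP fP; have hP x := harpoon_dualU x pP.
transitivity (\sum_(z <- co n) \sum_(y <- co z.2)
  act (src B (conv (harpoon H z.1 psi) phi (y.1 * u))) y.2); last by [].
rewrite -(@co_coassoc_sum _ _ _ _ _ _ _ _ _ _ NP _ (fun x y n =>
  act (src B (conv (harpoon H x psi) phi (y * u))) n)).
- rewrite exchange_big; apply: eq_bigr => z _ /=.
  rewrite -!act_src_sum; congr (act (src B _) _).
  pose F v x y z := phi (src B (harpoon H x psi (y * v)) * z).
  have FP v x z' : balA B (fun y z => F v x y (z * z')).
    by apply: (balA_mull v (balA_mulr z' (conv_balA (hP x) fP))).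
  transitivity (\sum_(v <- cop B u) \sum_(x <- cop B z.1) \sum_(y <- cop B x.2)
      F v.1 x.1 y.1 (y.2 * v.2)); last first.
    rewrite exchange_big; apply: eq_bigr => x _ /=.
    rewrite /conv (cop_sumM (conv_balA (hP x.1) fP)) exchange_big /=.
    by apply: eq_bigr => y _; apply: eq_bigr => v _; rewrite /F.
  apply: eq_bigr => v _; rewrite -(@cop_coassoc_sum _ _ _ _ _
      (fun x y z => F v.1 x y (z * v.2))); last first.
  + by move=> x; apply: FP.
  + move=> z'; split=> [x x' y|x y y'|a x y].
    * by rewrite /F harpoonD // rmorphD mulrDl (homND fP).
    * by rewrite /F mulrDl (homND (hP x)) rmorphD mulrDl (homND fP).
    * by rewrite /F harpoon_tgt // -[src B a * y * _]mulrA.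
  rewrite mulrA -src_counitl mulr_suml dualU_sum //; apply: eq_bigr => x _ /=.
  have := cop_tr_sum H (harpoon_balAop v.1 pP) x.1; rewrite mul1r cou_mul_src_tgt.
  move=> <-; rewrite rmorph_sum -mulrA mulr_suml dualU_sum //.
  apply: eq_bigr => y _; rewrite /F /harpoon; congr (phi (src B _ * _)).
  by apply: eq_bigr => q _; rewrite mulrA.
- move=> m; split=> [x x' y|x y y'|a x y].
  + rewrite -(actDl NP) -rmorphD -big_split; congr (act (src B _) _).
    by apply: eq_bigr => v _; rewrite harpoonD // rmorphD mulrDl (homND fP).
  + by rewrite mulrDl (homND (conv_dualU (hP x) fP)) rmorphD (actDl NP).
  + congr (act (src B _) _); rewrite -mulrA /conv.
    rewrite (cop_sum_srcl (conv_balA (hP x) fP)); apply: eq_bigr => v _.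
    by rewrite harpoon_tgt.
- by move=> x; apply/dual_tens_balN/conv_dualU.
Qed.

(** Contraassociativity for the functions $(u, v) \mapsto f(s(\psi(u)) v)$, of
    which every function is a sum by the dual basis. *)
Lemma gN_conv psi f : dualU psi -> homN f ->
  gN (fun u => act (tgt B (psi u)) (gN f)) =
  gN (fun u => \sum_(x <- cop B u) f (src B (psi x.1) * x.2)).
Proof.
move=> pP; move: f; apply: homN_ind => [|f h _ _ Ef Eh|phi n fP].
- by rewrite gN0; apply: eq_gN => u; rewrite linear0 big1.
- transitivity (gN (fun u => act (tgt B (psi u)) (gN f) + act (tgt B (psi u)) (gN h))).
    by apply: eq_gN => u; rewrite gND linearD.
  by rewrite gND Ef Eh -gND; apply: eq_gN => u; rewrite -big_split.
- rewrite gN_tgt // (gN_dual_tens _ fP) (co_sum_src NP (harpoon_balN pP)).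
  transitivity (gN (fun u => \sum_(z <- co n)
      dual_tens (conv (harpoon H z.1 psi) phi) z.2 u)); last first.
    by apply: eq_gN => u; rewrite dual_tens_conv.
  have hP x := harpoon_dualU x pP.
  rewrite gN_sum; apply: eq_bigr => z _.
  rewrite gN_dual_tens; last exact: conv_dualU.
  by rewrite gA_conv //; congr (act (src B _) _); apply: eq_gA => u; rewrite harpoon_src.
Qed.

Lemma gN_assoc (h : U -> U -> N) : balA B h -> (forall u, homN (h u)) ->
  gN (fun u => gN (h u)) = gN (fun u => \sum_(x <- cop B u) h x.1 x.2).
Proof.
move=> hP hN.
have hE u v : h u v = \sum_(j < r) h (e_ j) (src B (e' j u) * v).
  rewrite {1}(dual_basisE u).
  rewrite (additive_sum (f := h^~ v)) => [|x y]; last exact: (bal2Dl hP).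
  by apply: eq_bigr => j _; rewrite (bal2A hP).
transitivity (gN (fun u => \sum_(j < r) act (tgt B (e' j u)) (gN (h (e_ j))))).
  apply: eq_gN => u; rewrite -(eq_bigr _ (fun j _ => gN_src (e' j u) (hN (e_ j)))).
  by rewrite -gN_sum; apply: eq_gN => v; rewrite hE.
rewrite gN_sum; under eq_bigr do rewrite (gN_conv (ejP _) (hN _)).
rewrite -gN_sum; apply: eq_gN => u; rewrite exchange_big; apply: eq_bigr => x _.
by rewrite -hE.
Qed.

(** * The induced anti Yetter-Drinfel'd condition *)

Section AntiYetterDrinfeld.
Variable chi : U -> A.
Hypothesis cP : dualU chi.

(* $y_+ \cdot \chi(y_- w x)$ *)
Let theta x y w : A := \sum_(p <- tr H y) canact B p.1 (chi (p.2 * w * x)).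

Let theta_balAop x w : balAop B (fun p q => canact B p (chi (q * w * x))).
Proof.
have := act_balAop (base_YDalgebra B) (homN_mulr w (homN_mulr x cP)).
by [].
Qed.

Let theta_dualU x y : dualU (theta x y).
Proof.
split=> [w w'|a w].
  rewrite -big_split; apply: eq_bigr => p _.
  by rewrite mulrDr mulrDl (homND cP) linearD.
rewrite canact_tgt /theta; under eq_bigr do rewrite mulrA.
rewrite -(tr_takeuchi_sum H (theta_balAop x w)) mulr_suml; apply: eq_bigr => p _.
by rewrite !canactE -mulrA cou_tgt.
Qed.

Let thetaDl x x' y w : theta (x + x') y w = theta x y w + theta x' y w.
Proof.
rewrite -big_split; apply: eq_bigr => p _.
by rewrite mulrDr (homND cP) linearD.
Qed.

Let thetaDr x y y' w : theta x (y + y') w = theta x y w + theta x y' w.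
Proof. exact: (tr_sumD H (theta_balAop x w)). Qed.

Let theta_src x a y w : theta x (src B a * y) w = a * theta x y w.
Proof.
rewrite /theta (tr_sum_srcl H (theta_balAop x w)) mulr_sumr.
by apply: eq_bigr => p _; rewrite !canactE -mulrA cou_src.
Qed.

Let theta_tgt x a y w : theta x (tgt B a * y) w = theta x y (src B a * w).
Proof.
rewrite /theta (tr_sum_tgtl H (theta_balAop x w)).
by apply: eq_bigr => p _; rewrite !mulrA.
Qed.

(* For a fixed $x$ the anti Yetter-Drinfel'd condition holds before the
   contraaction is applied, by the Yetter-Drinfel'd condition of $N$.  It is
   not balanced in $x \otimes_A v$, which is why the coproducts of $u$ are
   rearranged under the contraaction in the next lemma. *)
Let YD_transport x v m w :
  \sum_(y <- cop B v) dual_tens (theta x y.1) (act y.2 m) w =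
  \sum_(p <- tr H v) act p.1 (dual_tens chi m (p.2 * w * x)).
Proof.
pose K (a b : U) n := act (src B (theta x a (b * w))) n.
have KN (a : U) : balN (K a) := dual_tens_balN w (theta_dualU x a).
have KA n : balA B (fun a b : U => K a b n).
  split=> [a a' b|a b b'|c a b].
  - by rewrite /K thetaDr rmorphD (actDl NP).
  - by rewrite /K mulrDl (homND (theta_dualU x a)) rmorphD (actDl NP).
  - by rewrite /K theta_tgt mulrA.
pose G (a b : U) q := \sum_(z <- co (act b m)) K a (z.1 * q) z.2.
have GA q : balA B (fun a b : U => G a b q).
  split=> [a a' b|a b b'|c a b].
  - rewrite -big_split; apply: eq_bigr => z _; exact: (bal2Dl (KA _)).
  - by rewrite /G (actDl NP) (co_sumD NP (balN_mull (KN a) q)).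
  - rewrite /G (act_mul NP) (co_sum_src NP (balN_mull (KN a) q)).
    by apply: eq_bigr => z _; rewrite (bal2A (KA _)) mulrA.
have GB (a : U) : balA B (G a) by apply: (balA_co NP m (KN a)).
pose Om v q := \sum_(y <- cop B v) G y.1 y.2 q.
have OmP : balA B Om.
  split=> [v1 v2 q|v1 q q'|c v1 q].
  - exact: (cop_sumD (GA q)).
  - by rewrite -big_split; apply: eq_bigr => y _; apply: (bal2Dr (GB _)).
  - rewrite /Om (cop_sum_tgtl (GA q)); apply: eq_bigr => y _.
    exact: (bal2A (GB _)).
transitivity (Om v 1).
  apply: eq_bigr => y _; apply: eq_bigr => z _; by rewrite /K mulr1.
rewrite -(tr_galois_sum H v OmP); apply: eq_bigr => p _.
rewrite (@cop_coassoc_sum _ _ _ _ _ (fun a b c : U => G a b (c * p.2))); last first.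
- by move=> a; apply: (balA_mulr p.2 (GB a)).
- by move=> c; apply: GA.
have KNp (a : U) : balN (fun (b : U) n => K a (b * p.2) n) := balN_mull (KN a) p.2.
transitivity (\sum_(y <- cop B p.1) \sum_(y' <- cop B y.2) \sum_(z <- co m)
    K y.1 (y'.1 * z.1 * p.2) (act y'.2 z.2)).
  apply: eq_bigr => y _; rewrite -(YD_sum NP y.2 m (KNp y.1)).
  by apply: eq_bigr => y' _; apply: eq_bigr => z _; rewrite mulrA.
rewrite -(@cop_coassoc_sum _ _ _ _ _ (fun a b c : U => \sum_(z <- co m)
    K a (b * z.1 * p.2) (act c z.2))); last first.
- by move=> a; apply: (balA_co_act NP m (KNp a)).
- move=> c; apply: bal2_sum => z.
  by apply: (balA_mulr z.1 (balA_mulr p.2 (KA _))).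
rewrite linear_sum; under eq_bigr do rewrite exchange_big /=.
rewrite exchange_big; apply: eq_bigr => z _ /=.
rewrite -(act_mul NP) -src_counitl (act_suml NP).
apply: eq_bigr => y _; rewrite (act_mul NP) /K -act_src_sum.
congr (act (src B _) _).
have := cop_tr_sum H (theta_balAop x (z.1 * p.2 * w)) y.1; rewrite mul1r.
rewrite -[X in _ -> _ = X]/(canact B y.1 (chi (z.1 * (p.2 * w * x)))) !mulrA => <-; apply: eq_bigr => y' _; apply: eq_bigr => q _.
by rewrite !mulrA.
Qed.

Lemma gN_aYD_dual_tens u m : act u (gN (dual_tens chi m)) = gN (fun w =>
  \sum_(x <- cop B u) \sum_(p <- tr H x.2) act p.1 (dual_tens chi m (p.2 * w * x.1))).
Proof.
pose Phi x y n := act (src B (gA (theta x y))) n.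
have gaD phi psi : dualU phi -> dualU psi ->
    gA (fun v => phi v + psi v) = gA phi + gA psi by exact: (cc_add gAP).
transitivity (\sum_(x <- cop B u) \sum_(y <- cop B x.1) Phi y.1 y.2 (act x.2 m)).
  rewrite gN_dual_tens // -(act_mul NP) -src_counitl (act_suml NP).
  apply: eq_bigr => x _; rewrite (act_mul NP) -act_src_sum.
  congr (act (src B _) _); rewrite -[LHS]/(canact B x.1 (gA chi)).
  by rewrite (cc_aYD gAP) // (gm_sum gAP) // => y; apply: theta_dualU.
rewrite (@cop_coassoc_sum _ _ _ _ _ (fun x y z => Phi x y (act z m))).
- rewrite gN_sum; apply: eq_bigr => x _.
  transitivity (gN (fun w => \sum_(y <- cop B x.2)
      dual_tens (theta x.1 y.1) (act y.2 m) w)); last first.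
    by apply: eq_gN => w; rewrite YD_transport.
  by rewrite gN_sum; apply: eq_bigr => y _; rewrite gN_dual_tens.
- move=> z; split=> [x x' y|x y y'|a x y].
  + rewrite -(actDl NP) -rmorphD -gaD //.
    by congr (act (src B _) _); apply: eq_gA => w; rewrite thetaDl.
  + rewrite -(actDl NP) -rmorphD -gaD //.
    by congr (act (src B _) _); apply: eq_gA => w; rewrite thetaDr.
  + congr (act (src B _) _).
    transitivity (gA (fun w => theta x y (w * tgt B a))).
      by apply: eq_gA => w; apply: eq_bigr => p _; rewrite !mulrA.
    rewrite (cc_tgtr gAP) //.
    by apply: eq_gA => w; rewrite canact_src theta_src.
- move=> x; split=> [y y' z|y z z'|a y z].
  + rewrite -(actDl NP) -rmorphD -gaD //.
    by congr (act (src B _) _); apply: eq_gA => w; rewrite thetaDr.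
  + by rewrite (actDl NP) /Phi linearD.
  + rewrite (act_mul NP) /Phi -act_srcM -(gA_src a (theta_dualU x y)).
    by congr (act (src B _) _); apply: eq_gA => w; rewrite theta_tgt.
Qed.

End AntiYetterDrinfeld.

Lemma gN_aYD u f : homN f -> act u (gN f) = gN (fun w =>
  \sum_(x <- cop B u) \sum_(p <- tr H x.2) act p.1 (f (p.2 * w * x.1))).
Proof.
move: f; apply: homN_ind => [|f h _ _ Ef Eh|chi n cP].
- rewrite gN0 linear0 -[LHS]gN0; apply: eq_gN => w.
  by rewrite big1 // => x _; rewrite big1 // => p _; rewrite linear0.
- rewrite gND linearD Ef Eh -gND; apply: eq_gN => w.
  rewrite -big_split; apply: eq_bigr => x _; rewrite -big_split.
  by apply: eq_bigr => p _; rewrite linearD.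
- exact: gN_aYD_dual_tens.
Qed.

Theorem induced_cyc_contra : stable act gN -> cyc_contra H act co mul gN.
Proof.
move=> gN_stable; split.
- by move=> f h _ _; apply: gND.
- exact: gN_assoc.
- exact: gN_mul.
- exact: gN_counit.
- exact: gN_stable.
- exact: gN_tgtr.
- exact: gN_aYD.
Qed.

End Induced.

(** * The two cyclic operads *)

Lemma mulractE (k : comNzRingType) (A U : algType k) (B : bialgebroid A U) a b :
  @mulract k A a b = canact B (tgt B a) b.
Proof. by rewrite canact_tgt. Qed.

(** Over the base algebra, insertion from the left and from the right agree up
    to the numbering of the inputs: the coefficients $u_{(2)} \cdot 1 =
    t(\varepsilon(u_{(2)})) \cdot 1$ are absorbed by the arguments. *)
Lemma circN_base (k : comNzRingType) (A U : algType k) (B : bialgebroid A U)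
    p q i (f : cochain B (@mulract k A) p) (h : q.-tuple U -> A) us :
  (0 < i <= p)%N ->
  circN B (canact B) (base_co B) *%R (p.+1 - i) f h us = circA B i f h us.
Proof.
move=> /andP[i0 ip]; rewrite /circN /circA.
have -> : ((p.+1 - i).-1 = p - i)%N by lia.
rewrite exchange_big; apply: eq_bigr => ys _ /=.
under eq_bigr do rewrite big_seq1 /=.
have fP := mixN_mul (base_YDalgebra B) (evs_coch (@mulractE _ _ _ B) f).
set a := take _ us; set l := _ :: _.
by have := Sw_counitr (base_YDalgebra B) a l fP; rewrite mulr1 => <-.
Qed.

Theorem theorem5p1 (k : comNzRingType) (A U : algType k) (B : bialgebroid A U)
    (H : left_hopf B) (gA : (U -> A) -> A)
    (A_aYD : is_aYD H (canact B) (@mulract k A) gA)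
    (A_stable : stable (canact B) gA) :
  (let C := cochain B (@mulract k A) in
   exists (one : C 1%N) (circ : forall p q : nat, nat -> C p -> C q -> C (p + q).-1)
          (mu : C 2%N) (e : C 0%N) (tau : forall n, C n -> C n),
     [/\ forall u, one [tuple u] = cou B u,
         forall u v, mu [tuple u; v] = cou B (u * v),
         e [tuple] = 1,
         forall p q i (f : C p) (h : C q), (0 < i <= p)%N ->
           forall us, circ p q i f h us = circA B i f h us &
         forall n (f : C n) us, tau n f us = tau_fun H (canact B) gA f us]
     /\ is_cyclic_operad_mult (O := C) one circ mu e tau)
  /\
  (fg_projective B ->
   forall (N : lmodType k) (act : U -> {linear N -> N})
     (lact : A -> {linear N -> N}) (co : N -> seq (U * N))
     (mul : N -> N -> N) (oneN : N),
   is_YDalgebra B act lact co mul oneN ->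
   braided_comm act co mul ->
   forall (r : nat) (e_ : 'I_r -> U) (e' : 'I_r -> U -> A),
   dual_basis B e_ e' ->
   let gN := induced_contra H gA lact co e_ e' in
   stable act gN ->
   let C := cochain B (fun a => act (tgt B a)) in
   exists (one : C 1%N) (circ : forall p q : nat, nat -> C p -> C q -> C (p + q).-1)
          (mu : C 2%N) (e : C 0%N) (tau : forall n, C n -> C n),
     [/\ forall u, one [tuple u] = lact (cou B u) oneN,
         forall u v, mu [tuple u; v] = lact (cou B (u * v)) oneN,
         e [tuple] = oneN,
         forall p q i (f : C p) (h : C q), (0 < i <= p)%N ->
           forall us, circ p q i f h us = circN B act co mul i f h us &
         forall n (f : C n) us, tau n f us = tau_fun H act gN f us]
     /\ is_operad_mult (O := C) one circ mu e
     /\ is_cyclic_operad_mult (O := C) one (rev_circ circ) mu e tau).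
Proof.
have gP := base_cyc_contra A_aYD A_stable; split=> [C|].
  have [one [circ [mu [e [tau [[oneE muE eE circE tauE] [_ cycP]]]]]]] :=
    cochain_cyclic_operad (base_YDalgebra B) (base_braided B) gP (@mulractE _ _ _ B).
  exists one, (rev_circ (O := C) circ), mu, e, tau; split=> //.
  have lactE1 a : base_lact B a 1 = a by rewrite /base_lact canact_src mulr1.
  split=> // [u|u v|p q i f h /andP[i0 ip] us].
  - by rewrite oneE lactE1.
  - by rewrite muE lactE1.
  - rewrite /rev_circ ip circE; last by lia.
    by apply: circN_base; rewrite i0.
move=> _ N act lact co mul oneN NP BC r e_ e' EP gN gN_stable C.
exact: (cochain_cyclic_operad NP BC (induced_cyc_contra NP gP EP gN_stable)
  (fun _ _ => erefl)).
Qed.
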